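(* There is a unital simple purely infinite C*-algebra $A$ such that each pair of projections in $A$ satisfies $[\mathrm{KP}_n]$ for every $n \in \mathbb{N}$, and yet $A$ contains a pair of unitary elements for which $[\mathrm{KP}_2]$ fails.
   Context: $\mathbb{N}=\{1,2,\dots\}$. Elements $x,y$ of a unital C*-algebra $B$ are approximately unitarily equivalent in $B$, written $x\simeq_a y$, if there is a sequence $(u_m)$ of unitaries of $B$ with $u_m^*xu_m \to y$ in norm. For $a\in A$, $a^{(n)} \in M_n(A)$ is the $n$-fold direct sum of $a$ with itself. A pair $a,b\in A$ satisfies $[\mathrm{KP}_n]$ if the implication ''$a^{(n)}\simeq_a b^{(n)}$ in $M_n(A)$ implies $a \simeq_a b$ in $A$'' holds; $[\mathrm{KP}_n]$ fails for $a,b$ if $a^{(n)}\simeq_a b^{(n)}$ in $M_n(A)$ but $a \not\simeq_a b$ in $A$. A projection is infinite if it is Murray–von Neumann equivalent to a proper subprojection of itself; a simple C*-algebra is purely infinite if every nonzero hereditary C*-subalgebra contains an infinite projection. *)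

(* Defs.v *)
From HB Require Import structures.
From mathcomp Require Import all_boot all_order all_algebra.
From mathcomp Require Import complex.
From mathcomp Require Import all_classical all_reals all_analysis.

Set Implicit Arguments.
Unset Strict Implicit.
Unset Printing Implicit Defensive.

Import Order.TTheory GRing.Theory Num.Theory.
Import numFieldNormedType.Exports.

Local Open Scope classical_set_scope.
Local Open Scope ring_scope.

HB.mixin Record PzRing_isStarRing A of GRing.PzRing A := {
  star : A -> A;
  starK : involutive star;
  starD : {morph star : x y / x + y};
  starM : forall x y, star (x * y) = star y * star x }.

#[short(type="starRingType")]
HB.structure Definition StarRing := { A of PzRing_isStarRing A & GRing.PzRing A }.

(* A (nonzero) unital C*-algebra is a complex Banach space with a product, a unit and an
   involution. The hierarchy has no join of rings and normed modules other than
   the number structures, so the ring structure is put on the alias [ring_of]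
   below. The norm takes its (real) values in [R[i]]. *)
HB.mixin Record isCStarAlgebra (R : realType) A
    of CompleteNormedModule R[i] A := {
  cs_mul : A -> A -> A;
  cs_one : A;
  cs_star : A -> A;
  cs_mulA : associative cs_mul;
  cs_mul1 : left_id cs_one cs_mul;
  cs_mulr1 : right_id cs_one cs_mul;
  cs_mulDl : left_distributive cs_mul +%R;
  cs_mulDr : right_distributive cs_mul +%R;
  cs_one_neq0 : cs_one != 0;
  cs_scaleAl : forall (c : R[i]) (x y : A), c *: cs_mul x y = cs_mul (c *: x) y;
  cs_scaleAr : forall (c : R[i]) (x y : A), c *: cs_mul x y = cs_mul x (c *: y);
  cs_starK : involutive cs_star;
  cs_starD : {morph cs_star : x y / x + y};
  cs_starM : forall x y, cs_star (cs_mul x y) = cs_mul (cs_star y) (cs_star x);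
  cs_starZ : forall (c : R[i]) (x : A), cs_star (c *: x) = (c^* )%R *: cs_star x;
  cs_normM : forall x y : A, `|cs_mul x y| <= `|x| * `|y|;
  cs_normCstar : forall x : A, `|cs_mul (cs_star x) x| = `|x| ^+ 2 }.

#[short(type="cstarAlgType")]
HB.structure Definition CStarAlgebra (R : realType) :=
  { A of isCStarAlgebra R A & CompleteNormedModule R[i] A }.

Definition ring_of (R : realType) (A : cstarAlgType R) : Type := A.

HB.instance Definition _ (R : realType) (A : cstarAlgType R) :=
  GRing.Lmodule.copy (ring_of A) A.
HB.instance Definition _ (R : realType) (A : cstarAlgType R) :=
  GRing.Zmodule_isNzRing.Build (ring_of A) (@cs_mulA R A) (@cs_mul1 R A)
    (@cs_mulr1 R A) (@cs_mulDl R A) (@cs_mulDr R A)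
    (@cs_one_neq0 R A).
HB.instance Definition _ (R : realType) (A : cstarAlgType R) :=
  GRing.LSemiModule_isLSemiAlgebra.Build R[i] (ring_of A) (@cs_scaleAl R A).
HB.instance Definition _ (R : realType) (A : cstarAlgType R) :=
  GRing.LSemiAlgebra_isSemiAlgebra.Build R[i] (ring_of A) (@cs_scaleAr R A).
HB.instance Definition _ (R : realType) (A : cstarAlgType R) :=
  PzRing_isStarRing.Build (ring_of A) (@cs_starK R A) (@cs_starD R A)
    (@cs_starM R A).

Section MatrixStar.
Variables (A : starRingType) (n : nat).

Definition mxstar (T : 'M[A]_n) : 'M[A]_n := map_mx star T^T.

Lemma star0 : star (0 : A) = 0.
Proof. by apply: (addrI (star 0)); rewrite -starD !addr0. Qed.

Lemma mxstarK : involutive mxstar.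
Proof. by move=> T; apply/matrixP => i j; rewrite !mxE starK. Qed.

Lemma mxstarD : {morph mxstar : S T / S + T}.
Proof. by move=> S T; apply/matrixP => i j; rewrite !mxE starD. Qed.

Lemma mxstarM (S T : 'M[A]_n) : mxstar (S * T) = mxstar T * mxstar S.
Proof.
apply/matrixP => i j; rewrite !mxE (big_morph star (@starD A) star0).
by apply: eq_bigr => k _; rewrite !mxE starM.
Qed.

HB.instance Definition _ :=
  PzRing_isStarRing.Build 'M[A]_n mxstarK mxstarD mxstarM.

End MatrixStar.

Section StarRingNotions.
Variable A : starRingType.
Implicit Types a b p q u v : A.

Definition unitary u := star u * u = 1 /\ u * star u = 1.

Definition projection p := star p = p /\ p * p = p.

Definition subprojection q p := projection q /\ p * q = q.

Definition mvn_equiv p q := exists v, star v * v = p /\ v * star v = q.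

Definition infinite_projection p :=
  projection p /\ exists q, [/\ subprojection q p, q <> p & mvn_equiv p q].

Definition positive a := exists b, a = star b * b.

(* Approximate unitary equivalence with respect to the norm [N]. *)
Definition approx_unitary_equiv (R : realType) (N : A -> R) a b :=
  exists u : nat -> A, (forall m, unitary (u m)) /\
    (N (star (u m) * a * u m - b) @[m --> \oo] --> (0 : R)).

End StarRingNotions.

Section CStarNotions.
Variables (R : realType) (A : cstarAlgType R).
Local Notation AR := (ring_of A).

Definition cstar_norm (a : AR) : R := complex.Re `|a : A|.

Definition closed_ideal (I : set AR) :=
  [/\ closed (I : set A), I 0, (forall a b, I a -> I b -> I (a + b)),
      (forall (c : R[i]) a, I a -> I (c *: a))
    & (forall a b, I b -> I (a * b) /\ I (b * a))].

Definition simple_cstar :=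
  forall I : set AR, closed_ideal I -> I = [set 0] \/ I = setT.

Definition cstar_subalgebra (B : set AR) :=
  [/\ closed (B : set A), B 0, (forall a b, B a -> B b -> B (a + b)),
      (forall (c : R[i]) a, B a -> B (c *: a))
    & (forall a b, B a -> B b -> B (a * b)) /\ (forall a, B a -> B (star a))].

Definition hereditary (B : set AR) :=
  forall a b, positive a -> positive (b - a) -> B b -> B a.

Definition purely_infinite :=
  forall B : set AR, cstar_subalgebra B -> hereditary B -> B <> [set 0] ->
    exists2 p, B p & infinite_projection p.

(* The C*-norm of M_n(A): the operator norm of left multiplication on the
   Hilbert A-module A^n, with inner product <x, y> = \sum_i x_i^* y_i. The
   set in [cstar_mxnorm] is nonempty and bounded, so that [sup] is meaningful. *)
Definition module_norm n (x : 'cV[AR]_n) : R :=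
  Num.sqrt (cstar_norm (\sum_i star (x i ord0) * x i ord0)).

Definition cstar_mxnorm n (T : 'M[AR]_n) : R :=
  sup [set module_norm (T *m x) | x in [set x | module_norm x <= 1]].

(* The n-fold direct sum a^(n) is the scalar matrix [a%:M]. *)
Definition amplification_equiv n (a b : AR) :=
  approx_unitary_equiv (@cstar_mxnorm n) a%:M b%:M.

Definition KP n (a b : AR) :=
  amplification_equiv n a b -> approx_unitary_equiv cstar_norm a b.

Definition KP_fails n (a b : AR) :=
  amplification_equiv n a b /\ ~ approx_unitary_equiv cstar_norm a b.

End CStarNotions.

(* Main.v *)
(* Let M be the algebra of norm-continuous paths of operators on l^2(N) (x) C^2 that are
   constant modulo the compact operators and whose two end points have the form y (x) 1_2.
   The endomorphism theta of M maps x to the direct sum of x and of infinitely many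
   copies of x(q) (x) 1_2 for each rational q in [0,1]. It satisfies
   theta o theta = Ad(G) o theta for a unitary G, so that the inductive limit A of
   M -> M -> ... along theta is the closure of the union of the G^-n theta(M) G^n inside M.

   Because of the infinite multiplicities, every b <> 0 in A has some y with
   y^* b^* b y = 1, which makes A simple and purely infinite; moreover all projections
   other than 0 and 1 are unitarily equivalent in A, which gives [KP_n] for projections.

   Let v be the bilateral shift (x) 1_2 and u = k v, where k(t) multiplies one basis vector by
   g(t) = h(t)^2, with h running from 1 to -1 along a half circle. If theta(u) and theta(v)
   were approximately unitarily equivalent, there would be a continuous path z(t), close to 1
   and supported in a finite window, with z(0) = 1 and det z = |det c|^2 g for some path c of
   matrices. Then det (sqrt z) / h is real and nonvanishing, equals 1 at t = 0 and hence is
   positive at t = 1. But c(1) = c_1 (x) 1_2, which forces det (sqrt z(1)) = |det c_1|^2 > 0,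
   whereas h(1) = -1. In M_2(A), however, the twist of u (+) u is g on a subspace of dimension
   two. Moving slowly along the shift, this subspace is rotated onto one of the form
   L (x) C^2, on which g may be deformed to 1; this gauge transformation conjugates
   u (+) u to v (+) v up to a small error. *)
Require Import Defs.
From HB Require Import structures.
From mathcomp Require Import all_boot all_order all_algebra.
From mathcomp Require Import complex perm spectral.
From mathcomp Require Import all_classical all_reals all_analysis.
From mathcomp Require Import ring lra.

Set Implicit Arguments.
Unset Strict Implicit.
Unset Printing Implicit Defensive.

Import Order.TTheory GRing.Theory Num.Theory.
Import numFieldNormedType.Exports.

Local Open Scope classical_set_scope.
Local Open Scope ring_scope.

(** * Identities in noncommutative rings *)

(** The obstruction has order two. The phase g winds once around the circle, and the determinant of
    a doubled matrix is a square, so only the parity of the winding is seen; on a subspace of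
    dimension two the winding is even. Projections do not see it: two doubled projections that
    differ only inside a finite window and are conjugate by a unitary of the window are already
    conjugate by a doubled one, because traces in the window are twice the traces of the halves. No
    rank survives either: for a projection p <> 0 in M the value of theta(p) at 0 is the range
    projection of a doubled isometry. The relation between theta o theta and theta keeps the limit
    inside M. An approximate unitary equivalence in A is therefore one in M, and the obstruction is
    proved there. Determinants are available only for operators that are 1 outside a finite window.
    A unitary w of M is replaced by w w(0)^-1, which is 1 plus a compact path, and then cut to a
    window. The cut path c is no longer unitary, which is why |det c|^2 occurs in place of 1. *)

(* A ring expression is normalized to the difference of two multisets of words, the
   positive and the negative monomials. *)
Inductive nexp := Natom of nat | N0 | N1 | Nadd of nexp & nexp | Nopp of nexp | Nmul of nexp & nexp.

Fixpoint nnorm e : seq (seq nat) * seq (seq nat) :=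
  match e with
  | Natom i => ([:: [:: i]], [::])
  | N0 => ([::], [::])
  | N1 => ([:: [::]], [::])
  | Nadd a b => let: (p, n) := nnorm a in let: (p', n') := nnorm b in (p ++ p', n ++ n')
  | Nopp a => let: (p, n) := nnorm a in (n, p)
  | Nmul a b => let: (p, n) := nnorm a in let: (p', n') := nnorm b in
     let m := allpairs cat in (m p p' ++ m n n', m p n' ++ m n p')
  end.

Section NRing.
Variable S : pzRingType.
Variable env : seq S.

Fixpoint neval e : S :=
  match e with
  | Natom i => nth 0 env i
  | N0 => 0
  | N1 => 1
  | Nadd a b => neval a + neval b
  | Nopp a => - neval a
  | Nmul a b => neval a * neval b
  end.

Definition nword (w : seq nat) : S := \prod_(i <- w) nth 0 env i.
Definition nsum (s : seq (seq nat)) : S := \sum_(w <- s) nword w.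

Lemma nsum_cat s t : nsum (s ++ t) = nsum s + nsum t.
Proof. by rewrite /nsum big_cat. Qed.
Lemma nsum_mul s t : nsum (allpairs cat s t) = nsum s * nsum t.
Proof.
rewrite /nsum big_allpairs_dep /= big_distrl/=; apply: eq_bigr => v _.
by rewrite big_distrr/=; apply: eq_bigr => w _; rewrite /nword big_cat.
Qed.
Lemma nnormE e : neval e = nsum (nnorm e).1 - nsum (nnorm e).2.
Proof.
elim: e => /= [i||| a -> b ->|a ->|a -> b ->].
- by rewrite /nsum big_nil big_seq1 subr0 /nword big_seq1.
- by rewrite /nsum big_nil subrr.
- by rewrite /nsum big_nil big_seq1 subr0 /nword big_nil.
- by case: (nnorm a) (nnorm b) => [p n] [p' n'] /=; rewrite !nsum_cat opprD addrACA.
- by case: (nnorm a) => [p n] /=; rewrite opprB.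
- case: (nnorm a) (nnorm b) => [p n] [p' n'] /=.
  by rewrite !nsum_cat !nsum_mul mulrBl !mulrBr opprB opprD addrACA.
Qed.
(** Negative words are moved across the equation. Monomials that cancel inside one expression then
    occur on both sides of the comparison, so that no cancellation procedure has to run. *)
Lemma nring_correct e e' :
  perm_eq ((nnorm e).1 ++ (nnorm e').2) ((nnorm e').1 ++ (nnorm e).2) -> neval e = neval e'.
Proof.
move=> h; rewrite !nnormE; apply/eqP; rewrite subr_eq addrAC eq_sym subr_eq eq_sym -!nsum_cat.
by apply/eqP; rewrite /nsum; apply: perm_big.
Qed.
End NRing.

Ltac nring_mem x l :=
  lazymatch l with
  | nil => constr:(false)
  | x :: _ => constr:(true)
  | _ :: ?l' => nring_mem x l'
  end.
Ltac nring_atoms e l :=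
  lazymatch e with
  | (?a + ?b)%R => let l := nring_atoms a l in nring_atoms b l
  | (- ?a)%R => nring_atoms a l
  | (?a * ?b)%R => let l := nring_atoms a l in nring_atoms b l
  | 0%R => l
  | 1%R => l
  | ?x => lazymatch nring_mem x l with true => l | false => constr:(x :: l) end
  end.
Ltac nring_index x l :=
  lazymatch l with
  | x :: _ => constr:(0%N)
  | _ :: ?l' => let n := nring_index x l' in constr:(S n)
  end.
Ltac nring_reify e l :=
  lazymatch e with
  | (?a + ?b)%R => let a := nring_reify a l in let b := nring_reify b l in constr:(Nadd a b)
  | (- ?a)%R => let a := nring_reify a l in constr:(Nopp a)
  | (?a * ?b)%R => let a := nring_reify a l in let b := nring_reify b l in constr:(Nmul a b)
  | 0%R => constr:(N0)
  | 1%R => constr:(N1)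
  | ?x => let n := nring_index x l in constr:(Natom n)
  end.
Ltac nring :=
  lazymatch goal with
  | |- @eq ?T ?a ?b =>
    let l := nring_atoms a (@nil T) in let l := nring_atoms b l in
    let a' := nring_reify a l in let b' := nring_reify b l in
    apply: (@nring_correct _ l a' b'); vm_compute; exact: erefl
  end.

(** * Bounded families of operators on a Hilbert space *)

(** The basis of l^2(N) (x) C^2; the boolean is the index of the factor C^2. *)
Definition idx := (nat * bool)%type.

(** * Real-valued absolute value and real inner product on the complex numbers *)

Section ComplexReal.
Variable R : realType.
Local Notation C := R[i].
Implicit Types z w : C.

Definition rd z w : R := complex.Re z * complex.Re w + complex.Im z * complex.Im w.
Definition csq z : R := rd z z.
Definition cabs z : R := Num.sqrt (csq z).
Definition rc (a : R) : C := Complex a 0.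

Lemma rdC z w : rd z w = rd w z. Proof. by rewrite /rd; ring. Qed.
Lemma rdDl z z' w : rd (z + z') w = rd z w + rd z' w.
Proof. by case: z z' w => [a b] [c d] [e f]; rewrite /rd/=; ring. Qed.
Lemma rdMl c z w : rd (c * z) w = rd z (c^* * w).
Proof. by case: c z w => [a b] [c d] [e f]; rewrite /rd/=; ring. Qed.
Lemma csqM z w : csq (z * w) = csq z * csq w.
Proof. by case: z w => [a b] [c d]; rewrite /csq/rd/=; ring. Qed.
Lemma csqN z : csq (- z) = csq z.
Proof. by case: z => [a b]; rewrite /csq/rd/=; ring. Qed.
Lemma csqJ z : csq z^* = csq z.
Proof. by case: z => [a b]; rewrite /csq/rd/=; ring. Qed.
Lemma csqJM z : z^* * z = rc (csq z).
Proof. by case: z => [a b]; rewrite /csq/rd/rc; apply/eqP; rewrite eq_complex /= ; apply/andP; split; apply/eqP; ring. Qed.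
Lemma csq_ge0 z : 0 <= csq z.
Proof. by rewrite /csq/rd -!expr2 addr_ge0 ?sqr_ge0. Qed.
Lemma csq0 : csq 0 = 0. Proof. by rewrite /csq/rd/=; ring. Qed.
Lemma csq1 : csq 1 = 1. Proof. by rewrite /csq/rd/=; ring. Qed.
Lemma csq_eq0 z : csq z = 0 -> z = 0.
Proof.
case: z => [a b]; rewrite /csq/rd/= -!expr2 => /eqP.
rewrite paddr_eq0 ?sqr_ge0// => /andP[]; rewrite !sqrf_eq0 => /eqP-> /eqP->.
by [].
Qed.
Lemma rd0r z : rd z 0 = 0. Proof. by rewrite /rd/= !mulr0 addr0. Qed.
Lemma cabs_ge0 z : 0 <= cabs z. Proof. by rewrite ?hnE sqrtr_ge0. Qed.
Lemma sqr_cabs z : cabs z ^+ 2 = csq z. Proof. by rewrite sqr_sqrtr ?csq_ge0. Qed.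
Lemma cabsM z w : cabs (z * w) = cabs z * cabs w.
Proof. by rewrite /cabs csqM sqrtrM ?csq_ge0. Qed.
Lemma cabsJ z : cabs z^* = cabs z. Proof. by rewrite /cabs csqJ. Qed.
Lemma cabsN z : cabs (- z) = cabs z. Proof. by rewrite /cabs csqN. Qed.
Lemma cabs0 : cabs 0 = 0. Proof. by rewrite /cabs csq0 sqrtr0. Qed.
Lemma cabs1 : cabs 1 = 1. Proof. by rewrite /cabs csq1 sqrtr1. Qed.
Lemma cabs_eq0 z : cabs z = 0 -> z = 0.
Proof. by move=> h; apply: csq_eq0; rewrite -sqr_cabs h expr0n. Qed.
Lemma normcE z : `|z| = rc (cabs z).
Proof. by rewrite normc_def /rc /cabs /csq /rd -!expr2. Qed.
Lemma cabsD z w : cabs (z + w) <= cabs z + cabs w.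
Proof. by have := ler_normD z w; rewrite !normcE /rc lecE/= => /andP[]. Qed.
Lemma cabsB z w : cabs (z - w) <= cabs z + cabs w.
Proof. by rewrite -(cabsN w) cabsD. Qed.
Lemma csq_rc a : csq (rc a) = a ^+ 2. Proof. by rewrite /csq/rd/=; ring. Qed.
Lemma cabs_rc a : cabs (rc a) = `|a|. Proof. by rewrite /cabs csq_rc sqrtr_sqr. Qed.
Lemma rcD a b : rc (a + b) = rc a + rc b. Proof. by rewrite /rc/=; apply/eqP; rewrite eq_complex/= addr0 !eqxx. Qed.
Lemma rcM a b : rc (a * b) = rc a * rc b.
Proof. by rewrite /rc/=; apply/eqP; rewrite eq_complex/= ; apply/andP; split; apply/eqP; ring. Qed.
Lemma rc1 : rc 1 = 1. Proof. by []. Qed.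
Lemma rcJ a : (rc a)^* = rc a. Proof. by rewrite /rc/=; apply/eqP; rewrite eq_complex/= oppr0 !eqxx. Qed.
Lemma rcN a : rc (- a) = - rc a. Proof. by rewrite /rc/=; apply/eqP; rewrite eq_complex/= oppr0 !eqxx. Qed.
Lemma rc_half : 2^-1 = rc 2^-1 :> C.
Proof.
apply: (@mulfI _ (2:C)); first by rewrite pnatr_eq0.
rewrite mulfV ?pnatr_eq0// (_ : 2 = rc 2); first by rewrite -rcM mulfV ?pnatr_eq0.
by rewrite -[2]/(1 + 1) rcD.
Qed.
Lemma ler_Re z : `|complex.Re z| <= cabs z.
Proof. by rewrite -sqrtr_sqr ler_wsqrtr// /csq /rd -expr2 lerDl -expr2 sqr_ge0. Qed.
Lemma ler_Im z : `|complex.Im z| <= cabs z.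
Proof. by rewrite -sqrtr_sqr ler_wsqrtr// /csq /rd -!expr2 lerDr sqr_ge0. Qed.
Lemma ler_cabs z : cabs z <= `|complex.Re z| + `|complex.Im z|.
Proof.
rewrite -(ger0_norm (addr_ge0 (normr_ge0 _) (normr_ge0 _))) -sqrtr_sqr ler_wsqrtr//.
rewrite /csq /rd -!expr2 sqrrD !real_normK ?num_real// -addrA lerD2l lerDr.
by rewrite mulrn_wge0// mulr_ge0.
Qed.
End ComplexReal.

(** * The Hilbert space l^2(N) (x) C^2 *)

Section L2.
Variable R : realType.
Local Notation C := R[i].
Implicit Types f g : idx -> C.

Definition ps f g (N : nat) : R :=
  \sum_(n < N) (rd (f (n : nat, false)) (g (n : nat, false)) + rd (f (n : nat, true)) (g (n : nat, true))).

Lemma psS f g n : ps f g n.+1 = ps f g n + (rd (f (n, false)) (g (n, false)) + rd (f (n, true)) (g (n, true))).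
Proof. by rewrite /ps big_ord_recr. Qed.

Definition l2p f := exists M : R, forall N, ps f f N <= M.

Lemma psC f g N : ps f g N = ps g f N.
Proof. by apply: eq_bigr => i _; rewrite rdC [in X in _ + X]rdC. Qed.
Lemma psDl f f' g N : ps (f + f') g N = ps f g N + ps f' g N.
Proof. by rewrite -big_split; apply: eq_bigr => i _ /=; rewrite !fctE !rdDl; ring. Qed.
Lemma psDr f g g' N : ps f (g + g') N = ps f g N + ps f g' N.
Proof. by rewrite psC psDl !(psC f). Qed.
Lemma psMl c f g N : ps (c *: f) g N = ps f (c^* *: g) N.
Proof. by apply: eq_bigr => i _ /=; rewrite !fctE/= !rdMl. Qed.
Lemma ps_ge0 f N : 0 <= ps f f N.
Proof. by apply: sumr_ge0 => i _; rewrite addr_ge0 ?csq_ge0. Qed.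
Lemma ps_csqZ c f N : ps (c *: f) (c *: f) N = csq c * ps f f N.
Proof. by rewrite /ps mulr_sumr; apply: eq_bigr => i _; rewrite !fctE -!/(csq _) !csqM; ring. Qed.
Lemma ps_nd f : nondecreasing_seq (ps f f).
Proof.
apply/nondecreasing_seqP => n; rewrite [leRHS]/ps big_ord_recr/= lerDl.
by rewrite addr_ge0 ?csq_ge0.
Qed.
Lemma ps_parallel f g N : ps (f + g) (f + g) N <= 2 * ps f f N + 2 * ps g g N.
Proof.
rewrite /ps !mulr_sumr -big_split/=; apply: ler_sum => i _.
have H z w : rd (z + w) (z + w) <= 2 * rd z z + 2 * rd w w :> R.
  case: z w => [a b] [c d]; rewrite /rd/=.
  by have := sqr_ge0 (a - c); have := sqr_ge0 (b - d); rewrite !expr2; lra.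
rewrite !fctE; have := H (f (i : nat, false)) (g (i : nat, false)).
have := H (f (i : nat, true)) (g (i : nat, true)); lra.
Qed.

Definition l2 : {pred idx -> C} := fun f => `[< l2p f >].
Lemma l2_submod : submod_closed l2.
Proof.
split; first by apply/asboolP; exists 0 => N; rewrite /ps big1// => i _; rewrite !rd0r addr0.
move=> c f g /asboolP[M hM] /asboolP[M' hM']; apply/asboolP.
exists (2 * (csq c * M) + 2 * M') => N; apply: (le_trans (ps_parallel _ _ _)).
by rewrite lerD ?ler_wpM2l// ps_csqZ ler_wpM2l ?csq_ge0.
Qed.
HB.instance Definition _ := GRing.isSubmodClosed.Build C (idx -> C) l2 l2_submod.

Record hilb := Hilb { hv :> idx -> C ; hvP : hv \in l2 }.
HB.instance Definition _ := [isSub for hv].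
HB.instance Definition _ := [Choice of hilb by <:].
HB.instance Definition _ := [SubChoice_isSubLmodule of hilb by <:].

Implicit Types x y : hilb.
Lemma hvZ c x : hv (c *: x) = c *: hv x. Proof. by []. Qed.
Lemma hvDE x y i : (x + y) i = x i + y i. Proof. by []. Qed.
Lemma hvZE c x i : (c *: x) i = c * x i. Proof. by []. Qed.
Lemma hvNE x i : (- x) i = - x i. Proof. by []. Qed.
Lemma hv0E i : (0 : hilb) i = 0. Proof. by []. Qed.
Lemma hvP2 x y : (forall i, x i = y i) -> x = y.
Proof. by move=> h; apply: val_inj; apply/funext. Qed.

(* [hdot] is the real part of the inner product; a complex linear map has the same adjoint
   for both. [hdot], [hn] and the operations on [fam] below are locked: conversion would otherwise
   unfold them in every failing unification. *)
Fact lock_key : unit. Proof. exact: tt. Qed.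
Definition hdot : hilb -> hilb -> R := locked_with lock_key (fun x y => limn (ps x y)).
Lemma hdotE x y : hdot x y = limn (ps x y). Proof. by rewrite /hdot locked_withE. Qed.

Lemma ps_cvg0 x : cvgn (ps x x).
Proof.
have /asboolP[M hM] := hvP x.
by apply: nondecreasing_is_cvgn; [exact: ps_nd | exists M => _ [n _ <-]].
Qed.
Lemma ps_polar f g N : ps f g N = 2^-1 * (ps (f + g) (f + g) N - ps f f N - ps g g N).
Proof. by rewrite psDl !psDr (psC g f); field. Qed.
(** Only sums of squares are monotone; polarization reduces the mixed sums to them. *)
Lemma ps_cvg x y : cvgn (ps x y).
Proof.
rewrite (_ : ps x y = fun N => 2^-1 * (ps (x + y) (x + y) N - ps x x N - ps y y N)); last first.
  by apply/funext => N; rewrite ps_polar.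
apply: is_cvgM; first exact: is_cvg_cst.
by apply: is_cvgB; [apply: is_cvgB|]; apply: ps_cvg0.
Qed.
Lemma hdotC x y : hdot x y = hdot y x.
Proof. by rewrite !hdotE; congr (limn _); apply/funext => N; rewrite psC. Qed.
Lemma hdotDl x x' y : hdot (x + x') y = hdot x y + hdot x' y.
Proof.
rewrite !hdotE (_ : ps (x + x') y = ps x y + ps x' y); last by apply/funext => N; rewrite psDl.
by rewrite limD//; apply: ps_cvg.
Qed.
Lemma hdotDr x y y' : hdot x (y + y') = hdot x y + hdot x y'.
Proof. by rewrite !(hdotC x) hdotDl. Qed.
Lemma hdotZl c x y : hdot (c *: x) y = hdot x (c^* *: y).
Proof. by rewrite !hdotE; congr (limn _); apply/funext => N; rewrite hvZ psMl. Qed.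
Lemma hdotZr c x y : hdot x (c *: y) = hdot (c^* *: x) y.
Proof. by rewrite hdotZl conjCK. Qed.
Lemma ps_le_hdot x N : ps x x N <= hdot x x.
Proof. by rewrite hdotE; apply: nondecreasing_cvgn_le; [exact: ps_nd | exact: ps_cvg]. Qed.
Lemma hdot_ge0 x : 0 <= hdot x x.
Proof. exact: le_trans (ps_ge0 _ 0) (ps_le_hdot _ _). Qed.
Lemma hdot_le x M : (forall N, ps x x N <= M) -> hdot x x <= M.
Proof. by move=> h; rewrite hdotE; apply: limr_le; [exact: ps_cvg | apply: nearW]. Qed.
Lemma hdotZZ c x : hdot (c *: x) (c *: x) = csq c * hdot x x.
Proof.
rewrite !hdotE (_ : ps (c *: x) (c *: x) = (fun N => csq c * ps x x N)); last first.
  by apply/funext => N; rewrite hvZ ps_csqZ.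
by rewrite limM//; [rewrite lim_cst | exact: is_cvg_cst | exact: ps_cvg].
Qed.
Lemma hdot0l y : hdot 0 y = 0.
Proof. by have := hdotDl 0 0 y; rewrite addr0 => /eqP; rewrite -subr_eq0 opprD addNKr oppr_eq0 => /eqP. Qed.
Lemma hdotNl x y : hdot (- x) y = - hdot x y.
Proof. by apply/eqP; rewrite -addr_eq0 -hdotDl addNr hdot0l. Qed.
Lemma hdotNr x y : hdot x (- y) = - hdot x y.
Proof. by rewrite hdotC hdotNl hdotC. Qed.
Lemma hdotBl x x' y : hdot (x - x') y = hdot x y - hdot x' y.
Proof. by rewrite hdotDl hdotNl. Qed.
Lemma hdotBr x y y' : hdot x (y - y') = hdot x y - hdot x y'.
Proof. by rewrite hdotDr hdotNr. Qed.
Lemma hdot0r y : hdot y 0 = 0. Proof. by rewrite hdotC hdot0l. Qed.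

Lemma csq_le_hdot x i : csq (x i) <= hdot x x.
Proof.
apply: le_trans (ps_le_hdot x i.1.+1); rewrite /ps big_ord_recr/=.
case: i => n [] /=.
- by rewrite -/(csq _) addrA lerDr addr_ge0 ?ps_ge0// csq_ge0.
- have h1 := csq_ge0 (x (n, true)); have h2 := ps_ge0 x n.
  by rewrite /ps in h2; rewrite /csq in h1 *; lra.
Qed.
Lemma hdot_eq0 x : hdot x x = 0 -> x = 0.
Proof.
move=> h; apply: hvP2 => i; apply: csq_eq0; apply/eqP.
by rewrite -[_ == _]/(_ == _) eq_le csq_ge0 andbT -h csq_le_hdot.
Qed.

Definition hn : hilb -> R := locked_with lock_key (fun x => Num.sqrt (hdot x x)).
Lemma hnE x : hn x = Num.sqrt (hdot x x). Proof. by rewrite /hn locked_withE. Qed.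
Lemma hn_ge0 x : 0 <= hn x. Proof. by rewrite ?hnE sqrtr_ge0. Qed.
Lemma sqr_hn x : hn x ^+ 2 = hdot x x. Proof. by rewrite hnE sqr_sqrtr ?hdot_ge0. Qed.
Lemma hn0 : hn 0 = 0. Proof. by rewrite !hnE hdot0l sqrtr0. Qed.
Lemma hn_eq0 x : hn x = 0 -> x = 0.
Proof. by move=> h; apply: hdot_eq0; rewrite -sqr_hn h expr0n. Qed.
Lemma hnZ c x : hn (c *: x) = cabs c * hn x.
Proof. by rewrite !hnE hdotZZ sqrtrM ?csq_ge0. Qed.
Lemma hnN x : hn (- x) = hn x.
Proof. by rewrite -scaleN1r hnZ cabsN cabs1 mul1r. Qed.
Lemma hdotZrc (a : R) x y : hdot (rc a *: x) y = a * hdot x y.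
Proof.
have ex z : hdot (z + y) (z + y) = hdot z z + 2 * hdot z y + hdot y y.
  by rewrite hdotDl !hdotDr (hdotC y z); ring.
rewrite !hdotE (_ : ps (rc a *: x) y = (fun N => a * ps x y N)).
  by rewrite limM//; [rewrite lim_cst | exact: is_cvg_cst | exact: ps_cvg].
apply/funext => N; rewrite /ps mulr_sumr; apply: eq_bigr => i _.
by rewrite !hvZE /rd/=; case: (x _) (x _) => [? ?] [? ?] /=; ring.
Qed.
Lemma hdotZrcr (a : R) x y : hdot y (rc a *: x) = a * hdot y x.
Proof. by rewrite !(hdotC y) hdotZrc. Qed.
Lemma hdot_CS x y : `|hdot x y| <= hn x * hn y.
Proof.
have [y0|yn] := eqVneq (hn y) 0; first by rewrite (hn_eq0 y0) hdot0r normr0 hn0 mulr0.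
have yp : 0 < hdot y y by rewrite -sqr_hn exprn_gt0// lt_neqAle eq_sym yn hn_ge0.
rewrite -(ger0_norm (mulr_ge0 (hn_ge0 x) (hn_ge0 y))) -ler_sqr ?nnegrE ?normr_ge0//.
rewrite !real_normK ?num_real// exprMn !sqr_hn.
(* For a = <x,x>, b = <x,y>, c = <y,y> the square of c x - b y is c (a c - b^2). *)
have := hdot_ge0 (rc (hdot y y) *: x + rc (- hdot x y) *: y).
rewrite !hdotDl !hdotDr !hdotZrc !hdotZrcr (hdotC y x).
set a := hdot x x; set b := hdot x y; set c := hdot y y => h.
have : 0 <= c * (a * c - b ^+ 2) by apply: le_trans h _; rewrite le_eqVlt; apply/orP; left; apply/eqP; ring.
by rewrite pmulr_rge0// subr_ge0.
Qed.
Lemma hnD x y : hn (x + y) <= hn x + hn y.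
Proof.
rewrite -ler_sqr ?nnegrE ?addr_ge0 ?hn_ge0// sqrrD !sqr_hn hdotDl !hdotDr (hdotC y x).
have := hdot_CS x y; rewrite ler_norml => /andP[_ h]; rewrite mulr2n; lra.
Qed.
Lemma hnB x y : hn (x - y) <= hn x + hn y.
Proof. by rewrite -(hnN y) hnD. Qed.
Lemma hnC x y : hn (x - y) = hn (y - x).
Proof. by rewrite -hnN opprB. Qed.
Lemma cabs_le_hn x i : cabs (x i) <= hn x.
Proof. by rewrite hnE ler_wsqrtr// csq_le_hdot. Qed.
Lemma hn_le x M : 0 <= M -> hdot x x <= M ^+ 2 -> hn x <= M.
Proof. by move=> M0 h; rewrite -ler_sqr ?nnegrE ?hn_ge0// sqr_hn. Qed.

(** Initial sums and sums over duplicate-free lists bound each other. The latter are what an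
    injection or a partial inverse of the index set transports. *)
Lemma sum_uniq_ps f (s : seq idx) : uniq s ->
  exists N, \sum_(i <- s) csq (f i) <= ps f f N.
Proof.
move=> us; pose N := (\max_(i <- s) i.1).+1; exists N.
pose t := [seq (nat_of_ord n, b) | n <- enum 'I_N, b <- [:: false; true]].
have -> : ps f f N = \sum_(i <- t) csq (f i).
  rewrite big_allpairs_dep/= /ps big_enum_cond/=; apply: eq_bigr => n _.
  by rewrite !big_cons big_nil addr0.
have ut : uniq t.
  apply: allpairs_uniq => //; first exact: enum_uniq.
  by move=> [a b] [c d] /= _ _ [/val_inj -> ->].
rewrite [leRHS](bigID (fun i => i \in s))/= -[leLHS]addr0 lerD//; last first.
  by apply: sumr_ge0 => i _; exact: csq_ge0.
rewrite -[leRHS]big_filter le_eqVlt; apply/orP; left; apply/eqP/perm_big.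
apply: uniq_perm => //; first exact: filter_uniq.
move=> [n b]; rewrite mem_filter; apply/idP/andP => [ins|[]//]; split=> //.
 apply/allpairsPdep.
have nN : (n < N)%N by rewrite ltnS; apply: (@leq_bigmax_seq _ s xpredT (fun i => i.1) (n, b)).
by exists (Ordinal nN), b; rewrite mem_enum; split => //; case: b {ins}.
Qed.
Lemma sum_uniq_hdot x (s : seq idx) : uniq s -> \sum_(i <- s) csq (x i) <= hdot x x.
Proof. by move=> /(sum_uniq_ps x)[N]; move=> /le_trans; apply; apply: ps_le_hdot. Qed.
Lemma ps_seq f N : {s : seq idx | uniq s & ps f f N = \sum_(i <- s) csq (f i)}.
Proof.
exists [seq (nat_of_ord n, b) | n <- enum 'I_N, b <- [:: false; true]].
  apply: allpairs_uniq => //; first exact: enum_uniq.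
  by move=> [a b] [c d] /= _ _ [/val_inj -> ->].
rewrite big_allpairs_dep/= /ps big_enum_cond/=; apply: eq_bigr => n _.
by rewrite !big_cons big_nil addr0.
Qed.

Lemma l2_ps f M : (forall N, ps f f N <= M) -> f \in l2.
Proof. by move=> h; apply/asboolP; exists M. Qed.

Lemma hdot_polar x y : hdot x y = 2^-1 * (hdot (x + y) (x + y) - hdot x x - hdot y y).
Proof. by rewrite hdotDl !hdotDr (hdotC y x); field. Qed.

Lemma be_subproof i : (fun j : idx => (j == i)%:R : C) \in l2.
Proof.
apply: (@l2_ps _ 1) => N; have [s us ->] := ps_seq (fun j : idx => (j == i)%:R : C) N.
rewrite (eq_bigr (fun j => (j == i)%:R)); last by move=> j _; case: eqP; rewrite ?csq1 ?csq0.
rewrite -natr_sum (_ : (\sum_(j <- s) (j == i))%N = count_mem i s); last first.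
  by rewrite -sum1_count [RHS]big_mkcond; apply: eq_bigr => j _ /=; case: eqP.
by rewrite count_uniq_mem// -[leRHS]/(1%:R) ler_nat; case: (i \in s).
Qed.
Definition be : idx -> hilb := locked_with lock_key (fun i => Hilb (be_subproof i)).
Lemma beE i j : be i j = (j == i)%:R. Proof. by rewrite /be locked_withE. Qed.
Lemma hdot_be i x : hdot x (be i) = complex.Re (x i).
Proof.
rewrite !hdotE; apply: lim_near_cst => //; exists i.1.+1 => // N /= iN.
rewrite /ps (bigD1 (Ordinal iN))//= big1 ?addr0.
  by rewrite !beE /rd; case: i {iN} => n [] /=; rewrite !eqxx/= ?xpair_eqE ?andbF/= ?eqxx/=; ring.
move=> j /eqP jN; case: i iN jN => n b iN jN; rewrite !beE.
have -> : ((j : nat, false) == (n, b)) = false.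
  by apply/negbTE/eqP => -[e _]; apply: jN; apply: val_inj.
have -> : ((j : nat, true) == (n, b)) = false.
  by apply/negbTE/eqP => -[e _]; apply: jN; apply: val_inj.
by rewrite !rd0r addr0.
Qed.
Lemma hn_be i : hn (be i) = 1.
Proof. by rewrite !hnE hdot_be beE eqxx sqrtr1. Qed.

Lemma real_complete (u : nat -> R) :
  (forall e, 0 < e -> exists K, forall k l, (K <= k)%N -> (K <= l)%N -> `|u k - u l| <= e) ->
  exists l : R, u n @[n --> \oo] --> l.
Proof.
move=> h; apply/cvg_ex/cauchy_cvgP/cauchy_exP => e e0.
have [K hK] := h (e / 2) (divr_gt0 e0 (ltr0n _ 2)).
exists (u K), K => // n /= Kn; rewrite /ball /=.
by apply: le_lt_trans (hK _ _ _ Kn) _ => //; rewrite ltr_pdivrMr// ltr_pMr// ltr1n.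
Qed.

Definition hcauchy (u : nat -> hilb) := forall e, 0 < e ->
  exists K, forall k l, (K <= k)%N -> (K <= l)%N -> hn (u k - u l) <= e.
Definition hlim (u : nat -> hilb) x := forall e, 0 < e ->
  exists K, forall k, (K <= k)%N -> hn (u k - x) <= e.

(** The limit is formed coordinatewise. The Cauchy bound passes to every finite partial sum of the
    limit and from there to the full norm, which gives both square summability and convergence. *)
Lemma hilb_complete u : hcauchy u -> exists x, hlim u x.
Proof.
move=> hu.
have cre i : exists l : R, complex.Re (u n i) @[n --> \oo] --> l.
  apply: real_complete => e /hu[K hK]; exists K => k l Kk Kl; apply: le_trans (hK k l Kk Kl).
  by apply: le_trans (cabs_le_hn _ i); apply: le_trans (ler_Re _); rewrite /= -raddfB.
have cim i : exists l : R, complex.Im (u n i) @[n --> \oo] --> l.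
  apply: real_complete => e /hu[K hK]; exists K => k l Kk Kl; apply: le_trans (hK k l Kk Kl).
  by apply: le_trans (cabs_le_hn _ i); apply: le_trans (ler_Im _); rewrite /= -raddfB.
have [re hre] := choice cre; have [im him] := choice cim.
pose f : idx -> C := fun i => Complex (re i) (im i).
have lps k e : 0 < e -> (exists K, forall l, (K <= l)%N -> hn (u k - u l) <= e) ->
    forall N, ps (hv (u k) - f) (hv (u k) - f) N <= e ^+ 2.
  move=> e0 [K hK] N.
  have c : ps (u k - u l) (u k - u l) N @[l --> \oo] --> ps (hv (u k) - f) (hv (u k) - f) N.
    elim: N => [|n IH].
      rewrite (_ : ps _ _ 0 = 0) ?[X in X @ _]( _ : _ = cst 0); first exact: cvg_cst.
      - by apply/funext => l; rewrite /ps big_ord0.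
      - by rewrite /ps big_ord0.
    rewrite psS; under eq_fun do rewrite psS.
    apply: cvgD IH _; rewrite /rd.
    have cr j : complex.Re ((u k - u l) j) @[l --> \oo] --> complex.Re ((hv (u k) - f) j).
      rewrite !fctE raddfB/=; under eq_fun do rewrite !fctE raddfB/=.
      by apply: cvgB; [exact: cvg_cst|exact: hre].
    have ci j : complex.Im ((u k - u l) j) @[l --> \oo] --> complex.Im ((hv (u k) - f) j).
      rewrite !fctE raddfB/=; under eq_fun do rewrite !fctE raddfB/=.
      by apply: cvgB; [exact: cvg_cst|exact: him].
    by apply: cvgD; apply: cvgD; apply: cvgM.
  rewrite -(cvg_lim _ c)//; apply: limr_le; first by apply/cvg_ex; eexists; exact: c.
  exists K => // l /= Kl.
  apply: (le_trans (ps_le_hdot (u k - u l) N)); rewrite -sqr_hn ler_sqr ?nnegrE ?hn_ge0 ?(ltW e0)//; exact: hK.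
have fl2 : f \in l2.
  have [K hK] := hu 1 ltr01.
  have : hv (u K) - f \in l2.
    by apply: (l2_ps (M := 1 ^+ 2)); apply: lps => //; exists K => l Kl; apply: hK.
  by move=> h; rewrite -[f](subKr (hv (u K))) rpredB// hvP.
exists (Hilb fl2) => e e0; have [K hK] := hu e e0; exists K => k Kk.
apply: hn_le (ltW e0) _; apply: hdot_le => N; apply: lps => //.
by exists K => l Kl; apply: hK.
Qed.

Lemma hlim_unique u x y : hlim u x -> hlim u y -> x = y.
Proof.
move=> hx hy; apply/eqP; rewrite -subr_eq0; apply/eqP/hn_eq0/eqP.
rewrite eq_le hn_ge0 andbT; apply/ler_addgt0Pr => e e0; rewrite add0r.
have [K hK] := hx _ (divr_gt0 e0 (ltr0n _ 2)); have [L hL] := hy _ (divr_gt0 e0 (ltr0n _ 2)).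
have := hK _ (leq_maxl K L); have := hL _ (leq_maxr K L); set n := maxn K L => h1 h2.
have -> : x - y = (u n - y) - (u n - x) by rewrite opprB [RHS]addrC subrKA.
apply: le_trans (hnB _ _) _; lra.
Qed.
End L2.

(** * Uniformly bounded families of operators, their algebra and their norm *)

Section Fam.
Variable R : realType.
Local Notation C := R[i].
Local Notation H := (hilb R).
Implicit Types (x y z : H) (t : R) (c : C).

Lemma hdot_nondeg y z : (forall x, hdot x y = hdot x z) -> y = z.
Proof.
move=> h; apply/eqP; rewrite -subr_eq0; apply/eqP/hdot_eq0.
by rewrite hdotBr h subrr.
Qed.

(** The adjoint is a field, so that none has to be constructed from a representation theorem; it is
    determined by [op], which is what [fam_eq] rests on. The parameter runs over the whole real
    line; [clamped] below turns families into paths on [0,1]. *)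
Record fam := Fam {
  op : R -> H -> H;
  ad : R -> H -> H;
  opD : forall t x y, op t (x + y) = op t x + op t y;
  opZ : forall t c x, op t (c *: x) = c *: op t x;
  op_ad : forall t x y, hdot (op t x) y = hdot x (ad t y);
  op_bd : exists M, 0 <= M /\ forall t x, hn (op t x) <= M * hn x }.
Implicit Types a b d : fam.

Lemma adD a t x y : ad a t (x + y) = ad a t x + ad a t y.
Proof. by apply: hdot_nondeg => z; rewrite hdotDr -!op_ad hdotDr. Qed.
Lemma adZ a t c x : ad a t (c *: x) = c *: ad a t x.
Proof. by apply: hdot_nondeg => z; rewrite hdotZr -!op_ad hdotZr -opZ. Qed.
Lemma ad_op a t x y : hdot (ad a t x) y = hdot x (op a t y).
Proof. by rewrite hdotC -op_ad hdotC. Qed.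
Lemma op_bdP a M : 0 <= M -> (forall t x, hn (op a t x) <= M * hn x) ->
  forall t x, hn (ad a t x) <= M * hn x.
Proof.
move=> M0 hM t x; have [->|n0] := eqVneq (hn (ad a t x)) 0; first by rewrite mulr_ge0 ?hn_ge0.
have p : 0 < hn (ad a t x) by rewrite lt_neqAle eq_sym n0 hn_ge0.
rewrite -(ler_pM2r p) -expr2 sqr_hn -op_ad.
apply: le_trans (ler_norm _) _; apply: le_trans (hdot_CS _ _) _.
by rewrite mulrAC ler_wpM2r ?hn_ge0.
Qed.
Lemma ad_bd a : exists M, 0 <= M /\ forall t x, hn (ad a t x) <= M * hn x.
Proof. by have [M [M0 hM]] := op_bd a; exists M; split=> //; apply: op_bdP. Qed.

Lemma fam_eq a b : (forall t x, op a t x = op b t x) -> a = b.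
Proof.
move=> h; have h2 : ad a = ad b.
  by apply/funext => t; apply/funext => y; apply: hdot_nondeg => x; rewrite -!op_ad h.
have h1 : op a = op b by apply/funext => t; apply/funext => x.
case: a b h1 h2 {h} => oa aa p1 p2 p3 p4 [ob ab q1 q2 q3 q4] /= h1 h2; subst.
by congr Fam; apply: Prop_irrelevance.
Qed.

HB.instance Definition _ := gen_eqMixin fam.
HB.instance Definition _ := gen_choiceMixin fam.

Definition fam0_def : fam.
apply: (@Fam (fun _ _ => 0) (fun _ _ => 0)) => [t x y|t c x|t x y|].
- by rewrite addr0.
- by rewrite scaler0.
- by rewrite hdot0l hdot0r.
- by exists 0; split=> // t x; rewrite hn0 mul0r.
Defined.
Definition fam1_def : fam.
apply: (@Fam (fun _ x => x) (fun _ x => x)) => //.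
by exists 1; split=> // t x; rewrite mul1r.
Defined.
Definition famD_def a b : fam.
apply: (@Fam (fun t x => op a t x + op b t x) (fun t x => ad a t x + ad b t x)) => [t x y|t c x|t x y|].
- by rewrite !opD addrACA.
- by rewrite !opZ scalerDr.
- by rewrite hdotDl hdotDr !op_ad.
- have [M [M0 hM]] := op_bd a; have [N [N0 hN]] := op_bd b.
  exists (M + N); split=> [|t x]; first exact: addr_ge0.
  by apply: le_trans (hnD _ _) _; rewrite mulrDl lerD.
Defined.
Definition famZ_def c a : fam.
apply: (@Fam (fun t x => c *: op a t x) (fun t x => c^* *: ad a t x)) => [t x y|t k x|t x y|].
- by rewrite opD scalerDr.
- by rewrite opZ !scalerA mulrC.
- by rewrite hdotZl op_ad -adZ.
- have [M [M0 hM]] := op_bd a.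
  exists (cabs c * M); split=> [|t x]; first by rewrite mulr_ge0 ?cabs_ge0.
  by rewrite hnZ -mulrA ler_wpM2l ?cabs_ge0.
Defined.
Definition famM_def a b : fam.
apply: (@Fam (fun t x => op a t (op b t x)) (fun t x => ad b t (ad a t x))) => [t x y|t c x|t x y|].
- by rewrite !opD.
- by rewrite !opZ.
- by rewrite !op_ad.
- have [M [M0 hM]] := op_bd a; have [N [N0 hN]] := op_bd b.
  exists (M * N); split=> [|t x]; first exact: mulr_ge0.
  by apply: le_trans (hM _ _) _; rewrite -mulrA ler_wpM2l.
Defined.
Definition famS_def a : fam.
apply: (@Fam (ad a) (op a)) => [t x y|t c x|t x y|].
- exact: adD.
- exact: adZ.
- exact: ad_op.
- exact: ad_bd.
Defined.

Definition fam0 := locked_with (lock_key) fam0_def.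
Definition fam1 := locked_with (lock_key) fam1_def.
Definition famD := locked_with (lock_key) famD_def.
Definition famZ := locked_with (lock_key) famZ_def.
Definition famM := locked_with (lock_key) famM_def.
Definition famS := locked_with (lock_key) famS_def.
Definition famN := famZ (-1).
Lemma op_fam0 t x : op fam0 t x = 0. Proof. by rewrite /fam0 locked_withE. Qed.
Lemma op_fam1 t x : op fam1 t x = x. Proof. by rewrite /fam1 locked_withE. Qed.
Lemma op_famD a b t x : op (famD a b) t x = op a t x + op b t x.
Proof. by rewrite /famD locked_withE. Qed.
Lemma op_famZ c a t x : op (famZ c a) t x = c *: op a t x.
Proof. by rewrite /famZ locked_withE. Qed.
Lemma op_famM a b t x : op (famM a b) t x = op a t (op b t x).
Proof. by rewrite /famM locked_withE. Qed.
Lemma op_famS a t x : op (famS a) t x = ad a t x.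
Proof. by rewrite /famS locked_withE. Qed.
Lemma ad_famS a t x : ad (famS a) t x = op a t x.
Proof. by rewrite /famS locked_withE. Qed.
Definition op_famE := (op_fam0, op_fam1, op_famD, op_famZ, op_famM, op_famS).

Lemma famDA : associative famD.
Proof. by move=> a b d; apply: fam_eq => t x; rewrite !op_famE addrA. Qed.
Lemma famDC : commutative famD.
Proof. by move=> a b; apply: fam_eq => t x; rewrite !op_famE addrC. Qed.
Lemma fam0D : left_id fam0 famD.
Proof. by move=> a; apply: fam_eq => t x; rewrite !op_famE add0r. Qed.
Lemma famND : left_inverse fam0 famN famD.
Proof. by move=> a; apply: fam_eq => t x; rewrite !op_famE scaleN1r addNr. Qed.
HB.instance Definition _ := GRing.isZmodule.Build fam famDA famDC fam0D famND.
Lemma op_add a b t x : op (a + b) t x = op a t x + op b t x. Proof. exact: op_famD. Qed.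
Lemma op_zero t x : op 0 t x = 0. Proof. exact: op_fam0. Qed.

Lemma famMA : associative famM.
Proof. by move=> a b d; apply: fam_eq => t x; rewrite !op_famE. Qed.
Lemma fam1M : left_id fam1 famM.
Proof. by move=> a; apply: fam_eq => t x; rewrite !op_famE. Qed.
Lemma famM1 : right_id fam1 famM.
Proof. by move=> a; apply: fam_eq => t x; rewrite !op_famE. Qed.
Lemma famMDl : left_distributive famM +%R.
Proof. by move=> a b d; apply: fam_eq => t x; rewrite !(op_famE, op_add). Qed.
Lemma famMDr : right_distributive famM +%R.
Proof. by move=> a b d; apply: fam_eq => t x; rewrite !(op_famE, op_add) opD. Qed.
Lemma fam1_neq0 : fam1 != 0.
Proof.
apply/eqP => h; have : op fam1 0 (be R (0%N, false)) = op 0 0 (be R (0%N, false)) by rewrite h.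
by rewrite op_fam1 op_zero => /(congr1 (@hn R)); rewrite hn_be hn0 => /eqP; rewrite oner_eq0.
Qed.
HB.instance Definition _ := GRing.Zmodule_isNzRing.Build fam famMA fam1M famM1 famMDl famMDr fam1_neq0.
Lemma op_mul a b t x : op (a * b) t x = op a t (op b t x). Proof. exact: op_famM. Qed.
Lemma op_one t x : op 1 t x = x. Proof. exact: op_fam1. Qed.

Lemma famZA c c' a : famZ c (famZ c' a) = famZ (c * c') a.
Proof. by apply: fam_eq => t x; rewrite !op_famE scalerA. Qed.
Lemma fam1Z : left_id 1 famZ.
Proof. by move=> a; apply: fam_eq => t x; rewrite !op_famE scale1r. Qed.
Lemma famZDr : right_distributive famZ +%R.
Proof. by move=> c a b; apply: fam_eq => t x; rewrite !(op_famE, op_add) scalerDr. Qed.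
Lemma famZDl a : {morph famZ^~ a : c c' / c + c'}.
Proof. by move=> c c'; apply: fam_eq => t x; rewrite !(op_famE, op_add) scalerDl. Qed.
HB.instance Definition _ := GRing.Zmodule_isLmodule.Build C fam famZA fam1Z famZDr famZDl.
Lemma op_scale c a t x : op (c *: a) t x = c *: op a t x. Proof. exact: op_famZ. Qed.
Lemma famZAl c a b : c *: (a * b) = (c *: a) * b.
Proof. by apply: fam_eq => t x; rewrite !(op_scale, op_mul). Qed.
HB.instance Definition _ := GRing.LSemiModule_isLSemiAlgebra.Build C fam famZAl.
Lemma famZAr c a b : c *: (a * b) = a * (c *: b).
Proof. by apply: fam_eq => t x; rewrite !(op_scale, op_mul) opZ. Qed.
HB.instance Definition _ := GRing.LSemiAlgebra_isSemiAlgebra.Build C fam famZAr.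

Lemma famSK : involutive famS.
Proof. by move=> a; apply: fam_eq => t x; rewrite op_famS ad_famS. Qed.
Lemma famSE a b : (forall t x y, hdot (op a t x) y = hdot x (op b t y)) -> b = famS a.
Proof.
by move=> h; apply: fam_eq => t y; rewrite op_famS; apply: hdot_nondeg => x; rewrite -h op_ad.
Qed.
Lemma famSD : {morph famS : a b / a + b}.
Proof.
move=> a b; apply/esym/famSE => t x y.
by rewrite !op_add !op_famS hdotDl hdotDr !op_ad.
Qed.
Lemma famSM a b : famS (a * b) = famS b * famS a.
Proof. by apply/esym/famSE => t x y; rewrite !op_mul !op_famS !op_ad. Qed.
HB.instance Definition _ := PzRing_isStarRing.Build fam famSK famSD famSM.
Lemma op_star a t x : op (star a) t x = ad a t x. Proof. exact: op_famS. Qed.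
Lemma ad_star a t x : ad (star a) t x = op a t x. Proof. exact: ad_famS. Qed.
Lemma star_eq a b : (forall t x y, hdot (op a t x) y = hdot x (op b t y)) -> b = star a.
Proof. exact: famSE. Qed.

Lemma op_opp a t x : op (- a) t x = - op a t x. Proof. by rewrite -scaleN1r op_scale scaleN1r. Qed.
Lemma opB a t x y : op a t (x - y) = op a t x - op a t y.
Proof. by rewrite opD -scaleN1r opZ scaleN1r. Qed.
Lemma op0 a t : op a t 0 = 0. Proof. by rewrite -(scale0r 0) opZ !scale0r. Qed.
Lemma star_scale c a : star (c *: a) = c^* *: star a.
Proof.
by apply/esym/star_eq => t x y; rewrite !op_scale op_star hdotZl op_ad adZ.
Qed.
Lemma star_one : star (1 : fam) = 1.
Proof. by apply/esym/star_eq => t x y; rewrite !op_one. Qed.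
Lemma star_opp a : star (- a) = - star a.
Proof. by rewrite -scaleN1r star_scale rmorphN1 scaleN1r. Qed.
Lemma star_sub a b : star (a - b) = star a - star b. Proof. by rewrite starD star_opp. Qed.

Definition nrmset a : set R := [set r | exists t x, hn x <= 1 /\ r = hn (op a t x)].
Definition nrm : fam -> R := locked_with lock_key (fun a => sup (nrmset a)).
Lemma nrmE a : nrm a = sup (nrmset a). Proof. by rewrite /nrm locked_withE. Qed.

Lemma nrmset_sup a : has_sup (nrmset a).
Proof.
split; first by exists (hn (op a 0 0)), 0, 0; rewrite hn0.
have [M [M0 hM]] := op_bd a; exists M => _ [t [x [x1 ->]]].
by apply: le_trans (hM _ _) _; rewrite ler_piMr.
Qed.
Lemma nrm_ge0 a : 0 <= nrm a.
Proof.
rewrite nrmE; apply: (@le_trans _ _ (hn (op a 0 0))); first exact: hn_ge0.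
by apply: ub_le_sup; [exact: (nrmset_sup a).2 | exists 0, 0; rewrite hn0].
Qed.
Lemma nrm_le a M : 0 <= M -> (forall t x, hn (op a t x) <= M * hn x) -> nrm a <= M.
Proof.
move=> M0 h; rewrite nrmE; apply: ge_sup; first exact: (nrmset_sup a).1.
by move=> _ [t [x [x1 ->]]]; apply: le_trans (h _ _) _; rewrite ler_piMr.
Qed.
Lemma op_nrm a t x : hn (op a t x) <= nrm a * hn x.
Proof.
have [x0|xn] := eqVneq (hn x) 0; first by rewrite (hn_eq0 x0) op0 hn0 mulr0.
have xp : 0 < hn x by rewrite lt_neqAle eq_sym xn hn_ge0.
rewrite -ler_pdivrMr// mulrC.
have -> : (hn x)^-1 * hn (op a t x) = hn (op a t (rc (hn x)^-1 *: x)).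
  by rewrite opZ hnZ cabs_rc ger0_norm ?invr_ge0 ?hn_ge0.
rewrite nrmE; apply: ub_le_sup; first exact: (nrmset_sup a).2.
exists t, (rc (hn x)^-1 *: x); split=> //.
by rewrite hnZ cabs_rc ger0_norm ?invr_ge0 ?hn_ge0// mulVf.
Qed.
Lemma nrmD a b : nrm (a + b) <= nrm a + nrm b.
Proof.
apply: nrm_le; first by rewrite addr_ge0 ?nrm_ge0.
move=> t x; rewrite op_add; apply: le_trans (hnD _ _) _; rewrite mulrDl lerD//; exact: op_nrm.
Qed.
Lemma nrmM a b : nrm (a * b) <= nrm a * nrm b.
Proof.
apply: nrm_le; first by rewrite mulr_ge0 ?nrm_ge0.
move=> t x; rewrite op_mul; apply: le_trans (op_nrm _ _ _) _.
by rewrite -mulrA ler_wpM2l ?nrm_ge0// op_nrm.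
Qed.
Lemma nrm0_eq0 a : nrm a = 0 -> a = 0.
Proof.
move=> h; apply: fam_eq => t x; rewrite op_zero; apply: hn_eq0; apply/eqP.
by rewrite eq_le hn_ge0 andbT; apply: le_trans (op_nrm _ _ _) _; rewrite h mul0r.
Qed.
Lemma nrm0 : nrm 0 = 0.
Proof.
by apply/eqP; rewrite eq_le nrm_ge0 andbT; apply: nrm_le => // t x; rewrite op_zero hn0 mul0r.
Qed.
Lemma nrmZ c a : nrm (c *: a) = cabs c * nrm a.
Proof.
have le k d : nrm (k *: d) <= cabs k * nrm d.
  apply: nrm_le; first by rewrite mulr_ge0 ?cabs_ge0 ?nrm_ge0.
  by move=> t x; rewrite op_scale hnZ -mulrA ler_wpM2l ?cabs_ge0// op_nrm.
have [->|c0] := eqVneq c 0; first by rewrite scale0r nrm0 cabs0 mul0r.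
apply/eqP; rewrite eq_le le/=.
have cp : 0 < cabs c.
  by rewrite lt_neqAle cabs_ge0 andbT eq_sym; apply: contra_neq c0 => /cabs_eq0.
have h := le c^-1 (c *: a); rewrite scalerA mulVf// scale1r in h.
rewrite -ler_pdivlMl//; apply: le_trans h _.
rewrite ler_wpM2r ?nrm_ge0// -(ler_pM2r cp) -cabsM mulVf// cabs1 mulVf ?lexx//.
by rewrite gt_eqF.
Qed.
Lemma nrmN a : nrm (- a) = nrm a.
Proof. by rewrite -scaleN1r nrmZ cabsN cabs1 mul1r. Qed.
Lemma nrmB a b : nrm (a - b) <= nrm a + nrm b.
Proof. by rewrite -(nrmN b) nrmD. Qed.
Lemma nrmBC a b : nrm (a - b) = nrm (b - a).
Proof. by rewrite -nrmN opprB. Qed.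
Lemma nrm1 : nrm 1 = 1.
Proof.
apply/eqP; rewrite eq_le; apply/andP; split; first by apply: nrm_le => // t x; rewrite op_one mul1r.
by have := op_nrm 1 0 (be R (0%N, false)); rewrite op_one hn_be mulr1.
Qed.
Lemma nrm_star a : nrm (star a) = nrm a.
Proof.
have le d : nrm (star d) <= nrm d.
  by apply: nrm_le; [exact: nrm_ge0 | move=> t x; rewrite op_star; apply: op_bdP; [exact: nrm_ge0|exact: op_nrm]].
by apply/eqP; rewrite eq_le le/= -{1}[a]starK le.
Qed.
Lemma nrm_cstar a : nrm (star a * a) = nrm a ^+ 2.
Proof.
apply/eqP; rewrite eq_le; apply/andP; split.
  by apply: le_trans (nrmM _ _) _; rewrite nrm_star expr2.
rewrite -[leRHS]sqr_sqrtr ?nrm_ge0// ler_sqr ?nnegrE ?nrm_ge0 ?sqrtr_ge0//.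
apply: nrm_le; first exact: sqrtr_ge0.
move=> t x; rewrite -ler_sqr ?nnegrE ?hn_ge0 ?mulr_ge0 ?sqrtr_ge0 ?hn_ge0//.
rewrite exprMn sqr_hn [X in _ * X]sqr_hn sqr_sqrtr ?nrm_ge0// op_ad -op_star -op_mul.
apply: le_trans (ler_norm _) _; apply: le_trans (hdot_CS _ _) _.
by rewrite -sqr_hn mulrC expr2 mulrA ler_wpM2r ?hn_ge0// op_nrm.
Qed.

Definition ncauchy (u : nat -> fam) := forall e, 0 < e ->
  exists K, forall k l, (K <= k)%N -> (K <= l)%N -> nrm (u k - u l) <= e.
Definition nlim (u : nat -> fam) a := forall e, 0 < e ->
  exists K, forall k, (K <= k)%N -> nrm (u k - a) <= e.

Lemma hlimD u v x y : hlim u x -> hlim v y -> hlim (fun n => u n + v n) (x + y).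
Proof.
move=> hx hy e e0; have [K hK] := hx _ (divr_gt0 e0 (ltr0n _ 2)).
have [L hL] := hy _ (divr_gt0 e0 (ltr0n _ 2)).
exists (maxn K L) => k; rewrite geq_max => /andP[/hK h1 /hL h2].
have -> : u k + v k - (x + y) = (u k - x) + (v k - y) by rewrite opprD addrACA.
by apply: le_trans (hnD _ _) _; lra.
Qed.
Lemma hlim_bd u x M : hlim u x -> (forall n, hn (u n) <= M) -> hn x <= M.
Proof.
move=> hx hM; apply/ler_addgt0Pr => e e0; have [K hK] := hx _ e0.
rewrite -[x](subKr (u K)); apply: le_trans (hnB _ _) _; exact: lerD (hM _) (hK _ _).
Qed.
Lemma hlimZ c u x : hlim u x -> hlim (fun n => c *: u n) (c *: x).
Proof.
move=> hx e e0; have p : 0 < cabs c + 1 by rewrite ltr_wpDl ?cabs_ge0.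
have [K hK] := hx _ (divr_gt0 e0 p); exists K => k /hK h.
rewrite -scalerBr hnZ; rewrite ler_pdivlMr// in h; apply: le_trans h.
by rewrite mulrC ler_wpM2l ?hn_ge0// lerDl.
Qed.
Lemma hlim_dot2 u v x y : hlim u x -> hlim v y -> (exists M, forall n, hn (u n) <= M) ->
  forall z w, (forall n, hdot (u n) z = hdot w (v n)) -> hdot x z = hdot w y.
Proof.
move=> hx hy _ z w h; apply/eqP; rewrite -subr_eq0 -normr_eq0 eq_le normr_ge0 andbT.
apply/ler_addgt0Pr => e e0; rewrite add0r.
have p : 0 < hn z + hn w + 1 by rewrite ltr_wpDl ?addr_ge0 ?hn_ge0.
have [K hK] := hx _ (divr_gt0 e0 p); have [L hL] := hy _ (divr_gt0 e0 p).
have h1 := hK _ (leq_maxl K L); have h2 := hL _ (leq_maxr K L); set n := maxn K L in h1 h2.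
have -> : hdot x z - hdot w y = hdot w (v n - y) - hdot (u n - x) z.
  by rewrite hdotBr hdotBl h; ring.
apply: le_trans (ler_normB _ _) _; have := hdot_CS w (v n - y); have := hdot_CS (u n - x) z.
rewrite ler_pdivlMr// in h1; rewrite ler_pdivlMr// in h2.
have := hn_ge0 z; have := hn_ge0 w; have := hn_ge0 (v n - y); have := hn_ge0 (u n - x).
nra.
Qed.

(** Taking adjoints is not strongly continuous, and the limit has to carry its own adjoint; hence
    the separate assumption on [ad]. *)
Lemma strong_limit (u : nat -> fam) M : 0 <= M ->
  (forall n, nrm (u n) <= M) ->
  (forall t x, hcauchy (fun n => op (u n) t x)) ->
  (forall t x, hcauchy (fun n => ad (u n) t x)) ->
  exists a, [/\ nrm a <= M, forall t x, hlim (fun n => op (u n) t x) (op a t x)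
    & forall t x, hlim (fun n => ad (u n) t x) (ad a t x)].
Proof.
move=> M0 hM cu cv.
have ex1 (p : R * H) : exists y, hlim (fun n => op (u n) p.1 p.2) y by apply: hilb_complete.
have ex2 (p : R * H) : exists y, hlim (fun n => ad (u n) p.1 p.2) y by apply: hilb_complete.
have [f hf] := choice ex1; have [g hg] := choice ex2.
have bd t x : hn (f (t, x)) <= M * hn x.
  apply: hlim_bd (hf (t, x)) _ => n /=; apply: le_trans (op_nrm _ _ _) _.
  by rewrite ler_wpM2r ?hn_ge0.
unshelve eexists (@Fam (fun t x => f (t, x)) (fun t x => g (t, x)) _ _ _ _).
- move=> t x y; apply: (hlim_unique (hf (t, x + y))) => /=.
  by under eq_fun do rewrite opD; apply: hlimD; [exact: (hf (t, x))|exact: (hf (t, y))].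
- move=> t c x; apply: (hlim_unique (hf (t, c *: x))) => /=.
  by under eq_fun do rewrite opZ; apply: hlimZ; exact: (hf (t, x)).
- move=> t x y; apply: (hlim_dot2 (hf (t, x)) (hg (t, y))) => /=; last by move=> n; rewrite op_ad.
  by exists (M * hn x) => n; apply: le_trans (op_nrm _ _ _) _; rewrite ler_wpM2r ?hn_ge0.
- by exists M; split.
split.
- by apply: nrm_le.
- by move=> t x; exact: (hf (t, x)).
- by move=> t x; exact: (hg (t, x)).
Qed.

Lemma fam_complete u : ncauchy u -> exists a, nlim u a.
Proof.
move=> hu.
have cau (v : nat -> fam) : ncauchy v -> forall t x, hcauchy (fun n => op (v n) t x).
  move=> hv t x e e0; have p : 0 < hn x + 1 by rewrite ltr_wpDl ?hn_ge0.
  have [K hK] := hv _ (divr_gt0 e0 p); exists K => k l Kk Kl.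
  rewrite -op_opp -op_add; apply: le_trans (op_nrm _ _ _) _.
  have := hK k l Kk Kl; rewrite ler_pdivlMr// => h; apply: le_trans h.
  by rewrite ler_wpM2l ?nrm_ge0// lerDl.
have hus : ncauchy (fun n => star (u n)).
  by move=> e /hu[K hK]; exists K => k l Kk Kl; rewrite -star_sub nrm_star hK.
(* Dropping the first terms yields the uniform bound |u_K0| + 1 that [strong_limit] asks for. *)
have [K0 hK0] := hu 1 ltr01; pose v n := u (K0 + n)%N.
have hv : ncauchy v.
  move=> e /hu[K hK]; exists K => k l Kk Kl; apply: hK; exact: leq_trans (leq_addl _ _).
have hvs : ncauchy (fun n => star (v n)).
  by move=> e /hv[K hK]; exists K => k l Kk Kl; rewrite -star_sub nrm_star hK.
have [||||a [_ ha _]] := @strong_limit v (nrm (u K0) + 1).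
- by rewrite addr_ge0 ?nrm_ge0.
- move=> n; rewrite -[v n](subrK (u K0)); apply: le_trans (nrmD _ _) _.
  by rewrite addrC lerD2l hK0// leq_addr.
- exact: cau.
- by move=> t x e /(cau _ hvs t x)[K hK]; exists K => k l Kk Kl; rewrite -!op_star; exact: hK.
exists a => e e0; have [K hK] := hu _ e0; exists (K0 + K)%N => k Kk.
apply: nrm_le (ltW e0) _ => t x.
rewrite op_add op_opp; apply: (@hlim_bd (fun n => op (u k) t x - op (v (K + n)%N) t x)).
  move=> d d0; have [L hL] := ha t x _ d0; exists L => l Ll.
  rewrite opprB addrC addrA subrK hnC hL//; exact: leq_trans (leq_addl _ _).
move=> n; rewrite -op_opp -op_add; apply: le_trans (op_nrm _ _ _) _.
rewrite ler_wpM2r ?hn_ge0// hK//; first exact: leq_trans (leq_addl _ _) Kk.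
by rewrite /v addnCA leq_addr.
Qed.
End Fam.

(* [lra] compares atoms up to conversion, which is very slow on norms. *)
Ltac gen_norms :=
  repeat match goal with
  | |- context [nrm ?a] => let k := fresh "k" in set k := nrm a in *; clearbody k
  | |- context [hn ?a] => let k := fresh "k" in set k := hn a in *; clearbody k
  | H : context [nrm ?a] |- _ => let k := fresh "k" in set k := nrm a in *; clearbody k
  | H : context [hn ?a] |- _ => let k := fresh "k" in set k := hn a in *; clearbody k
  end.
Ltac nlra := gen_norms; lra.

(** * Functional calculus near the identity *)

Section Tools.
Variable R : realType.
Local Notation C := R[i].
Local Notation A := (fam R).
Implicit Types a b d p q x y z : A.

Lemma nrm_le_rc (k : R) a : 0 <= k -> nrm (rc k *: a) = k * nrm a.
Proof. by move=> k0; rewrite nrmZ cabs_rc ger0_norm. Qed.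

Lemma nrm_small0 M x : (forall e, 0 < e -> nrm x <= M * e) -> x = 0.
Proof.
move=> h; apply: nrm0_eq0; apply/eqP; rewrite eq_le nrm_ge0 andbT.
apply/ler_addgt0Pr => e e0; rewrite add0r.
have p : 0 < `|M| + 1 by rewrite ltr_wpDl.
apply: le_trans (h _ (divr_gt0 e0 p)) _.
rewrite mulrA ler_pdivrMr// mulrC ler_wpM2l ?(ltW e0)//.
by apply: le_trans (ler_norm _) _; rewrite lerDl.
Qed.

Definition nclosed (B : set A) :=
  forall x, (forall e, 0 < e -> exists2 y, B y & nrm (x - y) <= e) -> B x.

(** Closure under exactly the operations of the iterations in [inv_sqrt], without unit, adjoints or
    general scalars. Annihilators of a vector, operators of a finite window and families vanishing
    at 0 are thus included, and a single clause of [inv_sqrt] yields all permanence properties of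
    the square root. *)
Record clsub (B : set A) : Prop := Clsub {
  cl0 : B 0;
  clD : forall a b, B a -> B b -> B (a + b);
  clH : forall a, B a -> B (2^-1 *: a);
  clM : forall a b, B a -> B b -> B (a * b);
  clC : nclosed B }.

Record csub (B : set A) : Prop := Csub {
  cs1 : B 1;
  csD : forall a b, B a -> B b -> B (a + b);
  csZ : forall (c : C) a, B a -> B (c *: a);
  csM : forall a b, B a -> B b -> B (a * b);
  csS : forall a, B a -> B (star a);
  csC : nclosed B }.

Lemma csN B a : csub B -> B a -> B (- a).
Proof. by move=> sB Ba; rewrite -scaleN1r; apply: csZ. Qed.
Lemma csB B a b : csub B -> B a -> B b -> B (a - b).
Proof. by move=> sB Ba Bb; apply: csD => //; apply: csN. Qed.
Lemma cs0 B : csub B -> B 0.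
Proof. by move=> sB; rewrite -(scale0r (1 : A)); apply: (csZ sB); apply: (cs1 sB). Qed.
Lemma csub_clsub B : csub B -> clsub B.
Proof.
move=> sB; split; [exact: cs0| exact: csD sB | | exact: csM sB| exact: csC sB].
by move=> a; apply: csZ.
Qed.

Lemma half_pow (c e : R) : 0 < e -> exists K, forall k, (K <= k)%N -> c * 2^-1 ^+ k <= e.
Proof.
move=> e0; exists (Num.bound (`|c| / e)) => k Kk.
rewrite exprVn ler_pdivrMr ?exprn_gt0//; apply: le_trans (ler_norm c) _.
rewrite mulrC -ler_pdivrMr//; apply/ltW/(lt_le_trans (archi_boundP _)).
  by rewrite divr_ge0// ltW.
rewrite -natrX ler_nat; apply: leq_trans Kk _; exact/ltnW/ltn_expl.
Qed.

(** Banach iteration from 0 with ratio 1/2; all iterates stay in [B], and so does the limit. *)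
Lemma fixpoint (B : set A) (F : A -> A) : nclosed B -> B 0 ->
  (forall x, B x -> B (F x)) ->
  (forall x y, B x -> B y -> nrm (F x - F y) <= 2^-1 * nrm (x - y)) ->
  exists2 x, B x & F x = x.
Proof.
move=> cB B0 BF cF; pose u n := iter n F 0; pose c := nrm (F 0).
have Bu n : B (u n) by elim: n => //= n; apply: BF.
have c0 : 0 <= c := nrm_ge0 _.
have h n m : nrm (u (m + n)%N - u n) <= (2 * c) * 2^-1 ^+ n.
  elim: n => [|n IH].
    rewrite addn0 expr0 mulr1; elim: m => [|m IH]; first by rewrite subrr nrm0 mulr_ge0.
    rewrite /= -[F (u m) - _](subrKA (F 0)); apply: le_trans (nrmD _ _) _.
    by have := cF _ _ (Bu m) B0; rewrite /= in IH *; rewrite !subr0 -/c in IH *; nlra.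
  rewrite addnS /=; apply: le_trans (cF _ _ (Bu _) (Bu _)) _.
  rewrite exprS mulrCA ler_wpM2l ?invr_ge0//.
have cu : ncauchy u.
  move=> e e0; have [K hK] := half_pow (2 * c) e0.
  exists K => k l Kk Kl; case/orP: (leq_total k l) => kl.
    by rewrite nrmBC -(subnK kl); apply: le_trans (h _ _) (hK _ Kk).
  by rewrite -(subnK kl); apply: le_trans (h _ _) (hK _ Kl).
have [x hx] := fam_complete cu.
have Bx : B x.
  by apply: cB => e /hx[K hK]; exists (u K) => //; rewrite nrmBC hK.
exists x => //; apply/eqP; rewrite -subr_eq0; apply/eqP.
apply: (@nrm_small0 2) => e /hx[K hK].
have L (k l m : R) : k <= e -> l <= e -> m <= 2^-1 * k -> 0 <= k -> m + l <= 2 * e.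
  by clear; lra.
rewrite -(subrKA (u K.+1)); apply: le_trans (nrmD _ _) _; apply: L (hK _ (leqnn K)) (hK _ (leqnSn K)) _ _.
  by rewrite (nrmBC (u K)); exact: cF.
exact: nrm_ge0.
Qed.

Lemma nclosed_eq (f : A -> A) M : 0 <= M ->
  (forall x y, nrm (f x - f y) <= M * nrm (x - y)) -> nclosed [set x | f x = 0].
Proof.
move=> M0 hf x hx /=; apply: (@nrm_small0 M) => e /hx[y /= fy h].
by rewrite -[f x]subr0 -fy; apply: le_trans (hf _ _) _; rewrite ler_wpM2l.
Qed.

Lemma clsub_comm d : clsub [set y | y * d = d * y].
Proof.
split=> /=.
- by rewrite mul0r mulr0.
- by move=> a b h1 h2; rewrite mulrDl mulrDr h1 h2.
- by move=> a h; rewrite -scalerAl h scalerAr.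
- by move=> a b h1 h2; rewrite -mulrA h2 mulrA h1 mulrA.
- rewrite (_ : [set _ | _] = [set y | y * d - d * y = 0]); last first.
    by apply/seteqP; split=> y /= h; apply/eqP; [rewrite subr_eq0 h|rewrite -subr_eq0 h].
  apply: (@nclosed_eq (fun y => y * d - d * y) (2 * nrm d)); first by rewrite mulr_ge0 ?nrm_ge0.
  move=> x y; have -> : x * d - d * x - (y * d - d * y) = (x - y) * d - d * (x - y).
    nring.
  apply: le_trans (nrmB _ _) _.
  by rewrite -mulrA mulr_natl mulr2n lerD ?nrmM// mulrC nrmM.
Qed.

Lemma clsub_kill t (v : hilb R) : clsub [set y | op y t v = 0].
Proof.
split=> /=.
- exact: op_zero.
- by move=> a b h1 h2; rewrite op_add h1 h2 addr0.
- by move=> a h; rewrite op_scale h scaler0.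
- by move=> a b h1 h2; rewrite op_mul h2 op0.
- move=> x h; apply: hn_eq0; apply/eqP; rewrite eq_le hn_ge0 andbT.
  apply/ler_addgt0Pr => e e0; rewrite add0r.
  have p : 0 < hn v + 1 by rewrite ltr_wpDl ?hn_ge0.
  have [y /= hy] := h _ (divr_gt0 e0 p); rewrite ler_pdivlMr// => xy.
  have -> : op x t v = op (x - y) t v by rewrite op_add op_opp hy subr0.
  apply: le_trans (op_nrm _ _ _) _; apply: le_trans xy.
  by rewrite ler_wpM2l ?nrm_ge0// lerDl.
Qed.

(** The second condition puts [y] into the bicommutant of [a]. Members therefore commute with each
    other, which keeps their products self-adjoint. *)
Lemma clsub_sa a : star a = a ->
  clsub [set y | star y = y /\ forall d, a * d = d * a -> y * d = d * y].
Proof.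
move=> sa; split=> /=.
- by split; [rewrite -(scale0r (1 : A)) star_scale rmorph0 !scale0r|move=> d _; rewrite mul0r mulr0].
- by move=> x y [h1 h2] [h3 h4]; split; [rewrite starD h1 h3|move=> d hd; rewrite mulrDl mulrDr h2// h4].
- move=> x [h1 h2]; split; first by rewrite star_scale h1 rc_half rcJ.
  by move=> d hd; rewrite -scalerAl h2// scalerAr.
- move=> x y [h1 h2] [h3 h4]; split; last by move=> d hd; rewrite -mulrA (h4 d hd) !mulrA (h2 d hd).
  by rewrite starM h1 h3 -h2//; apply/esym/h4.
- move=> x h; split.
    apply/eqP; rewrite -subr_eq0; apply/eqP; apply: (@nrm_small0 2) => e /h[y [hy _] xy].
    have -> : star x - x = star (x - y) - (x - y) by rewrite star_sub hy; nring.
    apply: le_trans (nrmB _ _) _; rewrite nrm_star; nlra.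
  move=> d hd; apply: (clC (clsub_comm d)) => e /h[y [_ hy] xy]; exists y => //=; exact: hy.
Qed.

Lemma clsub_gen a : clsub [set y | forall B, clsub B -> B a -> B y].
Proof.
split=> /=.
- by move=> B [].
- by move=> x y h1 h2 B sB Ba; apply: (clD sB); [apply: h1|apply: h2].
- by move=> x h B sB Ba; apply: (clH sB); apply: h.
- by move=> x y h1 h2 B sB Ba; apply: (clM sB); [apply: h1|apply: h2].
- by move=> x h B sB Ba; apply: (clC sB) => e /h[y hy xy]; exists y => //; apply: hy.
Qed.

Lemma nclosed_ball M : nclosed [set x | nrm x <= M].
Proof.
move=> x h /=; apply/ler_addgt0Pr => e /h[y /= yM xy].
by rewrite -[x](subrK y) addrC; apply: le_trans (nrmD _ _) _; rewrite lerD.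
Qed.
Lemma nclosedI B B' : nclosed B -> nclosed B' -> nclosed (B `&` B').
Proof. by move=> h h' x hx; split; [apply: h|apply: h'] => e /hx[y [? ?] ?]; exists y. Qed.

(* The square root of [z] is [1 - r] and its inverse is [1 + s]; [r] and [s] solve
   [r = (1 - z + r^2) / 2] and [s = r + r s]. *)
Lemma inv_sqrt z : nrm (1 - z) <= 2^-1 -> exists r s,
  [/\ (1 - r) * (1 - r) = z, (1 - r) * (1 + s) = 1 /\ (1 + s) * (1 - r) = 1,
      nrm r <= nrm (1 - z), nrm s <= 2 * nrm (1 - z)
    & forall B, clsub B -> B (1 - z) -> B r /\ B s].
Proof.
set a := 1 - z => ha.
pose gen := [set y | forall B, clsub B -> B a -> B y].
have sg : clsub gen := clsub_gen a.
have ga : gen a by [].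
have n2 x : nrm (2^-1 *: x) = 2^-1 * nrm x.
  by rewrite rc_half nrm_le_rc// invr_ge0.
(* On the ball of radius 1/2 the map x -> (a + x^2) / 2 has Lipschitz constant 1/2, since x^2 - y^2
   = x (x - y) + (x - y) y. The iteration runs in the smallest [clsub] set containing [a], so that
   its limit lies in all of them. *)
have [r [gr nr] hr] : exists2 r, (gen `&` [set x | nrm x <= 2^-1]) r & 2^-1 *: (a + r * r) = r.
  apply: fixpoint.
  - by apply: nclosedI; [exact: clC sg|exact: nclosed_ball].
  - by split; [exact: cl0 sg|rewrite /= nrm0 invr_ge0].
  - move=> x [gx /= nx]; split; first by apply: (clH sg); apply: (clD sg) => //; apply: (clM sg).
    rewrite /= n2; have := nrmD a (x * x); have := nrmM x x; have := nrm_ge0 x.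
    by move: (nrm x) nx => k; (gen_norms; nra).
  - move=> x y [_ /= nx] [_ /= ny]; rewrite -scalerBr n2 ler_wpM2l ?invr_ge0//.
    have -> : a + x * x - (a + y * y) = x * (x - y) + (x - y) * y.
      nring.
    apply: le_trans (nrmD _ _) _.
    apply: le_trans (lerD (nrmM _ _) (nrmM _ _)) _.
    rewrite [leRHS](_ : _ = 2^-1 * nrm (x - y) + nrm (x - y) * 2^-1); last by field.
    by apply: lerD; [apply: ler_wpM2r|apply: ler_wpM2l] => //; exact: nrm_ge0.
have [s gs hs] : exists2 s, gen s & r + r * s = s.
  apply: fixpoint; [exact: clC sg|exact: cl0 sg| |].
  - by move=> x gx; apply: (clD sg) => //; apply: (clM sg).
  - move=> x y _ _; have -> : r + r * x - (r + r * y) = r * (x - y).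
      nring.
    by apply: le_trans (nrmM _ _) _; rewrite ler_wpM2r ?nrm_ge0.
have ra : r * a = a * r by apply: (gr _ (clsub_comm a)).
have sr : s * r = r * s by apply: (gs _ (clsub_comm r)) => /=; rewrite ra.
have nra : nrm r <= nrm a.
  have : nrm r <= 2^-1 * (nrm a + 2^-1 * nrm r).
    rewrite -{1}hr n2 ler_wpM2l ?invr_ge0//; apply: le_trans (nrmD _ _) _; rewrite lerD2l.
    by apply: le_trans (nrmM _ _) _; rewrite ler_wpM2r ?nrm_ge0.
  have := nrm_ge0 r; have := nrm_ge0 a; nlra.
exists r, s; split=> //.
- have : 2 *: (2^-1 *: (a + r * r)) = 2 *: r by rewrite hr.
  rewrite scalerA mulfV ?pnatr_eq0// scale1r scaler_nat mulr2n => h.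
  have -> : z = 1 - a by rewrite /a; nring.
  have -> : (1 - r) * (1 - r) = 1 - (r + r) + r * r by nring.
  rewrite -h; nring.
- split.
    have -> : (1 - r) * (1 + s) = 1 - r - r * s + s by nring.
    by rewrite -{2}hs; nring.
  have -> : (1 + s) * (1 - r) = 1 - r - s * r + s by nring.
  by rewrite sr -{2}hs; nring.
- have : nrm s <= nrm r + 2^-1 * nrm s.
    rewrite -{1}hs; apply: le_trans (nrmD _ _) _; rewrite lerD2l.
    by apply: le_trans (nrmM _ _) _; rewrite ler_wpM2r ?nrm_ge0.
  have := nrm_ge0 s; nlra.
- by move=> B sB Ba; split; [apply: gr|apply: gs].
Qed.

Lemma subr_comm d a : d * a = a * d -> d * (1 - a) = (1 - a) * d.
Proof. by move=> h; rewrite mulrBr mulrBl h mulr1 mul1r. Qed.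

(* [h] plays the role of [z^(-1/2)]. *)
Lemma inv_sqrt_sa z : star z = z -> nrm (1 - z) <= 2^-1 -> exists h,
  [/\ star h = h, h * z * h = 1, nrm (1 - h) <= 2 * nrm (1 - z),
      forall d, z * d = d * z -> h * d = d * h
    & (forall B, csub B -> B z -> B h) /\ (forall t v, op z t v = v -> op h t v = v)].
Proof.
move=> sz /inv_sqrt[r [s [rr [rs sr] _ ns sub]]]; exists (1 + s).
have [ss sc] : star s = s /\ forall d, (1 - z) * d = d * (1 - z) -> s * d = d * s.
  have s1z : star (1 - z) = 1 - z by rewrite star_sub star_one sz.
  by have [_] := sub _ (clsub_sa s1z) (conj s1z (fun d h => h)).
split.
- by rewrite starD star_one ss.
- by rewrite -rr mulrA sr mul1r rs.
- by rewrite opprD addrA subrr sub0r nrmN.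
- by move=> d hd; rewrite mulrDl mulrDr mul1r mulr1 sc// -subr_comm.
- split=> [B sB Bz|t v hv].
    exact: (csD sB (cs1 sB) (sub B (csub_clsub sB) (csB sB (cs1 sB) Bz)).2).
  have hz : op (1 - z) t v = 0 by rewrite op_add op_opp op_one hv subrr.
  by have [_ sv] := sub _ (clsub_kill t v) hz; rewrite op_add op_one sv addr0.
Qed.

Lemma sqrt_sa z : star z = z -> nrm (1 - z) <= 2^-1 ->
  exists d, [/\ star d = d, d * d = z & forall B, csub B -> B z -> B d].
Proof.
move=> sz /inv_sqrt[r [s [rr _ _ _ sub]]]; exists (1 - r).
have s1z : star (1 - z) = 1 - z by rewrite star_sub star_one sz.
have [[sr _] _] := sub _ (clsub_sa s1z) (conj s1z (fun d h => h)).
split=> //; first by rewrite star_sub star_one sr.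
move=> B sB Bz.
exact: (csB sB (cs1 sB) (sub B (csub_clsub sB) (csB sB (cs1 sB) Bz)).1).
Qed.

Lemma projectionB p : projection p -> projection (1 - p).
Proof.
move=> [h1 h2]; split; first by rewrite star_sub star_one h1.
have -> : (1 - p) * (1 - p) = 1 - p - p + p * p by nring.
by rewrite h2; nring.
Qed.

(* The unitary is the polar part of [qp + (1 - q)(1 - p)]. *)
Lemma near_projections p q : projection p -> projection q -> nrm (p - q) <= 2^-1 ->
  exists u, [/\ unitary u, u * p = q * u, (forall B, csub B -> B p -> B q -> B u)
    & forall t v, op p t v = op q t v -> op u t v = v].
Proof.
move=> [sp pp] [sq qq] npq.
(* [w] intertwines p and q, and both [star w * w] and [w * star w] equal [z]. As [z] commutes with
   [w] and p, multiplying by its inverse square root makes [w] unitary and keeps the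
   intertwining. *)
pose w := q * p + (1 - q) * (1 - p); pose z := 1 - (p - q) * (p - q).
have zE : z = 1 - p - q + p * q + q * p.
  have -> : z = 1 - p * p - q * q + p * q + q * p by rewrite /z; nring.
  by rewrite pp qq.
have sw : star w = p * q + (1 - p) * (1 - q).
  by rewrite /w starD !starM !star_sub star_one sp sq.
have e1 x y : x * x = x -> y * y = y ->
    (x * y + (1 - x) * (1 - y)) * (y * x + (1 - y) * (1 - x)) = 1 - x - y + x * y + y * x.
  move=> hx hy.
  have -> : (x * y + (1 - x) * (1 - y)) * (y * x + (1 - y) * (1 - x)) =
     x * (y * y) * x + x * (y - y * y) * (1 - x) + (1 - x) * (y - y * y) * x
     + (1 - x) * (1 - y - (y - y * y)) * (1 - x) by nring.
  rewrite hy subrr.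
  have -> : x * y * x + x * 0 * (1 - x) + (1 - x) * 0 * x + (1 - x) * (1 - y - 0) * (1 - x) =
    1 - x - y + x * y + y * x - (x - x * x) by nring.
  by rewrite hx subrr subr0.
have ww : star w * w = z by rewrite sw e1.
have ww' : w * star w = z by rewrite sw e1// zE; nring.
have sz : star z = z by rewrite -ww starM starK.
have nz : nrm (1 - z) <= 2^-1.
  have -> : 1 - z = (p - q) * (p - q) by rewrite /z; nring.
  apply: le_trans (nrmM _ _) _; apply: le_trans (ler_wpM2l (nrm_ge0 _) npq) _.
  by rewrite ger_pMl ?invr_gt0//; apply: le_trans npq _; rewrite invf_le1// ler1n.
have [h [sh hzh _ hc [hB hv]]] := inv_sqrt_sa sz nz.
have wz : z * w = w * z by rewrite -{1}ww' -mulrA ww.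
have hw : h * w = w * h by apply: hc.
have zp : z * p = p * z.
  have -> : z * p = p * q * p + (p - p * p) + q * (p * p - p) by rewrite zE; nring.
  have -> : p * z = p * q * p + (p - p * p) + (p * p - p) * q by rewrite zE; nring.
  by rewrite pp subrr mulr0 mul0r.
have hw' : star w * h = h * star w by rewrite -{1}sh -starM hw starM sh.
exists (w * h); split.
- rewrite /unitary starM sh; split.
    have -> : h * star w * (w * h) = h * (star w * w) * h by nring.
    by rewrite ww.
  rewrite -hw -hw'; have -> : h * w * (star w * h) = h * (w * star w) * h by nring.
  by rewrite ww'.
- rewrite -mulrA (hc p zp) mulrA mulrA; congr (_ * h).
  have -> : w * p = q * (p * p) + (1 - q) * (p - p * p) by rewrite /w; nring.
  have -> : q * w = q * q * p + (q - q * q) * (1 - p) by rewrite /w; nring.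
  by rewrite pp qq !subrr mulr0 mul0r.
- move=> B sB Bp Bq; have B1 := cs1 sB.
  have Bz : B z := csB sB B1 (csM sB (csB sB Bp Bq) (csB sB Bp Bq)).
  apply: (csM sB _ (hB B sB Bz)).
  exact: (csD sB (csM sB Bq Bp) (csM sB (csB sB B1 Bq) (csB sB B1 Bp))).
- move=> t v hpq; rewrite op_mul hv; last first.
    by rewrite /z op_add op_opp op_mul [op (p - q) t v]op_add op_opp hpq subrr op0 op_one subr0.
  rewrite /w op_add !op_mul ![op (1 - _) t _]op_add !op_opp !op_one hpq -op_mul qq.
  by rewrite opB -op_mul qq subrr subr0 addrC subrK.
Qed.

(* The projection is [(1 + sgn (2x - 1)) / 2]. *)
Lemma near_projection x : star x = x -> nrm (x * x - x) <= 8^-1 ->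
  exists p, [/\ projection p, nrm (p - x) <= 8 * nrm (x * x - x),
    (forall B, csub B -> B x -> B p)
    & forall t v, (op x t v = 0 -> op p t v = 0) /\ (op x t v = v -> op p t v = v)].
Proof.
move=> sx nx; pose S := x + x - 1.
(* The factor 4 turns the threshold 1/8 into the bound 1/2 under which [inv_sqrt_sa] applies. *)
have SS : 1 - S * S = rc (- 4) *: (x * x - x).
  have -> : rc (- 4) = - (1 + 1 + 1 + 1) :> C by rewrite -!(rc1 R) -!rcD -rcN; congr (rc _); lra.
  by rewrite scaleNr !scalerDl !scale1r /S; nring.
have sS : star S = S by rewrite /S star_sub starD star_one sx.
have nSS : nrm (1 - S * S) = 4 * nrm (x * x - x) by rewrite SS nrmZ cabs_rc normrN ger0_norm.
have nz : nrm (1 - S * S) <= 2^-1 by rewrite nSS; nlra.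
have sSS : star (S * S) = S * S by rewrite starM sS.
have [h [sh hzh nh hc [hB hv]]] := inv_sqrt_sa sSS nz.
have hS : h * S = S * h by apply: hc; rewrite mulrA.
have hSh : (S * h) * (S * h) = 1.
  rewrite -{1}hS; have -> : h * S * (S * h) = h * (S * S) * h by nring.
  exact: hzh.
have nS : nrm S <= 2.
  rewrite -ler_sqr ?nnegrE ?nrm_ge0// -nrm_cstar sS -[S * S](subKr 1).
  apply: le_trans (nrmB _ _) _; rewrite nrm1; apply: le_trans (lerD (lexx _) nz) _; clear; lra.
pose p := 2^-1 *: (1 + S * h).
have c2 (y : A) : y + y = (2 : C) *: y by rewrite scaler_nat mulr2n.
have h2 : (2^-1 : C) * 2 = 1 by rewrite mulVf// pnatr_eq0.
have half (y : A) : 2^-1 *: (y + y) = y by rewrite c2 scalerA h2 scale1r.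
have xE : x = 2^-1 *: (1 + S) by rewrite /S addrC subrK half.
exists p; split.
- split; first by rewrite /p star_scale rc_half rcJ starD star_one starM sS sh hS.
  rewrite /p -scalerAl -scalerAr.
  have -> : (1 + S * h) * (1 + S * h) = 1 + S * h + S * h + (S * h) * (S * h) by nring.
  rewrite hSh (_ : 1 + S * h + S * h + 1 = (1 + S * h) + (1 + S * h)); last by nring.
  by rewrite half.
- have -> : p - x = rc (- 2^-1) *: (S * (1 - h)).
    rewrite rcN -rc_half scaleNr -scalerN xE /p -scalerBr; congr (_ *: _); nring.
  have L (k l m n : R) : k <= l * m -> l <= 2 -> m <= 2 * (4 * n) -> 0 <= m -> 2^-1 * k <= 8 * n.
    by clear => kl l2 mn m0; have := ler_wpM2r m0 l2; lra.
  rewrite nrmZ cabs_rc normrN (ger0_norm (_ : 0 <= 2^-1)) ?invr_ge0; last by [].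
  by apply: L (nrmM _ _) nS _ (nrm_ge0 _); rewrite -nSS.
- move=> B sB Bx; have B1 := cs1 sB; have BS : B S := csB sB (csD sB Bx Bx) B1.
  exact: (csZ sB _ (csD sB B1 (csM sB BS (hB B sB (csM sB BS BS))))).
- move=> t v; split=> hx.
    have Sv : op S t v = - v by rewrite /S !op_add hx op_opp op_one !add0r.
    have hvv : op h t v = v by apply: hv; rewrite op_mul Sv -scaleN1r opZ Sv scaleN1r opprK.
    by rewrite /p op_scale op_add op_mul hvv Sv op_one subrr scaler0.
  have Sv : op S t v = v by rewrite /S !op_add hx op_opp op_one addrK.
  have hvv : op h t v = v by apply: hv; rewrite op_mul !Sv.
  rewrite /p op_scale op_add op_mul hvv Sv op_one (_ : v + v = (2 : C) *: v).
    by rewrite scalerA h2 scale1r.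
  by rewrite scaler_nat mulr2n.
Qed.

Definition ueq (B : set A) p q := exists u, [/\ B u, unitary u & u * p * star u = q].

Lemma ueq_refl B p : csub B -> ueq B p p.
Proof.
move=> sB; exists 1; split; first exact: cs1.
  by split; rewrite star_one mulr1.
by rewrite star_one mulr1 mul1r.
Qed.
Lemma unitary_star (u : A) : unitary u -> unitary (star u).
Proof. by move=> [h1 h2]; split; rewrite starK. Qed.
Lemma unitaryM (u v : A) : unitary u -> unitary v -> unitary (u * v).
Proof.
move=> [h1 h2] [h3 h4]; split; rewrite starM.
  by rewrite mulrA -[_ * star u * u]mulrA h1 mulr1.
by rewrite mulrA -[_ * v * star v]mulrA h4 mulr1.
Qed.
Lemma ueq_sym B p q : csub B -> ueq B p q -> ueq B q p.
Proof.
move=> sB [u [Bu [u1 u2] <-]]; exists (star u); split; first exact: csS.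
  exact: unitary_star.
by rewrite starK !mulrA u1 mul1r -mulrA u1 mulr1.
Qed.
Lemma ueq_trans B p q x : csub B -> ueq B p q -> ueq B q x -> ueq B p x.
Proof.
move=> sB [u [Bu uu <-]] [v [Bv uv <-]]; exists (v * u); split; first exact: csM.
  exact: unitaryM.
by rewrite starM !mulrA.
Qed.
Lemma near_ueq B p q : csub B -> B p -> B q -> projection p -> projection q ->
  nrm (p - q) <= 2^-1 -> ueq B p q.
Proof.
move=> sB Bp Bq pp pq /(near_projections pp pq)[u [uu up uB _]].
by exists u; split; [exact: uB|exact: uu|rewrite up -mulrA uu.2 mulr1].
Qed.
End Tools.

(** * Shifts, fibrewise matrices and rank one operators *)

Section Operators.
Variable R : realType.
Local Notation C := R[i].
Local Notation H := (hilb R).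
Local Notation A := (fam R).
Implicit Types (x y v w : H) (a d : A) (t : R).

Lemma hdot_Zbe c i x : hdot x (c *: be R i) = complex.Re (c^* * x i).
Proof. by rewrite hdotZr hdot_be hvZE. Qed.
Lemma coord0 x i : (forall c, hdot x (c *: be R i) = 0) -> x i = 0.
Proof.
move=> h; apply: csq_eq0; have := h (x i); rewrite hdot_Zbe csqJM.
by move=> <-.
Qed.
(** A coordinate of the image of x is an inner product of x with an adjoint vector, and the
    coordinates of that vector are read off from the basis. *)
Lemma op_ext a b : (forall t i, op a t (be R i) = op b t (be R i)) -> a = b.
Proof.
move=> h; apply/eqP; rewrite -subr_eq0; apply/eqP.
have {}h t i : op (a - b) t (be R i) = 0 by rewrite op_add op_opp h subrr.
apply: fam_eq => t x; rewrite op_zero; apply: hvP2 => j; rewrite hv0E.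
apply: coord0 => c; rewrite op_ad adZ.
suff -> : ad (a - b) t (be R j) = 0 by rewrite scaler0 hdot0r.
apply: hvP2 => i; rewrite hv0E; apply: coord0 => d.
by rewrite hdotC -op_ad opZ h scaler0 hdot0l.
Qed.

Lemma ps_win x N k : ps x x (N + k) = ps x x N +
  \sum_(n < k) (csq (x ((N + n)%N, false)) + csq (x ((N + n)%N, true))).
Proof.
elim: k => [|k IH]; first by rewrite addn0 big_ord0 addr0.
by rewrite addnS psS IH big_ord_recr/= -addrA.
Qed.

(** * Isometries induced by injections of the basis *)

Section Shift.
Variables (f : idx -> idx) (finj : injective f).

Lemma pull_subproof x : (fun i => x (f i)) \in @l2 R.
Proof.
apply: (@l2_ps _ _ (hdot x x)) => N; have [s us ->] := ps_seq (fun i => x (f i)) N.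
rewrite -(big_map f xpredT (fun j => csq (x j))); apply: sum_uniq_hdot.
by rewrite map_inj_uniq.
Qed.
Definition finv (j : idx) : option idx :=
  if pselect (exists i, f i = j) is left h then Some (projT1 (cid h)) else None.
Lemma finvK i : finv (f i) = Some i.
Proof.
rewrite /finv; case: pselect => [h|[]]; last by exists i.
by congr Some; apply: finj; case: cid.
Qed.
Lemma finv_some j i : finv j = Some i -> f i = j.
Proof. by rewrite /finv; case: pselect => // h [<-]; case: cid. Qed.
Definition pushf (x : idx -> C) j := if finv j is Some i then x i else 0.
Lemma push_sum (x : H) (s : seq idx) : uniq s -> \sum_(i <- s) csq (pushf x i) <= hdot x x.
Proof.
move=> us; have -> : \sum_(i <- s) csq (pushf x i) = \sum_(j <- pmap finv s) csq (x j).
  elim: s {us} => [|i s IH]; first by rewrite !big_nil.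
  by rewrite big_cons IH /= /pushf; case: (finv i) => [j|]/=; rewrite ?big_cons// csq0 add0r.
apply: sum_uniq_hdot; apply: (@map_uniq _ _ f).
suff -> : map f (pmap finv s) = [seq j <- s | finv j] by exact: filter_uniq.
elim: s {us} => //= j s IH; case E: (finv j) => [i|]/=; rewrite ?IH//.
by rewrite (finv_some E).
Qed.
Lemma push_subproof x : pushf x \in @l2 R.
Proof.
apply: (@l2_ps _ _ (hdot x x)) => N; have [s us ->] := ps_seq (pushf x) N.
exact: push_sum.
Qed.
Definition pullv x : H := Hilb (pull_subproof x).
Definition pushv x : H := Hilb (push_subproof x).
Lemma push_pull x : pullv (pushv x) = x.
Proof. by apply: hvP2 => i /=; rewrite /pushf finvK. Qed.
Lemma hdot_pull x : hdot (pullv x) (pullv x) <= hdot x x.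
Proof.
apply: hdot_le => N; have [s us ->] := ps_seq (pullv x) N.
rewrite -(big_map f xpredT (fun j => csq (x j))); apply: sum_uniq_hdot.
by rewrite map_inj_uniq.
Qed.
Lemma hdot_push1 x : hdot (pushv x) (pushv x) = hdot x x.
Proof.
apply/eqP; rewrite eq_le; apply/andP; split; last by rewrite -{1 2}(push_pull x) hdot_pull.
by apply: hdot_le => N; have [s us ->] := ps_seq (pushv x) N; apply: push_sum.
Qed.
Lemma pushD x y : pushv (x + y) = pushv x + pushv y.
Proof. by apply: hvP2 => i; rewrite hvDE /= /pushf; case: (finv i) => [j|]//; rewrite addr0. Qed.
Lemma pushZ c x : pushv (c *: x) = c *: pushv x.
Proof. by apply: hvP2 => i; rewrite hvZE /= /pushf; case: (finv i) => [j|]//; rewrite mulr0. Qed.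
Lemma hdot_push x y : hdot (pushv x) (pushv y) = hdot x y.
Proof. by rewrite [LHS]hdot_polar [RHS]hdot_polar -pushD !hdot_push1. Qed.
Lemma push_adj x y : hdot (pushv x) y = hdot x (pullv y).
Proof.
rewrite -[y in LHS](subrK (pushv (pullv y))) hdotDr hdot_push -[RHS]add0r; congr (_ + _).
rewrite hdotE (_ : ps _ _ = cst 0) ?lim_cst//; apply/funext => N; rewrite /ps big1// => n _.
have z j : rd (pushv x j) ((y - pushv (pullv y)) j) = 0.
  rewrite hvDE hvNE /= /pushf; case E: (finv j) => [i|]; last by rewrite rdC rd0r.
  by rewrite /= (finv_some E) subrr rd0r.
by rewrite !z addr0.
Qed.
Definition Sop_def : A.
apply: (@Fam _ (fun _ => pushv) (fun _ => pullv)) => [t x y|t c x|t x y|].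
- exact: pushD.
- exact: pushZ.
- exact: push_adj.
- by exists 1; split=> // t x; rewrite mul1r !hnE hdot_push1.
Defined.
Definition Sop := locked_with lock_key Sop_def.
Lemma op_Sopv t x : op Sop t x = pushv x. Proof. by rewrite /Sop locked_withE. Qed.
Lemma ad_Sopv t x : ad Sop t x = pullv x. Proof. by rewrite /Sop locked_withE. Qed.
Lemma Sop_be t i : op Sop t (be R i) = be R (f i).
Proof.
apply: hvP2 => j; rewrite op_Sopv /= /pushf beE; case E: (finv j) => [k|].
  by rewrite beE -(finv_some E) (inj_eq finj).
by case: eqP => // ej; move: E; rewrite ej finvK.
Qed.
Lemma Sop_star_mul : star Sop * Sop = 1.
Proof. by apply: fam_eq => t x; rewrite op_mul op_star op_one ad_Sopv op_Sopv push_pull. Qed.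
Lemma op_starS t x i : op (star Sop) t x i = x (f i).
Proof. by rewrite op_star ad_Sopv. Qed.
Lemma starS_be t i : op (star Sop) t (be R (f i)) = be R i.
Proof. by rewrite -(Sop_be t) -op_mul Sop_star_mul op_one. Qed.
Lemma starS_be0 t j : (forall i, f i <> j) -> op (star Sop) t (be R j) = 0.
Proof.
move=> h; apply: hvP2 => i; rewrite op_starS beE hv0E.
by case: eqP => // /h.
Qed.
Lemma nrm_Sop : nrm Sop <= 1.
Proof. by apply: nrm_le => // t x; rewrite mul1r !hnE op_Sopv hdot_push1. Qed.
End Shift.

(** * Operators acting by 2 x 2 matrices on the fibres C^2 *)

Section Gauge.
Variable m : R -> nat -> bool -> bool -> C.
Definition gvec t (x : idx -> C) (i : idx) := m t i.1 i.2 false * x (i.1, false) + m t i.1 i.2 true * x (i.1, true).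
Lemma csqD2 (z w : C) : csq (z + w) <= 2 * csq z + 2 * csq w.
Proof.
case: z w => [a b] [c d]; rewrite /csq /rd/=.
by have := sqr_ge0 (a - c); have := sqr_ge0 (b - d); rewrite !expr2; lra.
Qed.
Lemma gvec_ps M : 0 <= M -> (forall t n b b', cabs (m t n b b') <= M) ->
  forall t x N, ps (gvec t x) (gvec t x) N <= (2 * M) ^+ 2 * ps x x N.
Proof.
move=> M0 hM t x N; rewrite /ps mulr_sumr; apply: ler_sum => n _.
have c b b' : csq (m t n b b') <= M ^+ 2 by rewrite -sqr_cabs ler_sqr ?nnegrE ?cabs_ge0.
have k b : csq (gvec t x (n : nat, b)) <= 2 * M ^+ 2 * (csq (x (n : nat, false)) + csq (x (n : nat, true))).
  have p1 := ler_wpM2r (csq_ge0 (x (n : nat, false))) (c b false).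
  have p2 := ler_wpM2r (csq_ge0 (x (n : nat, true))) (c b true).
  apply: le_trans (csqD2 _ _) _; rewrite !csqM /=; move: p1 p2.
  by move: (csq (m _ _ _ _)) (csq (m _ _ _ _)) (csq (x _)) (csq (x _)); clear; move=> *; lra.
have := k false; have := k true; rewrite /csq exprMn; lra.
Qed.
End Gauge.

Lemma gop_subproof m t (x : H) : (exists M, 0 <= M /\ forall t n b b', cabs (m t n b b') <= M) ->
  gvec m t x \in @l2 R.
Proof.
move=> [M [M0 hM]]; apply: (@l2_ps _ _ ((2 * M) ^+ 2 * hdot x x)) => N.
by apply: le_trans (gvec_ps M0 hM _ _ _) _; rewrite ler_wpM2l ?sqr_ge0// ps_le_hdot.
Qed.
Definition bdm (m : R -> nat -> bool -> bool -> C) :=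
  exists M, 0 <= M /\ forall t n b b', cabs (m t n b b') <= M.
Definition madj (m : R -> nat -> bool -> bool -> C) t n b b' := (m t n b' b)^*.
Lemma bdm_adj m : bdm m -> bdm (madj m).
Proof. by move=> [M [M0 h]]; exists M; split=> // t n b b'; rewrite /madj cabsJ. Qed.
Definition gopv m (hm : bdm m) t (x : H) : H := Hilb (gop_subproof t x hm).
Lemma gop_adj m (hm : bdm m) t x y : hdot (gopv hm t x) y = hdot x (gopv (bdm_adj hm) t y).
Proof.
rewrite !hdotE; congr (limn _); apply/funext => N; apply: eq_bigr => n _ /=.
rewrite /gvec /madj/=; case: (m t n false false) => [? ?]; case: (m t n false true) => [? ?].
case: (m t n true false) => [? ?]; case: (m t n true true) => [? ?].
case: (x _) => [? ?]; case: (x _) => [? ?]; case: (y _) => [? ?]; case: (y _) => [? ?].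
by rewrite /rd/=; ring.
Qed.
Definition gop_def m (hm : bdm m) : A.
apply: (@Fam _ (gopv hm) (gopv (bdm_adj hm))) => [t x y|t c x|t x y|].
- apply: hvP2 => i; rewrite hvDE -[LHS]/(gvec m t (hv (x + y)) i).
  by rewrite -[hv (gopv _ _ x) i]/(gvec m t x i) -[hv (gopv _ _ y) i]/(gvec m t y i) /gvec !hvDE; ring.
- apply: hvP2 => i; rewrite hvZE -[LHS]/(gvec m t (hv (c *: x)) i).
  by rewrite -[hv (gopv _ _ x) i]/(gvec m t x i) /gvec !hvZE; ring.
- exact: gop_adj.
- have [M [M0 h]] := hm; exists (2 * M); split=> [|t x]; first exact: mulr_ge0.
  apply: hn_le; first by rewrite !mulr_ge0 ?hn_ge0.
  apply: hdot_le => N; apply: le_trans (gvec_ps M0 h _ _ _) _.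
  by rewrite [leRHS]exprMn sqr_hn ler_wpM2l ?sqr_ge0// ps_le_hdot.
Defined.
Definition gop m : bdm m -> A := locked_with lock_key (@gop_def m).
Lemma op_gopv m (hm : bdm m) t x : op (gop hm) t x = gopv hm t x.
Proof. by rewrite /gop locked_withE. Qed.
Lemma ad_gopv m (hm : bdm m) t x : ad (gop hm) t x = gopv (bdm_adj hm) t x.
Proof. by rewrite /gop locked_withE. Qed.
Lemma op_gop m (hm : bdm m) t x i :
  op (gop hm) t x i = m t i.1 i.2 false * x (i.1, false) + m t i.1 i.2 true * x (i.1, true).
Proof. by rewrite op_gopv. Qed.
Lemma nrm_gop m (hm : bdm m) M : 0 <= M -> (forall t n b b', cabs (m t n b b') <= M) ->
  nrm (gop hm) <= 2 * M.
Proof.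
move=> M0 h; apply: nrm_le => [|t x]; first exact: mulr_ge0.
rewrite op_gopv; apply: hn_le; first by rewrite !mulr_ge0 ?hn_ge0.
apply: hdot_le => N; apply: le_trans (gvec_ps M0 h _ _ _) _.
by rewrite [leRHS]exprMn sqr_hn ler_wpM2l ?sqr_ge0// ps_le_hdot.
Qed.
Lemma star_gop m (hm : bdm m) (hm' : bdm (madj m)) : star (gop hm) = gop hm'.
Proof. by apply: fam_eq => t x; apply: hvP2 => i; rewrite op_star ad_gopv op_gopv /= /gvec. Qed.
Lemma gop_eq m m' (hm : bdm m) (hm' : bdm m') :
  (forall t n b b', m t n b b' = m' t n b b') -> gop hm = gop hm'.
Proof. by move=> h; apply: fam_eq => t x; apply: hvP2 => i; rewrite !op_gop !h. Qed.

(* The rank one operator [v |-> v_i zeta]. *)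
Section RankOne.
Variables (zeta : H) (i : idx).
(** The complex inner product, linear in [w], rebuilt from its real part. *)
Definition cdot (w : H) : C := Complex (hdot zeta w) (hdot (Complex 0 1 *: zeta) w).
Definition rk_def : A.
apply: (@Fam _ (fun _ v => v i *: zeta) (fun _ w => cdot w *: be R i)) => [t x y|t c x|t x y|].
- by rewrite hvDE scalerDl.
- by rewrite hvZE scalerA.
- rewrite hdot_Zbe; case: (x i) => p q; have -> : Complex p q = rc p + rc q * Complex 0 1 :> C.
    by apply/eqP; rewrite eq_complex /rc /=; apply/andP; split; apply/eqP; ring.
  by rewrite scalerDl hdotDl -scalerA !hdotZrc /cdot /=; ring.
- exists (hn zeta); split=> [|t x]; first exact: hn_ge0.
  by rewrite hnZ mulrC ler_wpM2l ?hn_ge0// cabs_le_hn.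
Defined.
Definition rk := locked_with lock_key rk_def.
Lemma op_rk t v : op rk t v = v i *: zeta. Proof. by rewrite /rk locked_withE. Qed.
Lemma nrm_rk : nrm rk <= hn zeta.
Proof. by apply: nrm_le => [|t x]; rewrite ?hn_ge0// op_rk hnZ mulrC ler_wpM2l ?hn_ge0// cabs_le_hn. Qed.
End RankOne.

Definition em N (_ : R) (n : nat) (b b' : bool) : C := ((n < N)%N && (b == b'))%:R.
Lemma bdm_em N : bdm (em N).
Proof. by exists 1; split=> // t n b b'; rewrite /em; case: (_ && _); rewrite ?cabs1 ?cabs0. Qed.
(** The projection onto the N-th window; its rank is 2N, as both values of the boolean are kept. *)
Definition eN N : A := gop (bdm_em N).
Lemma eN_E N t x i : op (eN N) t x i = (i.1 < N)%N%:R * x i.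
Proof.
rewrite op_gop /em; case: i => n [] /=; case: (n < N)%N => /=; ring.
Qed.
Lemma eN_sa N : star (eN N) = eN N.
Proof.
rewrite (star_gop _ (bdm_adj (bdm_em N))); apply: gop_eq => t n b b'.
by rewrite /madj /em conjC_nat eq_sym.
Qed.
Lemma eN_mul N M : eN N * eN M = eN (minn N M).
Proof.
apply: fam_eq => t x; apply: hvP2 => i; rewrite op_mul !eN_E mulrA leq_min.
by case: (_ < N)%N; rewrite ?mul0r ?mul1r.
Qed.
Lemma eN_id N : eN N * eN N = eN N. Proof. by rewrite eN_mul minnn. Qed.
Lemma eN_be N t i : op (eN N) t (be R i) = (i.1 < N)%N%:R *: be R i.
Proof. by apply: hvP2 => j; rewrite eN_E hvZE beE; case: eqP => [->|]//; rewrite !mulr0. Qed.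
Lemma nrm_proj (p : A) : projection p -> nrm p <= 1.
Proof.
move=> [h1 h2]; have := nrm_cstar p; rewrite h1 h2 expr2 => h.
have [->|n0] := eqVneq (nrm p) 0; first by [].
have : nrm p * nrm p = nrm p * 1 by rewrite -h mulr1.
by move/(mulfI n0) => ->.
Qed.
Lemma eN_proj N : projection (eN N). Proof. by split; [exact: eN_sa|exact: eN_id]. Qed.
Lemma nrm_eN N : nrm (eN N) <= 1. Proof. exact/nrm_proj/eN_proj. Qed.
Lemma nrm_eNC N : nrm (1 - eN N) <= 1. Proof. exact/nrm_proj/projectionB/eN_proj. Qed.

Lemma eN_lim x e : 0 < e -> exists N0, forall N, (N0 <= N)%N -> forall t, hn (op (1 - eN N) t x) <= e.
Proof.
move=> e0; have e20 : 0 < e ^+ 2 by rewrite exprn_gt0.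
have /cvgrPdist_le/(_ _ e20)[N0 _ hN0] : ps x x @ \oo --> limn (ps x x) := @ps_cvg R x x.
exists N0 => N NN t; apply: hn_le (ltW e0) _; apply: hdot_le => M.
have {}hN0 := hN0 N NN; rewrite -hdotE ger0_norm ?subr_ge0 ?ps_le_hdot// in hN0.
apply: le_trans hN0; set y := op _ _ _.
have yE i : y i = (N <= i.1)%N%:R * x i.
  by rewrite /y op_add op_opp hvDE hvNE eN_E op_one; case: (leqP N i.1) => _ /=; ring.
have [MN|NM] := leqP M N.
  rewrite [leLHS](_ : _ = 0) ?subr_ge0 ?ps_le_hdot// /ps big1// => n _.
  by rewrite !yE /= leqNgt (leq_trans (ltn_ord n) MN) !mul0r rd0r addr0.
rewrite -(subnKC (ltnW NM)) ps_win lerBrDl; set k := (M - N)%N.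
rewrite [X in _ + (X + _)](_ : _ = 0); last first.
  by rewrite /ps big1// => n _; rewrite !yE /= leqNgt ltn_ord !mul0r rd0r addr0.
rewrite add0r; apply: le_trans (ps_le_hdot x (N + k)); rewrite ps_win lerD2l.
by apply: ler_sum => n _; rewrite !yE /= leq_addr !mul1r.
Qed.

(** The value at [s] is again a family, constant in t. Evaluation is thus an idempotent endomorphism
    of one algebra, and constancy of a family reads [ev s a = a] for all s. *)
Definition ev_def (s : R) a : A.
apply: (@Fam _ (fun _ => op a s) (fun _ => ad a s)) => [t x y|t c x|t x y|].
- exact: opD.
- exact: opZ.
- exact: op_ad.
- by have [M [M0 h]] := op_bd a; exists M.
Defined.
Definition ev := locked_with lock_key ev_def.
Lemma op_ev s a t x : op (ev s a) t x = op a s x. Proof. by rewrite /ev locked_withE. Qed.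
Lemma ad_ev s a t x : ad (ev s a) t x = ad a s x. Proof. by rewrite /ev locked_withE. Qed.
Lemma evD s a b : ev s (a + b) = ev s a + ev s b. Proof. by apply: fam_eq => t x; rewrite !(op_ev, op_add, op_mul, op_scale, op_one, op_star, ad_ev). Qed.
Lemma evM s a b : ev s (a * b) = ev s a * ev s b. Proof. by apply: fam_eq => t x; rewrite !(op_ev, op_add, op_mul, op_scale, op_one, op_star, ad_ev). Qed.
Lemma evZ s c a : ev s (c *: a) = c *: ev s a. Proof. by apply: fam_eq => t x; rewrite !(op_ev, op_add, op_mul, op_scale, op_one, op_star, ad_ev). Qed.
Lemma evN s a : ev s (- a) = - ev s a. Proof. by apply: fam_eq => t x; rewrite !(op_ev, op_opp). Qed.
Lemma evB s a b : ev s (a - b) = ev s a - ev s b. Proof. by rewrite evD evN. Qed.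
Lemma evS s a : ev s (star a) = star (ev s a). Proof. by apply: fam_eq => t x; rewrite !(op_ev, op_add, op_mul, op_scale, op_one, op_star, ad_ev). Qed.
Lemma ev1 s : ev s 1 = 1. Proof. by apply: fam_eq => t x; rewrite !(op_ev, op_add, op_mul, op_scale, op_one, op_star, ad_ev). Qed.
Lemma ev_ev s s' a : ev s (ev s' a) = ev s' a. Proof. by apply: fam_eq => t x; rewrite !(op_ev, op_add, op_mul, op_scale, op_one, op_star, ad_ev). Qed.
Lemma nrm_ev s a : nrm (ev s a) <= nrm a.
Proof. by apply: nrm_le; [exact: nrm_ge0|move=> t x; rewrite op_ev op_nrm]. Qed.
Lemma nrm_evP a M : 0 <= M -> (forall s, nrm (ev s a) <= M) -> nrm a <= M.
Proof.
move=> M0 h; apply: nrm_le => // t x; rewrite -(op_ev t a 0).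
by apply: le_trans (op_nrm _ _ _) _; rewrite ler_wpM2r ?hn_ge0.
Qed.
Lemma ev_eN s N : ev s (eN N) = eN N.
Proof. by apply: fam_eq => t x; rewrite op_ev; apply: hvP2 => i; rewrite !eN_E. Qed.
Lemma ev_Sop s f (hf : injective f) : ev s (Sop hf) = Sop hf.
Proof. by apply: fam_eq => t x; rewrite !(op_ev, op_add, op_mul, op_scale, op_one, op_star, ad_ev, op_Sopv, op_rk). Qed.
Lemma ev_rk s z i : ev s (rk z i) = rk z i. Proof. by apply: fam_eq => t x; rewrite !(op_ev, op_add, op_mul, op_scale, op_one, op_star, ad_ev, op_Sopv, op_rk). Qed.
End Operators.

(** * Strongly convergent orthogonal sums *)

Section StrongSums.
Variable R : realType.
Local Notation C := R[i].
Local Notation H := (hilb R).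
Local Notation A := (fam R).
Implicit Types (d p : A) (t s : R).

Lemma hlim_cst (v : H) : hlim (fun=> v) v.
Proof. by move=> e e0; exists 0%N => k _; rewrite subrr hn0 ltW. Qed.
Lemma hlim_op (u : nat -> H) (v : H) (a : A) t : hlim u v -> hlim (fun n => op a t (u n)) (op a t v).
Proof.
move=> h e e0; have p : 0 < nrm a + 1 by rewrite ltr_wpDl ?nrm_ge0.
have [K hK] := h _ (divr_gt0 e0 p); exists K => k /hK; rewrite ler_pdivlMr// => hk.
rewrite -opB; apply: le_trans (op_nrm _ _ _) _; apply: le_trans hk.
by rewrite mulrC ler_wpM2l ?hn_ge0// lerDl.
Qed.
Lemma hlim_shift (u : nat -> H) (v : H) : hlim u v -> hlim (fun n => u n.+1) v.
Proof. by move=> h e /h[K hK]; exists K => k Kk; apply: hK; exact: leqW. Qed.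
Lemma hlim_near (u : nat -> H) (v w : H) (N : nat) : hlim u v -> (forall n, (N <= n)%N -> u n = w) -> v = w.
Proof.
move=> h hw; apply: (hlim_unique h) => e e0; exists N => k /hw ->.
by rewrite subrr hn0 ltW.
Qed.

Definition psum (y : nat -> A) L : A := \sum_(l < L) y l.
Lemma psumS y L : psum y L.+1 = psum y L + y L. Proof. by rewrite /psum big_ord_recr. Qed.
Lemma psum0 y : psum y 0 = 0. Proof. by rewrite /psum big_ord0. Qed.
Lemma psum_star y L : star (psum y L) = psum (fun l => star (y l)) L.
Proof.
by elim: L => [|L IH]; rewrite ?psum0 ?psumS ?starD ?IH// -(scale0r (1 : A)) star_scale rmorph0 !scale0r.
Qed.

Definition is_ssum (y : nat -> A) (Y : A) :=
  (forall t v, hlim (fun L => op (psum y L) t v) (op Y t v)) /\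
  (forall t v, hlim (fun L => ad (psum y L) t v) (ad Y t v)).

Lemma ssum_star y Y : is_ssum y Y -> is_ssum (fun l => star (y l)) (star Y).
Proof.
move=> [h1 h2]; split=> t v; under eq_fun do rewrite -psum_star ?op_star ?ad_star.
  by rewrite op_star; exact: h2.
by rewrite ad_star; exact: h1.
Qed.
Lemma ssum_mulr y Y d l : is_ssum y Y -> (forall k, (k != l)%N -> y k * d = 0) -> Y * d = y l * d.
Proof.
move=> [h _] hd; apply: fam_eq => t v; rewrite !op_mul.
apply: (hlim_near (N := l.+1) (h t (op d t v))).
elim=> // n IH; rewrite ltnS leq_eqVlt => /predU1P[<-|ln].
  rewrite psumS op_add; suff -> : op (psum y l) t (op d t v) = 0 by rewrite add0r.
  suff k m : (m <= l)%N -> op (psum y m) t (op d t v) = 0 by exact: k.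
  elim: m => [|m IHm] ml; first by rewrite psum0 op_zero.
  rewrite psumS op_add IHm ?(ltnW ml)// add0r -op_mul hd ?op_zero//.
  by rewrite neq_ltn ml.
have nl : (n != l)%N by rewrite gtn_eqF.
by rewrite psumS op_add (IH ln) -(op_mul (y n)) (hd _ nl) op_zero addr0.
Qed.
Lemma ssum_comm y Y d : is_ssum y Y -> (forall k, y k * d = d * y k) -> Y * d = d * Y.
Proof.
move=> [h _] hd; apply: fam_eq => t v; rewrite !op_mul.
apply: (hlim_unique (h t (op d t v))).
suff E L : op (psum y L) t (op d t v) = op d t (op (psum y L) t v).
  by under eq_fun do rewrite E; exact: hlim_op.
elim: L => [|L IH]; first by rewrite psum0 !op_zero op0.
by rewrite psumS !op_add IH opD -!op_mul hd.
Qed.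
Lemma ssum_ev y Y : is_ssum y Y -> (forall s k, ev s (y k) = y k) -> forall s, ev s Y = Y.
Proof.
move=> [h _] hd s; apply: fam_eq => t v; rewrite op_ev; apply: (hlim_unique (h s v)).
suff E L : op (psum y L) s v = op (psum y L) t v by under eq_fun do rewrite E; exact: h.
elim: L => [|L IH]; first by rewrite psum0 !op_zero.
by rewrite psumS !op_add IH -[in LHS](hd s L) -[in LHS](hd t) op_ev -[op (ev t (y L)) s v]/(op (ev t (y L)) s v) op_ev.
Qed.

Lemma orth_pyth (z : nat -> H) a b : (forall l m, l != m -> hdot (z l) (z m) = 0) ->
  hdot (\sum_(l < b) z (a + l)%N) (\sum_(l < b) z (a + l)%N) = \sum_(l < b) hdot (z (a + l)%N) (z (a + l)%N).
Proof.
move=> h; elim: b => [|b IH]; first by rewrite !big_ord0 hdot0l.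
rewrite !big_ord_recr/= hdotDl !hdotDr IH.
suff E : hdot (\sum_(l < b) z (a + l)%N) (z (a + b)%N) = 0.
  by rewrite (hdotC (z _)) E addr0 add0r.
suff E c : (c <= b)%N -> hdot (\sum_(l < c) z (a + l)%N) (z (a + b)%N) = 0 by exact: E.
elim: c => [|c IHc] cb; first by rewrite big_ord0 hdot0l.
by rewrite big_ord_recr/= hdotDl IHc ?(ltnW cb)// h ?addr0// eqn_add2l neq_ltn cb.
Qed.

(** Bessel's inequality for the ranges of the [P l] bounds the partial sums by [M] and makes them
    Cauchy on every vector. The argument applies verbatim to the adjoints. *)
Lemma strong_sum (P y : nat -> A) (M : R) : 0 <= M ->
  (forall l, projection (P l)) -> (forall l m, l != m -> P l * P m = 0) ->
  (forall l, P l * y l = y l) -> (forall l, y l * P l = y l) -> (forall l, nrm (y l) <= M) ->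
  exists Y, nrm Y <= M /\ is_ssum y Y.
Proof.
move=> M0 hP hPP.
have op_psum (z : nat -> A) t v a b : op (psum z (a + b)) t v - op (psum z a) t v =
    \sum_(l < b) op (z (a + l)%N) t v.
  elim: b => [|b IH]; first by rewrite addn0 subrr big_ord0.
  by rewrite addnS psumS op_add big_ord_recr/= -IH addrAC.
have Porth t v l m : l != m -> hdot (op (P l) t v) (op (P m) t v) = 0.
  move=> lm; rewrite op_ad -op_star -op_mul (hP l).1 hPP//.
  by rewrite op_zero hdot0r.
pose q t v l := hdot (op (P l) t v) (op (P l) t v).
have q0 t v l : 0 <= q t v l := hdot_ge0 _.
pose Q t v L := \sum_(l < L) q t v l.
have Qle t v L : Q t v L <= hdot v v.
  pose s := \sum_(l < L) op (P (0 + l)%N) t v.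
  have e1 : Q t v L = hdot s s by rewrite /s (@orth_pyth (fun l => op (P l) t v) 0 L (Porth t v)).
  have e2 : hdot s s = hdot s v.
    rewrite -e1 /Q /s /q; elim: (L) => [|k IH]; first by rewrite !big_ord0 hdot0l.
    rewrite !big_ord_recr/= hdotDl IH; congr (_ + _).
    by rewrite add0n op_ad -op_star -op_mul (hP k).1 (hP k).2 hdotC.
  rewrite e1; have hs := hdot_CS s v; rewrite -e2 ger0_norm ?hdot_ge0// in hs.
  have [s0|sn] := eqVneq (hn s) 0; first by rewrite -sqr_hn s0 expr0n hdot_ge0.
  rewrite -!sqr_hn ler_sqr ?nnegrE ?hn_ge0//; rewrite -sqr_hn expr2 in hs.
  by rewrite ler_pM2l in hs => //; rewrite lt_neqAle eq_sym sn hn_ge0.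
have Qc t v e : 0 < e -> exists K, forall a b, (K <= a)%N -> Q t v (a + b)%N - Q t v a <= e.
  move=> e0; have nd : nondecreasing_seq (Q t v).
    by apply/nondecreasing_seqP => n; rewrite /Q big_ord_recr/= lerDl q0.
  have cv : cvgn (Q t v).
    by apply: nondecreasing_is_cvgn => //; exists (hdot v v) => _ [n _ <-].
  have /cvgrPdist_le/(_ _ e0)[K _ hK] : Q t v @ \oo --> limn (Q t v) := cv.
  exists K => a b Ka; have := hK a Ka; rewrite ger0_norm; last first.
    by rewrite subr_ge0; apply: nondecreasing_cvgn_le.
  apply: le_trans; rewrite lerD2r; exact: nondecreasing_cvgn_le.
have main (z : nat -> A) : (forall l, P l * z l = z l) -> (forall l, z l * P l = z l) ->
    (forall l, nrm (z l) <= M) -> forall t v,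
    hcauchy (fun L => op (psum z L) t v) /\ forall L, hn (op (psum z L) t v) <= M * hn v.
  move=> Pz zP nz t v.
  have zo l m : l != m -> hdot (op (z l) t v) (op (z m) t v) = 0.
    move=> lm; rewrite -(Pz l) -(Pz m) !op_mul op_ad -op_star -op_mul (hP l).1 hPP//.
    by rewrite op_zero hdot0r.
  have zq l : hdot (op (z l) t v) (op (z l) t v) <= M ^+ 2 * q t v l.
    rewrite -(zP l) op_mul /q -!sqr_hn -exprMn ler_sqr ?nnegrE ?mulr_ge0 ?hn_ge0//.
    by apply: le_trans (op_nrm _ _ _) _; rewrite ler_wpM2r ?hn_ge0.
  have diff a b : hdot (\sum_(l < b) op (z (a + l)%N) t v) (\sum_(l < b) op (z (a + l)%N) t v) <=
      M ^+ 2 * (Q t v (a + b)%N - Q t v a).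
    rewrite (orth_pyth a b zo).
    have -> : Q t v (a + b)%N - Q t v a = \sum_(l < b) q t v (a + l)%N.
      elim: b => [|b IH]; first by rewrite addn0 subrr big_ord0.
      by rewrite addnS /Q !big_ord_recr/= -/(Q t v (a + b)%N) -IH addrAC.
    by rewrite mulr_sumr; apply: ler_sum => l _.
  split=> [e e0|L].
    have p : 0 < M ^+ 2 + 1 by rewrite ltr_wpDl ?sqr_ge0.
    have [K hK] := Qc t v _ (divr_gt0 (exprn_gt0 2 e0) p).
    have ab a b : (K <= a)%N -> hn (op (psum z (a + b)) t v - op (psum z a) t v) <= e.
      move=> Ka; rewrite op_psum; apply: hn_le (ltW e0) _; apply: le_trans (diff a b) _.
      have := hK a b Ka; rewrite ler_pdivlMr// => h; apply: le_trans h.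
      rewrite mulrC ler_wpM2l ?lerDl// subr_ge0 /Q.
      by elim: b => [|b IH]; rewrite ?addn0// addnS big_ord_recr/=; apply: le_trans IH _; rewrite lerDl q0.
    exists K => k l Kk Kl; case/orP: (leq_total k l) => kl.
      by rewrite hnC -(subnKC kl) ab.
    by rewrite -(subnKC kl) ab.
  apply: hn_le; first by rewrite mulr_ge0 ?hn_ge0.
  have := diff 0%N L; rewrite -(op_psum z t v 0%N L) psum0 op_zero subr0 add0n => h.
  apply: le_trans h _; rewrite exprMn sqr_hn ler_wpM2l ?sqr_ge0//.
  by rewrite /Q big_ord0 subr0 Qle.
move=> Py yP ny.
have [Psy syP] : (forall l, P l * star (y l) = star (y l)) /\ (forall l, star (y l) * P l = star (y l)).
  by split=> l; rewrite -{1}(hP l).1 -starM ?yP ?Py.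
have nsy l : nrm (star (y l)) <= M by rewrite nrm_star.
have [|||Y [nY h1 h2]] := @strong_limit R (psum y) M M0.
- move=> L; apply: nrm_le => // t v; exact: (main y Py yP ny t v).2.
- by move=> t v; exact: (main y Py yP ny t v).1.
- move=> t v; under eq_fun do rewrite -op_star psum_star.
  exact: (main _ Psy syP nsy t v).1.
by exists Y; split.
Qed.

(* Schroeder-Bernstein: with [D = \sum_n S^n (1 - P) S*^n], the operator that is [S] on the
   range of [D] and the identity on its complement maps onto the range of [P]. *)
Lemma absorbing_projection (P S : A) : projection P -> star S * S = 1 -> P * S = S ->
  (forall s, ev s P = P) -> (forall s, ev s S = S) ->
  exists W, [/\ star W * W = 1, W * star W = P, forall s, ev s W = W
    & forall d, P * d = d * P -> S * d = d * S -> star S * d = d * star S -> W * d = d * W].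
Proof.
move=> hP SS PS cP cS; pose Q := 1 - P.
have hQ : projection Q := projectionB hP.
have QS : Q * S = 0 by rewrite /Q mulrBl mul1r PS subrr.
have SQ : star S * Q = 0.
  by rewrite -[Q]starK -starM hQ.1 QS -(scale0r (1 : A)) star_scale rmorph0 !scale0r.
pose T n := S ^+ n; pose P_ n := T n * Q * star (T n).
have TS n : star (T n) * T n = 1.
  elim: n => [|n IH]; first by rewrite /T expr0 star_one mulr1.
  rewrite /T exprS starM.
  have -> : star (S ^+ n) * star S * (S * S ^+ n) = star (S ^+ n) * (star S * S) * S ^+ n by nring.
  by rewrite SS mulr1.
have hP_ n : projection (P_ n).
  split; first by rewrite /P_ !starM starK hQ.1; nring.
  have -> : P_ n * P_ n = T n * Q * (star (T n) * T n) * Q * star (T n) by rewrite /P_; nring.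
  by rewrite TS mulr1 -(mulrA _ Q Q) hQ.2.
have lt0 l k : P_ l * P_ (l + k.+1)%N = 0.
  rewrite /P_ /T exprD exprS.
  have -> : forall X Y : A, X ^+ l * Q * star (X ^+ l) * (X ^+ l * (X * X ^+ k) * Q * Y) =
     X ^+ l * Q * (star (X ^+ l) * X ^+ l) * X * X ^+ k * Q * Y by move=> X Y; nring.
  by rewrite TS mulr1 -(mulrA _ Q S) QS mulr0 !mul0r.
have s00 : star (0 : A) = 0 by rewrite -(scale0r (1 : A)) star_scale rmorph0 !scale0r.
have PP_ l m : l != m -> P_ l * P_ m = 0.
  rewrite neq_ltn => /orP[lm|ml].
    by rewrite -(subnKC lm) addSnnS lt0.
  by rewrite -[LHS]starK starM (hP_ l).1 (hP_ m).1 -(subnKC ml) addSnnS lt0 s00.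
have [D [_ sD]] : exists Y, nrm Y <= 1 /\ is_ssum P_ Y.
  apply: (strong_sum (P := P_)) => // l; try exact: (hP_ l).2.
  exact: nrm_proj (hP_ l).
have DP l : D * P_ l = P_ l.
  by rewrite (ssum_mulr (l := l) sD) ?(hP_ l).2// => k kl; apply: PP_.
have sDD : star D = D.
  have h := ssum_star sD; apply: fam_eq => t v; apply: (hlim_unique (h.1 t v)).
  have E : (fun l => star (P_ l)) = P_ by apply/funext => l; exact: (hP_ l).1.
  by rewrite E; exact: sD.1.
have DD : D * D = D.
  apply: fam_eq => t v; rewrite op_mul.
  apply: (hlim_unique (hlim_op D t (sD.1 t v))).
  suff E L : op D t (op (psum P_ L) t v) = op (psum P_ L) t v by under eq_fun do rewrite E; exact: sD.1.
  by elim: L => [|L IH]; rewrite ?psum0 ?op_zero ?op0// psumS !op_add opD IH -op_mul DP.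
(* This recursion makes [S] commute with [D], so W is an isometry. It also gives S D S^-1 = D - Q,
   with the adjoint of S as inverse on its range, and W times its adjoint becomes (D - Q) + (1 - D)
   = P. *)
have Drec : D = Q + S * D * star S.
  apply: fam_eq => t v; rewrite op_add !op_mul.
  apply: (hlim_unique (hlim_shift (sD.1 t v))).
  suff E L : op (psum P_ L.+1) t v = op Q t v + op S t (op (psum P_ L) t (op (star S) t v)).
    under eq_fun do rewrite E; apply: hlimD; first exact: hlim_cst.
    exact/hlim_op/sD.1.
  elim: L => [|L IH].
    by rewrite psumS !psum0 add0r !op_zero op0 addr0 /P_ /T expr0 star_one mul1r mulr1.
  rewrite psumS op_add IH (psumS _ L) [op (psum P_ L + _) _ _]op_add opD addrA; congr (_ + _).
  by rewrite -!op_mul /P_ /T exprS starM; congr (op _ t v); nring.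
have DS : D * S = S * D.
  rewrite {1}Drec mulrDl QS add0r.
  have -> : S * D * star S * S = S * D * (star S * S) by nring.
  by rewrite SS mulr1.
have SSD : S * D * star S = D - Q by rewrite {2}Drec; nring.
have SD : star S * D = D * star S by rewrite -[D in LHS]sDD -starM DS starM sDD.
pose W := S * D + 1 - D.
have sW : star W = D * star S + 1 - D by rewrite /W star_sub starD starM star_one sDD.
exists W; split.
- rewrite sW /W.
  have -> : (D * star S + 1 - D) * (S * D + 1 - D) =
    D * (star S * S) * D + D * star S - D * (star S * D) + S * D - D * S * D + 1 - D - D + D * D by nring.
  rewrite SS SD DS mulr1 !mulrA DD -(mulrA S D D) DD; nring.
- rewrite sW /W.
  have -> : (S * D + 1 - D) * (D * star S + 1 - D) =
    S * (D * D) * star S + S * D - S * (D * D) + D * star S + 1 - D - (D * D) * star S - D + D * D by nring.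
  rewrite !DD SSD /Q; nring.
- move=> s; have cD : ev s D = D.
    apply: (ssum_ev sD) => u k.
    have cT : ev u (T k) = T k.
      by rewrite /T; elim: k => [|k IH]; rewrite ?expr0 ?ev1// exprS evM cS IH.
    by rewrite /P_ !evM evS cT /Q evB ev1 cP.
  have E : ev s W = ev s S * ev s D + ev s 1 - ev s D by rewrite -evM -evD -evB.
  rewrite E cS cD (ev1 s); reflexivity.
- move=> d Pd Sd ssd.
  have Qd : Q * d = d * Q by rewrite /Q mulrBl mulrBr mul1r mulr1 Pd.
  have Dd : D * d = d * D.
    apply: (ssum_comm sD) => k.
    have Td : T k * d = d * T k.
      by rewrite /T; elim: k => [|k IH]; rewrite ?expr0 ?mul1r ?mulr1// exprS -mulrA IH mulrA Sd mulrA.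
    have sTd : star (T k) * d = d * star (T k).
      rewrite /T; elim: k {Td} => [|k IH]; first by rewrite expr0 star_one mul1r mulr1.
      by rewrite exprSr starM -mulrA IH mulrA ssd mulrA.
    have -> : P_ k * d = T k * (Q * (star (T k) * d)) by rewrite /P_; nring.
    have -> : d * P_ k = d * T k * Q * star (T k) by rewrite /P_; nring.
    rewrite sTd -Td; have -> : T k * d * Q * star (T k) = T k * (d * Q) * star (T k) by nring.
    rewrite -Qd; nring.
  by rewrite /W mulrBl mulrDl mul1r -mulrA Dd mulrA Sd mulrBr mulrDr mulr1 mulrA.
Qed.
End StrongSums.

(** * The path algebra *)

Section PathAlgebra.
Variable R : realType.
Local Notation C := R[i].
Local Notation H := (hilb R).
Local Notation A := (fam R).
Implicit Types (a d k x y : A) (t s : R).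

Lemma star0A : star (0 : A) = 0.
Proof. by rewrite -(scale0r (1 : A)) star_scale rmorph0 !scale0r. Qed.

Lemma csubI (B B' : set A) : csub B -> csub B' -> csub (B `&` B').
Proof.
move=> sB sB'; split.
- by split; [exact: cs1 sB|exact: cs1 sB'].
- by move=> a d [? ?] [? ?]; split; [exact: (csD sB)|exact: (csD sB')].
- by move=> c a [? ?]; split; [exact: (csZ sB)|exact: (csZ sB')].
- by move=> a d [? ?] [? ?]; split; [exact: (csM sB)|exact: (csM sB')].
- by move=> a [? ?]; split; [exact: (csS sB)|exact: (csS sB')].
- by move=> x h; split; [apply: (csC sB)|apply: (csC sB')] => e /h[y [? ?] ?]; exists y.
Qed.

Lemma csub_comm d : star d = d -> csub [set a | a * d = d * a].
Proof.
move=> sd; have sB := clsub_comm d; split=> /=.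
- by rewrite mul1r mulr1.
- exact: (clD sB).
- by move=> c a h; rewrite -scalerAl h scalerAr.
- exact: (clM sB).
- by move=> a h; rewrite -{1}sd -starM -h starM sd.
- exact: (clC sB).
Qed.

Lemma csub_ev (B : set A) s : csub B -> csub [set a | B (ev s a)].
Proof.
move=> sB; split=> /=.
- by rewrite ev1; exact: cs1 sB.
- by move=> a d ? ?; rewrite evD; exact: (csD sB).
- by move=> c a ?; rewrite evZ; exact: (csZ sB).
- by move=> a d ? ?; rewrite evM; exact: (csM sB).
- by move=> a ?; rewrite evS; exact: (csS sB).
- move=> x h; apply: (csC sB) => e /h[y By xy]; exists (ev s y) => //.
  by rewrite -evB; apply: le_trans (nrm_ev _ _) xy.
Qed.

Definition swap (i : idx) : idx := (i.1, ~~ i.2).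
Lemma swapK : involutive swap. Proof. by case=> n b; rewrite /swap negbK. Qed.
Lemma swap_inj : injective swap. Proof. exact: inv_inj swapK. Qed.
Definition Xop : A := Sop R swap_inj.
(** Together with the swap [Xop] this sign generates all 2 x 2 matrices on the factor C^2, so that
    commuting with both means having the form y (x) 1_2. *)
Definition sgm (_ : R) (_ : nat) (b b' : bool) : C := if b == b' then (if b then -1 else 1) else 0.
Lemma bdm_sgm : bdm sgm.
Proof.
exists 1; split=> // t n b b'; rewrite /sgm; case: (_ == _); last by rewrite cabs0.
by case: b; rewrite ?cabsN cabs1.
Qed.
Definition Zop : A := gop bdm_sgm.
Lemma Xop_star : star Xop = Xop.
Proof.
apply: op_ext => t i; rewrite Sop_be -{1}(swapK i) /Xop starS_be; congr be.
Qed.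
Lemma Zop_star : star Zop = Zop.
Proof.
rewrite /Zop (star_gop _ (bdm_adj bdm_sgm)); apply: gop_eq => t n b b'.
by rewrite /madj /sgm; case: b; case: b'; rewrite /= ?conjC0 ?rmorphN1 ?conjC1.
Qed.
Lemma Xop_E t (x : H) i : op Xop t x i = x (swap i).
Proof. by rewrite -Xop_star op_starS. Qed.
Lemma Zop_E t (x : H) i : op Zop t x i = (if i.2 then -1 else 1) * x i.
Proof.
by rewrite op_gop /sgm; case: i => n [] /=; rewrite mul0r ?addr0 ?add0r.
Qed.

(* The operators of the form [y (x) 1_2] on [l2(nat) (x) C^2]. *)
Definition dbl : set A := [set a | a * Xop = Xop * a] `&` [set a | a * Zop = Zop * a].
Lemma csub_dbl : csub dbl.
Proof. apply: csubI; [exact: csub_comm Xop_star|exact: csub_comm Zop_star]. Qed.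

Lemma dbl_Sop (g : nat -> nat) (hf : injective (fun i : idx => (g i.1, i.2))) : dbl (Sop R hf).
Proof.
split=> /=.
  by apply: op_ext => t i; rewrite !op_mul !Sop_be.
apply: op_ext => t i; rewrite !op_mul Sop_be.
have Zbe j : op Zop t (be R j) = (if j.2 then -1 else 1) *: be R j.
  by apply: hvP2 => k; rewrite Zop_E hvZE beE; case: eqP => [->|]//; rewrite !mulr0.
by rewrite !Zbe opZ Sop_be.
Qed.

Definition ucont : set A := [set a | forall e, 0 < e -> exists2 r, 0 < r &
  forall s t, `|s - t| <= r -> nrm (ev s a - ev t a) <= e].

Lemma csub_ucont : csub ucont.
Proof.
split=> /=.
- by move=> e e0; exists 1 => // s t _; rewrite !ev1 subrr nrm0 ltW.
- move=> a d ha hd e e0; have e2 : 0 < e / 2 by rewrite divr_gt0.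
  have [r r0 hr] := ha _ e2; have [r' r'0 hr'] := hd _ e2.
  exists (Num.min r r') => [|s t]; first by rewrite lt_min r0.
  rewrite le_min => /andP[/hr h1 /hr' h2]; rewrite !evD opprD addrACA.
  by apply: le_trans (nrmD _ _) _; rewrite (splitr e) lerD.
- move=> c a ha e e0; have p : 0 < cabs c + 1 by rewrite ltr_wpDl ?cabs_ge0.
  have [r r0 hr] := ha _ (divr_gt0 e0 p); exists r => // s t /hr h.
  rewrite !evZ -scalerBr nrmZ; rewrite ler_pdivlMr// in h; apply: le_trans h.
  by rewrite mulrC ler_wpM2l ?nrm_ge0// lerDl.
- move=> a d ha hd e e0.
  have p : 0 < nrm a + nrm d + 1 by rewrite ltr_wpDl ?addr_ge0 ?nrm_ge0.
  have [r r0 hr] := ha _ (divr_gt0 e0 p); have [r' r'0 hr'] := hd _ (divr_gt0 e0 p).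
  exists (Num.min r r') => [|s t]; first by rewrite lt_min r0.
  rewrite le_min => /andP[/hr h1 /hr' h2]; rewrite !evM.
  have -> : ev s a * ev s d - ev t a * ev t d = ev s a * (ev s d - ev t d) + (ev s a - ev t a) * ev t d.
    nring.
  apply: le_trans (nrmD _ _) _.
  apply: le_trans (lerD (nrmM _ _) (nrmM _ _)) _.
  have L (q na nd u v w z : R) : u <= q -> v <= q -> w <= na -> z <= nd -> 0 <= w -> 0 <= z ->
     0 <= u -> 0 <= v -> w * u + v * z <= (na + nd + 1) * q.
    clear=> *; have := @ler_pM R w na u q; have := @ler_pM R v q z nd; nra.
  have -> : e = (nrm a + nrm d + 1) * (e / (nrm a + nrm d + 1)) by rewrite mulrCA mulfV ?mulr1 ?gt_eqF.
  by apply: L => //; rewrite ?nrm_ev ?nrm_ge0.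
- by move=> a ha e /ha[r r0 hr]; exists r => // s t /hr; rewrite !evS -star_sub nrm_star.
- move=> x h e e0; have e3 : 0 < e / 3 by rewrite divr_gt0.
  have [y hy xy] := h _ e3; have [r r0 hr] := hy _ e3; exists r => // s t /hr st.
  have -> : ev s x - ev t x = ev s (x - y) + (ev s y - ev t y) - ev t (x - y).
    by rewrite !evB; nring.
  apply: le_trans (nrmB _ _) _; apply: le_trans (lerD (nrmD _ _) (lexx _)) _.
  have := nrm_ev s (x - y); have := nrm_ev t (x - y).
  have L (a b c d : R) : c <= e / 3 -> d <= e / 3 -> a <= d -> b <= d -> b + c + a <= e by clear; lra.
  exact: L.
Qed.

Definition clamp (t : R) : R := Num.min 1 (Num.max 0 t).
Lemma clamp_ge0 t : 0 <= clamp t. Proof. by rewrite /clamp le_min ler01 le_max lexx. Qed.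
Lemma clamp_le1 t : clamp t <= 1. Proof. by rewrite /clamp ge_min lexx. Qed.
Lemma clamp_id t : 0 <= t -> t <= 1 -> clamp t = t.
Proof. by move=> t0 t1; rewrite /clamp (max_idPr t0) (min_idPr t1). Qed.
Lemma clampK t : clamp (clamp t) = clamp t.
Proof. by rewrite clamp_id ?clamp_ge0 ?clamp_le1. Qed.
Lemma clamp0 : clamp 0 = 0. Proof. by rewrite clamp_id. Qed.
Lemma clamp1 : clamp 1 = 1. Proof. by rewrite clamp_id. Qed.
Lemma clamp_lip s t : `|clamp s - clamp t| <= `|s - t|.
Proof.
have cl w : [\/ w <= 0 /\ clamp w = 0, 0 <= w <= 1 /\ clamp w = w | 1 <= w /\ clamp w = 1].
  case: (leP w 0) => w0; first by constructor 1; rewrite /clamp (max_idPl w0) (min_idPr ler01).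
  case: (leP w 1) => w1; first by constructor 2; rewrite clamp_id// ltW.
  by constructor 3; rewrite /clamp (max_idPr (ltW w0)) (min_idPl (ltW w1)) ltW.
have L u v : u <= v -> 0 <= clamp v - clamp u /\ clamp v - clamp u <= v - u.
  by move=> uv; case: (cl u) => -[h1 ->]; case: (cl v) => -[h2 ->]; split; lra.
case: (leP s t) => [|/ltW] /L[h0 h1].
  rewrite distrC [`|s - t|]distrC (ger0_norm h0); apply: le_trans h1 (ler_norm _).
by rewrite (ger0_norm h0); apply: le_trans h1 (ler_norm _).
Qed.

Definition clamped : set A := [set a | forall t, ev t a = ev (clamp t) a].
Lemma csub_clamped : csub clamped.
Proof.
split=> /=.
- by move=> t; rewrite !ev1.
- by move=> a d ha hd t; rewrite !evD ha hd.
- by move=> c a ha t; rewrite !evZ ha.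
- by move=> a d ha hd t; rewrite !evM ha hd.
- by move=> a ha t; rewrite !evS ha.
- move=> x h t; apply/eqP; rewrite -subr_eq0; apply/eqP.
  apply: (@nrm_small0 _ 2) => e /h[y hy xy].
  have -> : ev t x - ev (clamp t) x = ev t (x - y) - ev (clamp t) (x - y).
    by rewrite !evB (hy t); nring.
  apply: le_trans (nrmB _ _) _; rewrite mulr_natl mulr2n.
  by apply: lerD; apply: le_trans (nrm_ev _ _) xy.
Qed.

Definition supp N a := eN R N * a * eN R N = a.
Lemma supp_mono N M a : (N <= M)%N -> supp N a -> supp M a.
Proof.
move=> NM h; rewrite /supp -h.
have -> : eN R M * (eN R N * a * eN R N) * eN R M = (eN R M * eN R N) * a * (eN R N * eN R M) by nring.
by rewrite !eN_mul (minn_idPr NM) (minn_idPl NM).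
Qed.
Lemma suppD N a d : supp N a -> supp N d -> supp N (a + d).
Proof. by move=> h1 h2; rewrite /supp mulrDr mulrDl h1 h2. Qed.
Lemma suppZ N c a : supp N a -> supp N (c *: a).
Proof. by move=> h1; rewrite /supp -scalerAr -scalerAl h1. Qed.
Lemma suppl N a : supp N a -> eN R N * a = a.
Proof. by move=> <-; rewrite !mulrA eN_id. Qed.
Lemma suppr N a : supp N a -> a * eN R N = a.
Proof. by move=> <-; rewrite -!mulrA eN_id. Qed.
Lemma suppM N a d : supp N a -> supp N d -> supp N (a * d).
Proof. by move=> h1 h2; rewrite /supp mulrA (suppl h1) -mulrA (suppr h2). Qed.
Lemma suppS N a : supp N a -> supp N (star a).
Proof. by move=> h; rewrite /supp -{2}h !starM eN_sa mulrA. Qed.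
Lemma supp_cut N a : supp N (eN R N * a * eN R N).
Proof.
by rewrite /supp !mulrA eN_id -!mulrA eN_id.
Qed.
Lemma nrm_cut N a : nrm (eN R N * a * eN R N) <= nrm a.
Proof.
apply: le_trans (nrmM _ _) _; apply: le_trans (ler_wpM2l (nrm_ge0 _) (nrm_eN _ _)) _.
rewrite mulr1; apply: le_trans (nrmM _ _) _.
by apply: le_trans (ler_wpM2r (nrm_ge0 _) (nrm_eN _ _)) _; rewrite mul1r.
Qed.

(** One window serves all t at once. For norm-continuous paths on [0,1] this amounts to compactness
    of every value, the interval being compact. *)
Definition KK : set A := [set k | forall e, 0 < e -> exists N, nrm (k - eN R N * k * eN R N) <= e].
Lemma KK_intro k : (forall e, 0 < e -> exists N k', supp N k' /\ nrm (k - k') <= e) -> KK k.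
Proof.
move=> h e e0; have [N [k' [sk kk]]] := h _ (divr_gt0 e0 (ltr0n _ 2)); exists N.
have -> : k - eN R N * k * eN R N = (k - k') - eN R N * (k - k') * eN R N.
  by rewrite mulrBr mulrBl sk; nring.
by apply: le_trans (nrmB _ _) _; rewrite (splitr e) lerD//; apply: le_trans (nrm_cut _ _) kk.
Qed.
Lemma KK_elim k : KK k -> forall e, 0 < e -> exists N, forall M, (N <= M)%N -> nrm (k - eN R M * k * eN R M) <= e.
Proof.
move=> hk e e0; have [N hN] := hk _ (divr_gt0 e0 (ltr0n _ 2)); exists N => M NM.
set k' := eN R N * k * eN R N in hN; have sk : supp M k' := supp_mono NM (supp_cut N k).
have -> : k - eN R M * k * eN R M = (k - k') - eN R M * (k - k') * eN R M.
  by rewrite mulrBr mulrBl sk; nring.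
by apply: le_trans (nrmB _ _) _; rewrite (splitr e) lerD//; apply: le_trans (nrm_cut _ _) hN.
Qed.
Lemma KK_supp N k : supp N k -> KK k.
Proof. by move=> h e e0; exists N; rewrite h subrr nrm0 ltW. Qed.
Lemma KK0 : KK 0.
Proof. by apply: (@KK_supp 0%N); rewrite /supp mulr0 mul0r. Qed.
Lemma KKD a d : KK a -> KK d -> KK (a + d).
Proof.
move=> ha hd; apply: KK_intro => e e0.
have [N hN] := KK_elim ha (divr_gt0 e0 (ltr0n _ 2)); have [M hM] := KK_elim hd (divr_gt0 e0 (ltr0n _ 2)).
have h1 := hN _ (leq_maxl N M); have h2 := hM _ (leq_maxr N M); set L := maxn N M in h1 h2.
exists L, (eN R L * a * eN R L + eN R L * d * eN R L); split.
  by apply: suppD; exact: supp_cut.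
by rewrite opprD addrACA; apply: le_trans (nrmD _ _) _; rewrite (splitr e) lerD.
Qed.
Lemma KKZ c a : KK a -> KK (c *: a).
Proof.
move=> ha e e0; have p : 0 < cabs c + 1 by rewrite ltr_wpDl ?cabs_ge0.
have [N h] := ha _ (divr_gt0 e0 p); exists N.
rewrite -scalerAr -scalerAl -scalerBr nrmZ; rewrite ler_pdivlMr// in h; apply: le_trans h.
by rewrite mulrC ler_wpM2l ?nrm_ge0// lerDl.
Qed.
Lemma KKS a : KK a -> KK (star a).
Proof.
move=> ha e /ha[N h]; exists N.
have -> : star a - eN R N * star a * eN R N = star (a - eN R N * a * eN R N).
  by rewrite star_sub !starM eN_sa mulrA.
by rewrite nrm_star.
Qed.
Lemma KKC : nclosed KK.
Proof.
move=> x h; apply: KK_intro => e e0; have e2 := divr_gt0 e0 (ltr0n R 2).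
have [y hy xy] := h _ e2; have [N hN] := hy _ e2.
exists N, (eN R N * y * eN R N); split; first exact: supp_cut.
have -> : x - eN R N * y * eN R N = (x - y) + (y - eN R N * y * eN R N) by nring.
by apply: le_trans (nrmD _ _) _; rewrite (splitr e) lerD.
Qed.
(** Among all bounded families [KK] is not an ideal: [a] has to carry windows nearly into windows,
    uniformly in t. *)
Lemma KK_mull a k : (forall N e, 0 < e -> exists M, (N <= M)%N /\ nrm ((1 - eN R M) * a * eN R N) <= e) ->
  KK k -> KK (a * k).
Proof.
move=> ha hk; apply: KK_intro => e e0; have e2 := divr_gt0 e0 (ltr0n R 2).
have p : 0 < nrm a + 1 by rewrite ltr_wpDl ?nrm_ge0.
have [N hN] := hk _ (divr_gt0 e2 p); set k' := eN R N * k * eN R N in hN.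
have q : 0 < nrm k' + 1 by rewrite ltr_wpDl ?nrm_ge0.
have [M [NM hM]] := ha N _ (divr_gt0 e2 q).
exists M, (eN R M * (a * k') * eN R M); split; first exact: supp_cut.
have sk : supp N k' := supp_cut N k.
have -> : eN R M * (a * k') * eN R M = eN R M * a * k'.
  have -> : eN R M * (a * k') * eN R M = eN R M * a * (k' * eN R M) by nring.
  by rewrite (suppr (supp_mono NM sk)).
have -> : a * k - eN R M * a * k' = a * (k - k') + (1 - eN R M) * a * eN R N * k'.
  have -> : (1 - eN R M) * a * eN R N * k' = (1 - eN R M) * a * (eN R N * k') by nring.
  by rewrite (suppl sk); nring.
apply: le_trans (nrmD _ _) _; rewrite (splitr e) lerD//.
  apply: le_trans (nrmM _ _) _; rewrite ler_pdivlMr// in hN; apply: le_trans hN.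
  by rewrite mulrC ler_wpM2l ?nrm_ge0// lerDl.
apply: le_trans (nrmM _ _) _; rewrite ler_pdivlMr// in hM; apply: le_trans hM.
by rewrite ler_wpM2l ?nrm_ge0// lerDl.
Qed.
Lemma KKM a k : KK a -> KK k -> KK (a * k).
Proof.
move=> ha; apply: KK_mull => N e e0; have [M0 h] := KK_elim ha e0.
exists (maxn N M0); split; first exact: leq_maxl.
have {}h := h _ (leq_maxr N M0); set M := maxn N M0 in h *.
have E : (1 - eN R M) * a * eN R N = (1 - eN R M) * (a - eN R M * a * eN R M) * eN R N.
  have -> : (1 - eN R M) * (a - eN R M * a * eN R M) * eN R N =
     (1 - eN R M) * a * eN R N - (eN R M - eN R M * eN R M) * a * eN R M * eN R N by nring.
  by rewrite eN_id subrr !mul0r subr0.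
rewrite E; apply: le_trans (nrmM _ _) _; apply: le_trans (ler_wpM2l (nrm_ge0 _) (nrm_eN _ _)) _.
rewrite mulr1; apply: le_trans (nrmM _ _) _.
by apply: le_trans (ler_wpM2r (nrm_ge0 _) (nrm_eNC _ _)) _; rewrite mul1r.
Qed.

Lemma eN_rk n : eN R n.+1 = eN R n + (rk (be R (n, false)) (n, false) + rk (be R (n, true)) (n, true)).
Proof.
apply: op_ext => t [m b]; rewrite !op_add !op_rk !eN_be !beE /=.
rewrite !xpair_eqE ltnS leq_eqVlt (eq_sym n m).
case: (eqVneq m n) => [->|mn] /=; last by rewrite !scale0r !addr0.
by rewrite ltnn scale0r add0r scale1r; case: b => /=; rewrite scale1r scale0r ?addr0 ?add0r.
Qed.
(** [c * eN R N] has finite rank, and constancy of [c] makes the estimate independent of t. *)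
Lemma const_small c : (forall s, ev s c = c) -> forall N e, 0 < e ->
  exists M, (N <= M)%N /\ forall L, (M <= L)%N -> nrm ((1 - eN R L) * c * eN R N) <= e.
Proof.
move=> hc.
have one i e : 0 < e -> exists M, forall L, (M <= L)%N -> nrm ((1 - eN R L) * c * rk (be R i) i) <= e.
  move=> e0; have [M hM] := eN_lim (op c 0 (be R i)) e0; exists M => L ML.
  apply: nrm_le (ltW e0) _ => t v; rewrite !op_mul op_rk !opZ hnZ mulrC.
  have -> : op c t (be R i) = op c 0 (be R i) by rewrite -[c in LHS](hc 0) op_ev.
  by apply: ler_pM; rewrite ?hn_ge0 ?cabs_ge0 ?cabs_le_hn ?hM.
elim=> [|N IH] e e0.
  exists 0%N; split=> // L _; have -> : eN R 0 = 0.
    by apply: op_ext => t i; rewrite eN_be scale0r op_zero.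
  by rewrite mulr0 nrm0 ltW.
have e3 : 0 < e / 3 by rewrite divr_gt0.
have [M0 [NM0 h0]] := IH _ e3; have [M1 h1] := one (N, false) _ e3; have [M2 h2] := one (N, true) _ e3.
exists (maxn N.+1 (maxn M0 (maxn M1 M2))); split; first exact: leq_maxl.
move=> L; rewrite !geq_max => /and4P[_ /h0 k0 /h1 k1 /h2 k2].
rewrite eN_rk !mulrDr; apply: le_trans (nrmD _ _) _; apply: le_trans (lerD (lexx _) (nrmD _ _)) _.
by move: k0 k1 k2; move: (nrm _) (nrm _) (nrm _); clear; move=> *; lra.
Qed.
Lemma KK_constl c k : (forall s, ev s c = c) -> KK k -> KK (c * k).
Proof.
move=> hc; apply: KK_mull => N e e0; have [M [NM h]] := const_small hc N e0.
by exists M; split=> //; exact: h.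
Qed.
Lemma KK_constr c k : (forall s, ev s c = c) -> KK k -> KK (k * c).
Proof.
move=> hc hk; rewrite -[k * c]starK starM; apply/KKS/KK_constl; last exact: KKS.
by move=> s; rewrite evS hc.
Qed.

Definition kpath : set A := [set a | KK (a - ev 0 a)].
Lemma csub_kpath : csub kpath.
Proof.
split=> /=.
- by rewrite /kpath /= ev1 subrr; exact: KK0.
- by move=> a d ha hd; rewrite /kpath /= evD opprD addrACA; exact: KKD.
- by move=> c a ha; rewrite /kpath /= evZ -scalerBr; exact: KKZ.
- move=> a d ha hd; rewrite /kpath /= evM.
  have -> : a * d - ev 0 a * ev 0 d =
    (a - ev 0 a) * (d - ev 0 d) + (a - ev 0 a) * ev 0 d + ev 0 a * (d - ev 0 d) by nring.
  have ce b s : ev s (ev 0 b) = ev 0 b by rewrite ev_ev.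
  exact: (KKD (KKD (KKM ha hd) (KK_constr (ce d) ha)) (KK_constl (ce a) hd)).
- by move=> a ha; rewrite /kpath /= evS -star_sub; exact: KKS.
- move=> x h; apply: KKC => e e0; have [y hy xy] := h _ (divr_gt0 e0 (ltr0n _ 2)).
  exists (y - ev 0 y) => //.
  have -> : x - ev 0 x - (y - ev 0 y) = (x - y) - ev 0 (x - y) by rewrite evB; nring.
  by apply: le_trans (nrmB _ _) _; rewrite (splitr e) lerD//; apply: le_trans (nrm_ev _ _) xy.
Qed.

(* The norm-continuous paths of operators on [l2(nat) (x) C^2], constant modulo the
   compact operators, whose end points are of the form [y (x) 1_2]. *)
Definition MM : set A :=
  (ucont `&` clamped) `&` ((kpath `&` [set a | dbl (ev 0 a)]) `&` [set a | dbl (ev 1 a)]).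
Lemma csub_MM : csub MM.
Proof.
apply: csubI; first exact: csubI csub_ucont csub_clamped.
apply: csubI; last exact: csub_ev csub_dbl.
by apply: csubI; [exact: csub_kpath|exact: csub_ev csub_dbl].
Qed.
Lemma MM_const a : (forall s, ev s a = a) -> dbl a -> MM a.
Proof.
move=> ca da; split; split=> /=.
- by move=> e e0; exists 1 => // s t _; rewrite !ca subrr nrm0 ltW.
- by move=> t; rewrite !ca.
- by split; rewrite /kpath /= ca// subrr; exact: KK0.
- by rewrite ca.
Qed.
End PathAlgebra.

(** * The endomorphism *)

Section CountableBijection.
Local Open Scope card_scope.
Lemma countable_bijection (T : countType) (f : nat -> T) : injective f ->
  exists (g : T -> nat) (h : nat -> T), cancel g h /\ cancel h g.
Proof.
move=> fi; have iT : infinite_set [set: T].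
  apply/infiniteP; have /card_eqPle[_ h] : f @` [set: nat] #= [set: nat].
    by apply: inj_card_eq => x y _ _; exact: fi.
  exact: card_le_trans h (subset_card_le (@subsetT _ _)).
have /card_set_bijP[g] := eq_card_nat (@countableP _ [set: T]) iT.
rewrite setTT_bijective => -[h gh hg]; by exists g, h.
Qed.
End CountableBijection.

(* The positions [inl n] carry the given family, the positions [inr (a, r, n, b)] carry
   its value at the [a]-th rational point. *)
Definition posn := (nat + nat * nat * nat * bool)%type.
(* [kcode] identifies the multiplicities [r] of a rational point in [theta x] with those
   in [theta (theta x)], so that the permutation [gam] intertwines the two. *)
Definition mult := (nat + nat + nat * nat * nat * bool)%type.
Fact code_ex : exists p : (posn -> nat) * (nat -> posn), cancel p.1 p.2 /\ cancel p.2 p.1.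
Proof.
have [|g [h gh]] := @countable_bijection posn inl; first by move=> ? ? [].
by exists (g, h).
Qed.
Definition code := (projT1 (cid code_ex)).1.
Definition decode := (projT1 (cid code_ex)).2.
Lemma codeK : cancel code decode. Proof. by case: (projT2 (cid code_ex)). Qed.
Lemma decodeK : cancel decode code. Proof. by case: (projT2 (cid code_ex)). Qed.
Fact kcode_ex : exists p : (mult -> nat) * (nat -> mult), cancel p.1 p.2 /\ cancel p.2 p.1.
Proof.
have [|g [h gh]] := @countable_bijection mult (inl \o inl); first by move=> ? ? [].
by exists (g, h).
Qed.
Definition kcode := (projT1 (cid kcode_ex)).1.
Definition kdecode := (projT1 (cid kcode_ex)).2.
Lemma kcodeK : cancel kcode kdecode. Proof. by case: (projT2 (cid kcode_ex)). Qed.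
Lemma kdecodeK : cancel kdecode kcode. Proof. by case: (projT2 (cid kcode_ex)). Qed.

(** A copy of x(q) in theta(theta x) arises from the inner expansion, from the outer one, or from
    both, which are the three cases of [mult]. In the last case the inner block is constant already,
    so that only the inner rational point counts. *)
Definition gam (m : nat) : nat :=
  match decode m with
  | inl n => code (inl (code (inl n)))
  | inr (a, k, n, b) => match kdecode k with
     | inl (inl r) => code (inl (code (inr (a, r, n, b))))
     | inl (inr r) => code (inr (a, r, code (inl n), b))
     | inr (a', r', r, c) => code (inr (a', r', code (inr (a, r, n, b)), c))
     end
  end.
Definition gami (m : nat) : nat :=
  match decode m with
  | inl n => match decode n with
     | inl n => code (inl n)
     | inr (a, r, n, b) => code (inr (a, kcode (inl (inl r)), n, b))
     end
  | inr (a', r', n, c) => match decode n with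
     | inl n => code (inr (a', kcode (inl (inr r')), n, c))
     | inr (a, r, n, b) => code (inr (a, kcode (inr (a', r', r, c)), n, b))
     end
  end.
Lemma gamK : cancel gam gami.
Proof.
move=> m; rewrite -{2}(decodeK m) /gam; case: (decode m) => [n|[[[a k] n] b]].
  by rewrite /gami !codeK.
rewrite -{2}(kdecodeK k); case: (kdecode k) => [[r|r]|[[[a' r'] r] c]];
  by rewrite /gami !codeK.
Qed.
Lemma gamiK : cancel gami gam.
Proof.
move=> m; rewrite -{2}(decodeK m) /gami; case: (decode m) => [n|[[[a r] n] b]];
rewrite -{2}(decodeK n); case: (decode n) => [n'|[[[a' r'] n'] b']];
  by rewrite /gam !codeK ?kcodeK.
Qed.

Definition lbl := option (nat * nat * bool).
(** At a rational point both components of the old index are coded into the new natural number. The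
    new boolean is then free to carry the factor 1_2, whether or not x(q) itself is doubled. Under
    [None] the old doubling is kept. *)
Definition lmap (o : lbl) (i : idx) : idx :=
  match o with
  | None => (code (inl i.1), i.2)
  | Some (a, r, c) => (code (inr (a, r, i.1, i.2)), c)
  end.
Lemma lmap_inj2 o o' i i' : lmap o i = lmap o' i' -> o = o' /\ i = i'.
Proof.
case: o => [[[a r] c]|]; case: o' => [[[a' r'] c']|]; case: i => n b; case: i' => n' b' /= [].
- by move=> /(can_inj codeK)[-> -> -> ->] ->.
- by move=> /(can_inj codeK).
- by move=> /(can_inj codeK).
- by move=> /(can_inj codeK)[->] ->.
Qed.
Lemma lmap_inj o : injective (lmap o). Proof. by move=> i i' /lmap_inj2[]. Qed.
Lemma lmap_surj i : exists o j, lmap o j = i.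
Proof.
case: i => m c; rewrite -(decodeK m); case: (decode m) => [n|[[[a r] n] b]].
  by exists None, (n, c).
by exists (Some (a, r, c)), (n, b).
Qed.

Section Theta.
Variable R : realType.
Local Notation C := R[i].
Local Notation H := (hilb R).
Local Notation A := (fam R).
Implicit Types (x y : A) (s : R) (o : lbl) (F G : lbl -> A).

Lemma Sop_orth f g (hf : injective f) (hg : injective g) : (forall i j, f i <> g j) ->
  star (Sop R hf) * Sop R hg = 0.
Proof.
by move=> h; apply: op_ext => t i; rewrite op_mul Sop_be starS_be0 ?op_zero.
Qed.

Definition leg o : A := Sop R (@lmap_inj o).
Lemma leg_be o t i : op (leg o) t (be R i) = be R (lmap o i). Proof. exact: Sop_be. Qed.
Lemma ev_leg o s : ev s (leg o) = leg o. Proof. exact: ev_Sop. Qed.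
Lemma leg_iso o : star (leg o) * leg o = 1. Proof. exact: Sop_star_mul. Qed.
Lemma leg_orth o o' : o != o' -> star (leg o) * leg o' = 0.
Proof. by move=> /eqP oo; apply: Sop_orth => i j /lmap_inj2[]. Qed.
Lemma leg_ext x y : (forall o, x * leg o = y * leg o) -> x = y.
Proof.
move=> h; apply: op_ext => t i; have [u [j <-]] := lmap_surj i.
by rewrite -(leg_be u t) -!op_mul h.
Qed.
Lemma leg_extl x y : (forall o, star (leg o) * x = star (leg o) * y) -> x = y.
Proof.
move=> h; rewrite -[x]starK -[y]starK; congr star; apply: leg_ext => o.
by rewrite -[leg o]starK -!starM h.
Qed.
Lemma nrm_leg o : nrm (leg o) <= 1. Proof. exact: nrm_Sop. Qed.

Lemma blk_ex F M : 0 <= M -> (forall o, nrm (F o) <= M) ->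
  exists Y, nrm Y <= M /\ forall o, Y * leg o = leg o * F o.
Proof.
(* Several numbers may decode to the same label; the test keeps the canonical code, so that each
   block enters the sum once. *)
move=> M0 hM; pose y l : A := if (unpickle l : option lbl) is Some o then
   (if pickle o == l then leg o * F o * star (leg o) else 0) else 0.
pose P l : A := if (unpickle l : option lbl) is Some o then
   (if pickle o == l then leg o * star (leg o) else 0) else 0.
have proj0 : projection (0 : A) by split; rewrite ?star0A ?mul0r.
have bigE x z (o : lbl) : leg o * x * star (leg o) * (leg o * z * star (leg o)) =
    leg o * (x * z) * star (leg o).
  have -> : leg o * x * star (leg o) * (leg o * z * star (leg o)) =
    leg o * x * (star (leg o) * leg o) * z * star (leg o) by nring.
  by rewrite leg_iso; nring.
have PE o : leg o * star (leg o) = leg o * 1 * star (leg o) by rewrite mulr1.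
have [|||||Y [nY sY]] := @strong_sum R P y M M0.
- move=> l; rewrite /P; case: unpickle => // o; case: eqP => // _; split.
    by rewrite starM starK.
  by rewrite PE bigE mulr1.
- move=> l m lm; rewrite /P; case: (unpickle l) => [u|]; last by rewrite mul0r.
  case: eqP => [ol|]; last by rewrite mul0r.
  case: (unpickle m) => [v|]; last by rewrite mulr0.
  case: eqP => [om|]; last by rewrite mulr0.
  have -> : leg u * star (leg u) * (leg v * star (leg v)) =
    leg u * (star (leg u) * leg v) * star (leg v) by nring.
  rewrite leg_orth ?mulr0 ?mul0r//; apply: contraNneq lm => oo.
  by rewrite -ol -om oo.
- move=> l; rewrite /P /y; case: unpickle => [u|]; last by rewrite mul0r.
  by case: eqP => _; rewrite ?mul0r// PE bigE mul1r.
- move=> l; rewrite /P /y; case: unpickle => [u|]; last by rewrite mul0r.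
  by case: eqP => _; rewrite ?mul0r// PE bigE mulr1.
- move=> l; rewrite /y; case: unpickle => [u|]; last by rewrite nrm0.
  case: eqP => _; last by rewrite nrm0.
  apply: le_trans (nrmM _ _) _; rewrite nrm_star.
  apply: le_trans (ler_wpM2r (nrm_ge0 _) (nrmM _ _)) _.
  apply: le_trans (hM u); rewrite -[leRHS]mulr1 -[leRHS]mul1r mulrA.
  by apply: ler_pM; rewrite ?mulr_ge0 ?nrm_ge0 ?nrm_leg// ler_pM ?nrm_ge0 ?nrm_leg.
exists Y; split=> // o; rewrite (@ssum_mulr _ _ _ _ (pickle o) sY).
  rewrite /y pickleK eqxx -mulrA leg_iso mulr1.
  by [].
move=> k ko; rewrite /y; case: unpickle => [u|]; last by rewrite mul0r.
case: eqP => [ok|]; last by rewrite mul0r.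
rewrite -mulrA leg_orth ?mulr0//; apply: contraNneq ko => <-.
by rewrite ok.
Qed.

(** The block diagonal operator with entries [F o]. For bounded [F] the set is a singleton by
    [blk_ex] and [leg_ext]; the default 0 concerns unbounded [F] only. *)
Definition blk F : A := xget 0 [set Y | forall o, Y * leg o = leg o * F o].
Definition bounded_lbl F := exists M, 0 <= M /\ forall o, nrm (F o) <= M.
Lemma blkE F : bounded_lbl F -> forall o, blk F * leg o = leg o * F o.
Proof.
move=> [M [M0 hM]]; have [Y [_ hY]] := blk_ex M0 hM.
by rewrite /blk; case: xgetP => [Z _ //|/(_ Y)].
Qed.
Lemma blk_uniq F Y : bounded_lbl F -> (forall o, Y * leg o = leg o * F o) -> Y = blk F.
Proof. by move=> bF h; apply: leg_ext => o; rewrite h blkE. Qed.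
Lemma nrm_blk F M : 0 <= M -> (forall o, nrm (F o) <= M) -> nrm (blk F) <= M.
Proof.
move=> M0 hM; have [Y [nY hY]] := blk_ex M0 hM.
by rewrite -(@blk_uniq F Y) //; exists M.
Qed.
Lemma blk_star F : bounded_lbl F -> star (blk F) = blk (fun o => star (F o)).
Proof.
move=> bF; have bF' : bounded_lbl (fun o => star (F o)).
  by have [M [M0 hM]] := bF; exists M; split=> // o; rewrite nrm_star.
apply: blk_uniq bF' _ => o'; apply: leg_extl => o.
have -> : star (leg o) * (star (blk F) * leg o') = star (star (leg o') * (blk F * leg o)).
  by rewrite !starM starK mulrA.
rewrite blkE// mulrA; have [->|oo] := eqVneq o o'.
  by rewrite !leg_iso starM star_one mulr1 mulrA leg_iso mul1r.
by rewrite leg_orth 1?eq_sym// mul0r star0A mulrA leg_orth// mul0r.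
Qed.
Lemma blkM F G : bounded_lbl F -> bounded_lbl G -> blk F * blk G = blk (fun o => F o * G o).
Proof.
move=> bF bG; apply: blk_uniq => [|o].
  have [M [M0 hM]] := bF; have [N [N0 hN]] := bG; exists (M * N); split; first exact: mulr_ge0.
  by move=> o; apply: le_trans (nrmM _ _) _; rewrite ler_pM ?nrm_ge0.
by rewrite -mulrA blkE// mulrA blkE// mulrA.
Qed.
Lemma ev_blk F s : bounded_lbl F -> ev s (blk F) = blk (fun o => ev s (F o)).
Proof.
move=> bF; apply: blk_uniq => [|o].
  by have [M [M0 hM]] := bF; exists M; split=> // o; apply: le_trans (nrm_ev _ _) _.
by rewrite -{1}(ev_leg o s) -evM blkE// evM ev_leg.
Qed.

(** The rational numbers moved into [0,1]; a number that codes no rational stands for the point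
    0. *)
Definition qpt (a : nat) : R := clamp (ratr (odflt (0 : rat) (unpickle a))).
Definition spread x o : A := if o is Some (a, _, _) then ev (qpt a) x else x.
Lemma nrm_spread x o : nrm (spread x o) <= nrm x.
Proof. by case: o => [[[a r] c]|] //=; exact: nrm_ev. Qed.
Lemma bspread x : bounded_lbl (spread x).
Proof. by exists (nrm x); split; [exact: nrm_ge0|exact: nrm_spread]. Qed.
Definition theta x := blk (spread x).
Lemma thetaE x o : theta x * leg o = leg o * spread x o. Proof. exact/blkE/bspread. Qed.
Lemma theta_uniq x Y : (forall o, Y * leg o = leg o * spread x o) -> Y = theta x.
Proof. exact/blk_uniq/bspread. Qed.
Lemma thetaD x y : theta (x + y) = theta x + theta y.
Proof.
apply/esym/theta_uniq => o; rewrite mulrDl !thetaE -mulrDr; congr (_ * _).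
by case: o => [[[a r] c]|] //=; rewrite evD.
Qed.
Lemma thetaM x y : theta (x * y) = theta x * theta y.
Proof.
apply/esym/theta_uniq => o; rewrite -mulrA thetaE mulrA thetaE -mulrA; congr (_ * _).
by case: o => [[[a r] c]|] //=; rewrite evM.
Qed.
Lemma thetaZ c x : theta (c *: x) = c *: theta x.
Proof.
apply/esym/theta_uniq => o; rewrite -scalerAl thetaE scalerAr; congr (_ * _).
by case: o => [[[a r] b]|] //=; rewrite evZ.
Qed.
Lemma thetaN x : theta (- x) = - theta x.
Proof. by rewrite -(scaleN1r x) thetaZ scaleN1r. Qed.
Lemma thetaB x y : theta (x - y) = theta x - theta y.
Proof. by rewrite thetaD thetaN. Qed.
Lemma theta_star x : theta (star x) = star (theta x).
Proof.
rewrite /theta (blk_star (bspread x)); congr blk; apply/funext => -[[[a r] c]|] //=.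
by rewrite evS.
Qed.
Lemma theta1 : theta 1 = 1.
Proof.
by apply/esym/theta_uniq => -[[[a r] c]|] /=; rewrite ?ev1 mul1r mulr1.
Qed.
Lemma nrm_theta x : nrm (theta x) = nrm x.
Proof.
apply/eqP; rewrite eq_le; apply/andP; split.
  by apply: nrm_blk; [exact: nrm_ge0|exact: nrm_spread].
have -> : x = star (leg None) * (theta x * leg None).
  by rewrite thetaE mulrA leg_iso mul1r.
apply: le_trans (nrmM _ _) _; rewrite nrm_star.
apply: le_trans (ler_wpM2r (nrm_ge0 _) (nrm_leg _)) _; rewrite mul1r.
apply: le_trans (nrmM _ _) _; apply: le_trans (ler_wpM2l (nrm_ge0 _) (nrm_leg _)) _.
by rewrite mulr1 thetaE mulrA leg_iso mul1r.
Qed.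
Lemma ev_thetaE s x o : ev s (theta x) * leg o = leg o * ev s (spread x o).
Proof. by rewrite -{1}(ev_leg o s) -evM thetaE evM ev_leg. Qed.

Lemma Xop_leg o : Xop R * leg o =
  if o is Some (a, r, c) then leg (Some (a, r, ~~ c)) else leg None * Xop R.
Proof.
by apply: op_ext => t [n b]; case: o => [[[a r] c]|]; rewrite !(op_mul, leg_be, Sop_be).
Qed.
Lemma Zop_be t i : op (Zop R) t (be R i) = (if i.2 then -1 else 1) *: be R i.
Proof.
by apply: hvP2 => k; rewrite Zop_E hvZE beE; case: eqP => [->|]//; rewrite !mulr0.
Qed.
Lemma Zop_leg o : Zop R * leg o =
  if o is Some (a, r, c) then (if c then -1 else 1) *: leg o else leg None * Zop R.
Proof.
apply: op_ext => t [n b]; case: o => [[[a r] c]|]; rewrite !(op_mul, leg_be, Zop_be, op_scale) //.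
by rewrite opZ leg_be.
Qed.
(** The blocks at rational points are doubled by construction; the hypothesis enters through the
    block [None]. *)
Lemma dbl_theta s x : dbl (ev s x) -> dbl (ev s (theta x)).
Proof.
move=> [hX hZ]; split=> /=; apply: leg_ext => o.
  rewrite -!mulrA Xop_leg ev_thetaE [RHS]mulrA Xop_leg.
  case: o => [[[a r] c]|] /=; first by rewrite ev_thetaE.
  by rewrite mulrA ev_thetaE -!mulrA hX.
rewrite -!mulrA Zop_leg ev_thetaE [RHS]mulrA Zop_leg.
case: o => [[[a r] c]|] /=; first by rewrite -scalerAr -scalerAl ev_thetaE.
by rewrite mulrA ev_thetaE -!mulrA hZ.
Qed.

(** Only the block [None] of [theta x] depends on t, so continuity and compactness of the variation
    are inherited from [x]. *)
Lemma MM_theta x : MM x -> MM (theta x).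
Proof.
move=> [[ux cx] [[kx dx] d'x]]; split; split.
- move=> e /ux[r r0 h]; exists r => // s t /h st.
  have -> : ev s (theta x) - ev t (theta x) =
      blk (fun o => if o is None then ev s x - ev t x else 0).
    apply: blk_uniq => [|o].
      by exists e; split=> [|[?|]] //; rewrite ?nrm0; exact: le_trans (nrm_ge0 _) st.
    rewrite mulrBl !ev_thetaE; case: o => [[[a q] c]|] /=; rewrite ?ev_ev ?subrr ?mulr0//.
    by rewrite -mulrBr.
  apply: nrm_blk; first exact: le_trans (nrm_ge0 _) st.
  by case=> // ?; rewrite nrm0; exact: le_trans (nrm_ge0 _) st.
- move=> t; apply: leg_ext => o; rewrite !ev_thetaE; congr (_ * _).
  by case: o => [[[a q] c]|] /=; rewrite ?ev_ev// cx.
- split; last exact: dbl_theta.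
  rewrite /kpath /=.
  have -> : theta x - ev 0 (theta x) = leg None * ((x - ev 0 x) * star (leg None)).
    apply: leg_ext => o; rewrite mulrBl ev_thetaE thetaE -!mulrA.
    have [->|oN] := eqVneq o None; first by rewrite leg_iso mulr1 -mulrBr.
    rewrite leg_orth 1?eq_sym// !mulr0.
    by case: o oN => [[[a q] c]|] //= _; rewrite ev_ev subrr.
  apply: KK_constl => [s|]; first exact: ev_leg.
  by apply: KK_constr => // s; rewrite evS ev_leg.
- exact: dbl_theta.
Qed.

Lemma gamp_inj : injective (fun i : idx => (gam i.1, i.2)).
Proof. by move=> [n b] [n' b'] /= [/(can_inj gamK) -> ->]. Qed.
Definition Gam : A := Sop R gamp_inj.
Lemma Gam_unitary : unitary Gam.
Proof.
split; first exact: Sop_star_mul.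
apply: op_ext => t [n b]; rewrite op_mul op_one.
have -> : (n, b) = (fun i : idx => (gam i.1, i.2)) (gami n, b) by rewrite /= gamiK.
by rewrite (starS_be gamp_inj) Sop_be.
Qed.
Lemma MM_Gam : MM Gam.
Proof. by apply: MM_const => [s|]; [exact: ev_Sop|exact: dbl_Sop]. Qed.

Lemma theta_theta x : theta (theta x) * Gam = Gam * theta x.
Proof.
have GE i t : op Gam t (be R i) = be R (gam i.1, i.2) by rewrite Sop_be.
apply: leg_ext => -[[[a k] c]|]; rewrite -!mulrA [theta x * _]thetaE.
  case E: (kdecode k) => [[r|r]|[[[a' r'] r] c']].
  - have EE : Gam * leg (Some (a, k, c)) = leg None * leg (Some (a, r, c)).
      by apply: op_ext => t [n b]; rewrite !(op_mul, leg_be, GE) /= /gam codeK E.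
    by rewrite [RHS]mulrA !EE mulrA thetaE -mulrA thetaE mulrA.
  - have EE : Gam * leg (Some (a, k, c)) = leg (Some (a, r, c)) * leg None.
      by apply: op_ext => t [n b]; rewrite !(op_mul, leg_be, GE) /= /gam codeK E.
    by rewrite [RHS]mulrA !EE mulrA thetaE -mulrA ev_thetaE mulrA.
  - have EE : Gam * leg (Some (a, k, c)) = leg (Some (a', r', c)) * leg (Some (a, r, c')).
      by apply: op_ext => t [n b]; rewrite !(op_mul, leg_be, GE) /= /gam codeK E.
    by rewrite [RHS]mulrA !EE mulrA thetaE -mulrA /= ev_thetaE /= ev_ev mulrA.
have EE : Gam * leg None = leg None * leg None.
  by apply: op_ext => t [n b]; rewrite !(op_mul, leg_be, GE) /= /gam codeK.
by rewrite [RHS]mulrA !EE mulrA thetaE -mulrA thetaE mulrA.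
Qed.
End Theta.

(** * The inductive limit *)

Section InductiveLimit.
Variable R : realType.
Local Notation C := R[i].
Local Notation H := (hilb R).
Local Notation A := (fam R).
Implicit Types (x y a b : A) (s : R).

Lemma ad_rk (z : H) i t w : ad (rk z i) t w = cdot z w *: be R i.
Proof. by rewrite /rk locked_withE. Qed.
Lemma rk_iso (z : H) i : hn z = 1 -> star (rk z i) * rk z i = rk (be R i) i.
Proof.
move=> z1; apply: fam_eq => t v; rewrite op_mul op_star ad_rk !op_rk.
have -> : cdot z (v i *: z) = v i; last by [].
have zz : hdot z z = 1 by rewrite -sqr_hn z1 expr1n.
have h0 : hdot z (Complex 0 1 *: z) = 0.
  have := hdotC (Complex 0 1 *: z) z; rewrite hdotZl.
  have -> : (Complex 0 1 : C)^* *: z = - (Complex 0 1 *: z).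
    by rewrite -scaleNr; congr (_ *: _); apply/eqP; rewrite eq_complex /= oppr0 !eqxx.
  rewrite hdotNr => h; lra.
case: (v i) => p q; have -> : Complex p q = rc p + rc q * Complex 0 1 :> C.
  by apply/eqP; rewrite eq_complex /rc /=; apply/andP; split; apply/eqP; ring.
have h1 : hdot (Complex 0 1 *: z) (Complex 0 1 *: z) = 1.
  by rewrite hdotZZ zz /csq /rd /=; ring.
rewrite /cdot scalerDl !hdotDr -scalerA.
rewrite ![hdot _ (rc _ *: _)]hdotC !hdotZrc zz h1 [hdot (_ *: z) z]hdotC h0.
by apply/eqP; rewrite eq_complex /rc /=; apply/andP; split; apply/eqP; ring.
Qed.

Lemma qpt_dense (t e : R) : 0 < e -> exists n, `|qpt R n - clamp t| <= e.
Proof.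
move=> e0; have [q] : exists q : rat, ratr q \in `]t, (t + e)[ by apply: rat_in_itvoo; rewrite ltrDl.
rewrite in_itv /= => /andP[h1 h2]; exists (pickle q); rewrite /qpt pickleK /=.
by apply: le_trans (clamp_lip _ _) _; rewrite ler_norml; apply/andP; split; lra.
Qed.

Section Corner.
Variable a : nat.
Definition cinj (i : idx) : idx := lmap (Some (a, i.1, i.2)) (0%N, false).
Lemma cinj_inj : injective cinj.
Proof. by move=> [n b] [n' b'] /lmap_inj2[[-> ->]]. Qed.
Definition cpad (x : A) (o : lbl) : A := if o is Some (a', _, _) then (if a' == a then x else 0) else 0.
(** The basis vector (n, b) goes to the vector z placed in the copy of the point [a] with
    multiplicity n and doubling b. For a unit vector z this is an isometry onto z tensored with the
    multiplicity space. It is constant and doubled, and [theta x] acts on its range through the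
    vector x(q) z alone. *)
Definition corner (z : H) : A := blk (cpad (rk z (0%N, false))) * Sop R cinj_inj.
Lemma bcpad x : bounded_lbl (cpad x).
Proof.
exists (nrm x); split; first exact: nrm_ge0.
by move=> [[[a' r] c]|] /=; [case: eqP => _|]; rewrite ?nrm0 ?nrm_ge0.
Qed.
Lemma corner_be z t i : op (corner z) t (be R i) = op (leg R (Some (a, i.1, i.2))) t z.
Proof.
rewrite /corner op_mul Sop_be /cinj -(leg_be _ t) -op_mul blkE; last exact: bcpad.
by rewrite op_mul /= eqxx op_rk beE eqxx scale1r.
Qed.
Lemma nrm_corner z : nrm (corner z) <= hn z.
Proof.
apply: le_trans (nrmM _ _) _; rewrite -[leRHS]mulr1.
apply: ler_pM; rewrite ?nrm_ge0 ?nrm_Sop//.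
apply: nrm_blk => [|[[[a' r] c]|] /=]; rewrite ?nrm0 ?hn_ge0//.
by case: eqP => _; rewrite ?nrm0 ?hn_ge0// nrm_rk.
Qed.
Lemma corner_iso z : hn z = 1 -> star (corner z) * corner z = 1.
Proof.
move=> z1; apply: op_ext => t i; rewrite op_one /corner starM.
have bz := bcpad (rk z (0%N, false)).
rewrite (blk_star bz) mulrA -[_ * _ * blk (cpad _)]mulrA blkM //; last first.
  by have [M [M0 hM]] := bz; exists M; split=> // o; rewrite nrm_star.
rewrite !op_mul Sop_be /cinj -(leg_be _ t) -[op (blk _) _ _]op_mul blkE; last first.
  have [M [M0 hM]] := bz; exists (M * M); split; first exact: mulr_ge0.
  by move=> o; apply: le_trans (nrmM _ _) _; rewrite nrm_star ler_pM ?nrm_ge0.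
rewrite /= eqxx rk_iso// !op_mul op_rk beE eqxx scale1r leg_be.
exact: (starS_be cinj_inj).
Qed.
Lemma theta_corner x z : theta x * corner z = corner (op x (qpt R a) z).
Proof.
apply: op_ext => t i; rewrite op_mul !corner_be -op_mul thetaE op_mul /=.
by rewrite op_ev.
Qed.
Lemma MM_corner z : MM (corner z).
Proof.
apply: MM_const => [s|].
  rewrite /corner evM ev_Sop ev_blk; last exact: bcpad.
  congr (blk _ * _); apply/funext => -[[[a' r] c]|] /=; last by rewrite -(scale0r 1) evZ !scale0r.
  by case: eqP => _; rewrite ?ev_rk// -(scale0r 1) evZ !scale0r.
split=> /=; apply: op_ext => t [n b]; rewrite [LHS]op_mul [RHS]op_mul corner_be.
  rewrite Sop_be corner_be -op_mul /=.
  by rewrite (Xop_leg R (Some (a, n, b))).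
rewrite Zop_be opZ corner_be -op_mul (Zop_leg R (Some (a, n, b))) op_scale.
by [].
Qed.
End Corner.

(** Some t and v satisfy |b(t) v| > d |v|; by continuity t may be taken to be a rational point. The
    corner of v, scaled so that b v becomes a unit vector, is the required [Y]. *)
Lemma isometry_corner b d : ucont b -> clamped b -> 0 < d -> d < nrm b ->
  exists Y, [/\ MM Y, star Y * theta (star b * b) * Y = 1 & nrm Y <= d^-1].
Proof.
move=> ub cb d0 db.
have [t [v dv]] : exists t v, d * hn v < hn (op b t v).
  apply: contrapT => h; have : nrm b <= d; last by rewrite leNgt db.
  apply: nrm_le => [|t v]; first exact: ltW.
  by rewrite leNgt; apply/negP => k; apply: h; exists t, v.
have p : 0 < hn v + 1 by rewrite ltr_wpDl ?hn_ge0.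
have e0 : 0 < (hn (op b t v) - d * hn v) / 2 by rewrite divr_gt0// subr_gt0.
have [r r0 hr] := ub _ (divr_gt0 e0 p); have [a ha] := qpt_dense t r0.
have {}dv : d * hn v < hn (op b (qpt R a) v).
  have -> : op b (qpt R a) v = op b t v + op (ev (qpt R a) b - ev t b) 0 v.
    by rewrite op_add op_opp !op_ev addrC subrK.
  have h1 : hn (op (ev (qpt R a) b - ev t b) 0 v) <= (hn (op b t v) - d * hn v) / 2.
    apply: le_trans (op_nrm _ _ _) _; have h2 := hr _ _ ha.
    rewrite -cb ler_pdivlMr// in h2; apply: le_trans h2.
    by rewrite ler_wpM2l ?nrm_ge0// lerDl.
  have := hnB (op b t v + op (ev (qpt R a) b - ev t b) 0 v) (op (ev (qpt R a) b - ev t b) 0 v).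
  rewrite addrK; move: h1 e0; set x1 := hn _; set x2 := hn (op b t v); set x3 := hn (_ + _).
  by move: (d * hn v) => x4; clear; move=> *; lra.
have n0 : 0 < hn (op b (qpt R a) v) by apply: le_lt_trans dv; rewrite mulr_ge0 ?hn_ge0 ?ltW.
pose c : C := rc (hn (op b (qpt R a) v))^-1.
have cc : cabs c = (hn (op b (qpt R a) v))^-1 by rewrite cabs_rc ger0_norm// invr_ge0 ltW.
exists (corner a (c *: v)); split; first exact: MM_corner.
  rewrite thetaM theta_star -mulrA -mulrA mulrA -starM theta_corner.
  apply: corner_iso; rewrite opZ hnZ cc mulVf//; exact: lt0r_neq0.
apply: le_trans (nrm_corner _ _) _; rewrite hnZ cc ler_pdivrMl// mulrC.
by rewrite ler_pdivlMl// ltW.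
Qed.

Lemma unitaryX (u : A) n : unitary u -> unitary (u ^+ n).
Proof.
move=> uu; elim: n => [|n IH]; first by split; rewrite expr0 star_one mulr1.
by rewrite exprS; exact: unitaryM.
Qed.
Lemma MM_GamX n : MM (Gam R ^+ n).
Proof.
elim: n => [|n IH]; first by rewrite expr0; exact: cs1 (csub_MM R).
by rewrite exprS; exact: csM (csub_MM R) _ _ (MM_Gam R) IH.
Qed.
(** The embedding of the n-th stage of the inductive system: by [theta_theta], one more conjugation
    by [Gam] undoes one more application of [theta]. *)
Definition jn n x := star (Gam R ^+ n) * theta x * Gam R ^+ n.
Lemma jnM n x y : jn n (x * y) = jn n x * jn n y.
Proof.
have [_ h] := unitaryX n (Gam_unitary R); rewrite /jn thetaM; set g := _ ^+ n in h *.
have -> : star g * theta x * g * (star g * theta y * g) =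
  star g * theta x * (g * star g) * theta y * g by nring.
by rewrite h mulr1 !mulrA.
Qed.
Lemma jnD n x y : jn n (x + y) = jn n x + jn n y.
Proof. by rewrite /jn thetaD mulrDr mulrDl. Qed.
Lemma jnZ n c x : jn n (c *: x) = c *: jn n x.
Proof. by rewrite /jn thetaZ -scalerAr -scalerAl. Qed.
Lemma jnB n x y : jn n (x - y) = jn n x - jn n y.
Proof. by rewrite jnD -(scaleN1r y) jnZ scaleN1r. Qed.
Lemma jnS n x : jn n (star x) = star (jn n x).
Proof. by rewrite /jn theta_star !starM starK mulrA. Qed.
Lemma jn1 n : jn n 1 = 1.
Proof. by rewrite /jn theta1 mulr1; case: (unitaryX n (Gam_unitary R)). Qed.
Lemma jn_theta n x : jn n.+1 (theta x) = jn n x.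
Proof.
have [h _] := Gam_unitary R.
rewrite /jn exprS starM; set g := _ ^+ n.
have -> : star g * star (Gam R) * theta (theta x) * (Gam R * g) =
   star g * (star (Gam R) * (theta (theta x) * Gam R)) * g by nring.
have -> : star (Gam R) * (theta (theta x) * Gam R) = theta x.
  by rewrite theta_theta mulrA h mul1r.
by [].
Qed.
Lemma nrm_unitary_conj (u x : A) : unitary u -> nrm (star u * x * u) = nrm x.
Proof.
have le (w y : A) : unitary w -> nrm (star w * y * w) <= nrm y.
  move=> [w1 _]; have n1 : nrm w <= 1.
    by rewrite -ler_sqr ?nnegrE ?nrm_ge0// -nrm_cstar w1 nrm1 expr1n.
  apply: le_trans (nrmM _ _) _; apply: le_trans (ler_wpM2l (nrm_ge0 _) n1) _; rewrite mulr1.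
  apply: le_trans (nrmM _ _) _; rewrite nrm_star.
  by apply: le_trans (ler_wpM2r (nrm_ge0 _) n1) _; rewrite mul1r.
move=> uu; apply/eqP; rewrite eq_le le//=.
have {1}-> : x = star (star u) * (star u * x * u) * star u.
  have [_ h] := uu; rewrite starK.
  have -> : u * (star u * x * u) * star u = (u * star u) * x * (u * star u) by nring.
  by rewrite h mulr1 mul1r.
exact: le (unitary_star uu).
Qed.
Lemma nrm_jn n x : nrm (jn n x) = nrm x.
Proof. by rewrite /jn nrm_unitary_conj ?nrm_theta//; exact/unitaryX/Gam_unitary. Qed.
Lemma MM_jn n x : MM x -> MM (jn n x).
Proof.
move=> hx; have sM := csub_MM R.
exact: (csM sM (csM sM (csS sM (MM_GamX n)) (MM_theta hx)) (MM_GamX n)).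
Qed.
Lemma jn_iter k n x : jn (k + n) (iter k (@theta R) x) = jn n x.
Proof. by elim: k => //= k IH; rewrite jn_theta IH. Qed.
Lemma MM_iter k x : MM x -> MM (iter k (@theta R) x).
Proof. by move=> hx; elim: k => //= k IH; exact: MM_theta. Qed.

(* The inductive limit of the endomorphism [theta] of [MM], realized inside [MM]. *)
Definition AA : set A := [set b | forall e, 0 < e -> exists n x, MM x /\ nrm (b - jn n x) <= e].
Lemma AA_jn n x : MM x -> AA (jn n x).
Proof. by move=> hx e e0; exists n, x; split=> //; rewrite subrr nrm0 ltW. Qed.
Lemma AA_MM b : AA b -> MM b.
Proof.
move=> h; apply: (csC (csub_MM R)) => e /h[n [x [hx bx]]].
by exists (jn n x) => //; exact: MM_jn.
Qed.
Lemma AA_common b d e : AA b -> AA d -> 0 < e ->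
  exists n x y, [/\ MM x, MM y, nrm (b - jn n x) <= e & nrm (d - jn n y) <= e].
Proof.
move=> hb hd e0; have [n [x [hx bx]]] := hb _ e0; have [m [y [hy dy]]] := hd _ e0.
exists (n + m)%N, (iter m (@theta R) x), (iter n (@theta R) y).
by split; rewrite ?jn_iter 1?addnC ?jn_iter//; exact: MM_iter.
Qed.
Lemma csub_AA : csub AA.
Proof.
have sM := csub_MM R; split.
- by rewrite -(jn1 0); apply: AA_jn; exact: cs1 sM.
- move=> b d hb hd e e0; have e2 : 0 < e / 2 by rewrite divr_gt0.
  have [n [x [y [hx hy bx dy]]]] := AA_common hb hd e2.
  exists n, (x + y); split; first exact: csD.
  rewrite jnD opprD addrACA; apply: le_trans (nrmD _ _) _.
  by rewrite (splitr e) lerD.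
- move=> c b hb e e0; have p : 0 < cabs c + 1 by rewrite ltr_wpDl ?cabs_ge0.
  have [n [x [hx bx]]] := hb _ (divr_gt0 e0 p); exists n, (c *: x); split; first exact: csZ.
  rewrite jnZ -scalerBr nrmZ; rewrite ler_pdivlMr// in bx; apply: le_trans bx.
  by rewrite mulrC ler_wpM2l ?nrm_ge0// lerDl.
- move=> b d hb hd e e0.
  have p : 0 < nrm b + nrm d + 1 by rewrite ltr_wpDl ?addr_ge0 ?nrm_ge0.
  have q : 0 < Num.min 1 (e / (nrm b + nrm d + 1)) by rewrite lt_min ltr01 divr_gt0.
  have [n [x [y [hx hy bx dy]]]] := AA_common hb hd q.
  move: bx dy; rewrite !le_min => /andP[b1 b2] /andP[_ d2].
  exists n, (x * y); split; first exact: csM.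
  have -> : b * d - jn n (x * y) = (b - jn n x) * d + jn n x * (d - jn n y).
    by rewrite jnM; nring.
  have nx : nrm (jn n x) <= nrm b + 1.
    rewrite -[jn n x](subKr b); apply: le_trans (nrmB _ _) _; by rewrite lerD2l.
  apply: le_trans (nrmD _ _) _; apply: le_trans (lerD (nrmM _ _) (nrmM _ _)) _.
  have {q}qE : e = e / (nrm b + nrm d + 1) * (nrm b + nrm d + 1) by rewrite divfK// lt0r_neq0.
  rewrite [leRHS]qE.
  have := nrm_ge0 b; have := nrm_ge0 d; have := nrm_ge0 (b - jn n x); have := nrm_ge0 (d - jn n y).
  move: b2 d2 nx (nrm_ge0 (jn n x)); move: (e / _) => f.
  clear; gen_norms; nra.
- move=> b hb e /hb[n [x [hx bx]]]; exists n, (star x); split; first exact: csS.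
  by rewrite jnS -star_sub nrm_star.
- move=> b h e e0; have e2 : 0 < e / 2 by rewrite divr_gt0.
  have [d hd bd] := h _ e2; have [n [x [hx dx]]] := hd _ e2.
  exists n, x; split=> //; have -> : b - jn n x = (b - d) + (d - jn n x) by nring.
  by apply: le_trans (nrmD _ _) _; rewrite (splitr e) lerD.
Qed.

Lemma AA_corner b : AA b -> b <> 0 -> exists2 y, AA y & star y * (star b * b) * y = 1.
Proof.
move=> hb b0; have sA := csub_AA.
have n0 : 0 < nrm b.
  by rewrite lt_neqAle nrm_ge0 andbT eq_sym; apply/eqP => /nrm0_eq0.
(* The compression is exact for the approximant x and is repaired by an inverse square root for b.
   With distance |b| / 18 the error of b^* b is at most (1/18)(1 + 19/18) |b|^2 <= |b|^2 / 8, and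
   |y0|^2 <= 4 / |b|^2, which leaves 1/2. *)
have [n [x [hx bx]]] := hb (nrm b / 18) (divr_gt0 n0 (ltr0Sn _ _)).
have nx : nrm b / 2 < nrm x.
  rewrite -(nrm_jn n x); have := nrmD (b - jn n x) (jn n x).
  by rewrite subrK; move: bx n0; gen_norms; lra.
have nx' : nrm x <= 19/18 * nrm b.
  rewrite -(nrm_jn n x); have := nrmB b (b - jn n x).
  by rewrite opprB addrC subrK; move: bx n0; gen_norms; lra.
have [[ux cx] _] := hx.
have [Y [MY YY nY]] := isometry_corner ux cx (divr_gt0 n0 (ltr0n _ 2)) nx.
pose y0 := jn n.+1 Y; have yy : star y0 * jn n (star x * x) * y0 = 1.
  by rewrite -jn_theta /y0 -jnS -!jnM YY jn1.
have Ay : AA y0 by exact: AA_jn.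
pose z := star y0 * (star b * b) * y0.
have Az : AA z by exact: (csM sA (csM sA (csS sA Ay) (csM sA (csS sA hb) hb)) Ay).
have sz : star z = z by rewrite /z !starM !starK !mulrA.
have nz : nrm (1 - z) <= 2^-1.
  have -> : 1 - z = star y0 * (star (jn n x - b) * jn n x + star b * (jn n x - b)) * y0.
    by rewrite -yy /z jnM jnS star_sub; nring.
  apply: le_trans (nrmM _ _) _; apply: le_trans (ler_wpM2r (nrm_ge0 _) (nrmM _ _)) _.
  rewrite nrm_star [X in X * _]mulrC -mulrA -expr2.
  have {}nY : nrm y0 ^+ 2 <= (2 / nrm b) ^+ 2.
    rewrite ler_sqr ?nnegrE ?nrm_ge0 ?divr_ge0 ?nrm_ge0// /y0 nrm_jn.
    by apply: le_trans nY _; rewrite invfM invrK mulrC.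
  have h1 : nrm (star (jn n x - b) * jn n x + star b * (jn n x - b)) <= nrm b ^+ 2 / 8.
    apply: le_trans (nrmD _ _) _; apply: le_trans (lerD (nrmM _ _) (nrmM _ _)) _.
    rewrite !nrm_star nrmBC nrm_jn; have := nrm_ge0 (b - jn n x); have := nrm_ge0 x.
    move: bx nx' n0; clear; gen_norms; nra.
  apply: le_trans (ler_pM (nrm_ge0 _) (sqr_ge0 _) h1 nY) _.
  by rewrite le_eqVlt; apply/orP; left; apply/eqP; field; exact: lt0r_neq0.
have [h [sh hzh _ _ [hB _]]] := inv_sqrt_sa sz nz; exists (y0 * h).
  exact: (csM sA Ay (hB _ sA Az)).
by rewrite starM sh -hzh /z; nring.
Qed.
End InductiveLimit.

(** * Equivalence of projections *)

Section LinearAlgebra.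
Variable C : numClosedFieldType.
Definition adj m n (M : 'M[C]_(m, n)) : 'M[C]_(n, m) := map_mx Num.conj M^T.
Lemma adjE m n (M : 'M[C]_(m, n)) i j : adj M i j = (M j i)^*. Proof. by rewrite !mxE. Qed.
Lemma adjK m n (M : 'M[C]_(m, n)) : adj (adj M) = M.
Proof. by apply/matrixP => i j; rewrite !adjE conjCK. Qed.
Lemma adjM m n p (M : 'M[C]_(m, n)) (N : 'M[C]_(n, p)) : adj (M *m N) = adj N *m adj M.
Proof. by rewrite /adj trmx_mul map_mxM. Qed.

Lemma spectral_unitary n (A : 'M[C]_n) : adj A *m A = A *m adj A ->
  exists (P : 'M[C]_n) (D : 'rV[C]_n),
    [/\ adj P *m P = 1%:M, P *m adj P = 1%:M & A = adj P *m diag_mx D *m P].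
Proof.
move=> An; have /orthomx_spectralP E : A \is normalmx by apply/normalmxP.
have hP := spectral_unitarymx A; exists (spectralmx A), (spectral_diag A).
have e : invmx (spectralmx A) = adj (spectralmx A) := invmx_unitary hP.
split; last by rewrite -e.
  by rewrite -e mulVmx// unitarymx_unit.
by rewrite -e mulmxV// unitarymx_unit.
Qed.

Lemma perm_of_count n (a b : 'I_n -> bool) : (\sum_i a i = \sum_i b i)%N ->
  exists s : 'S_n, forall i, a (s i) = b i.
Proof.
move=> h; have /tuple_permP[s hs] : perm_eq [tuple b i | i < n] [tuple a i | i < n].
  apply/allP => c _ /=; rewrite !count_map.
  have cE (f : 'I_n -> bool) : count (preim f (pred1 c)) (enum 'I_n) =
      if c then (\sum_i f i)%N else (n - \sum_i f i)%N.
    have -> : (\sum_i f i)%N = count f (enum 'I_n) by rewrite -sum1_count big_enum_cond/= [RHS]big_mkcond.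
    case: c; first by apply: eq_count => i /=; case: (f i).
    rewrite -[n in (n - _)%N]size_enum_ord -(count_predC f) addKn.
    by apply: eq_count => i /=; case: (f i).
  by have E := cE b; rewrite -h -(cE a) !enumT in E; exact/eqP.
exists s => i; have /(congr1 (fun t => tnth t i)) := val_inj hs.
by rewrite !tnth_mktuple.
Qed.

(** The spectral theorem turns both into diagonal matrices with entries 0 and 1. The trace counts
    the ones, so equal traces provide a permutation between them. *)
Lemma projection_equiv n (P Q : 'M[C]_n) : adj P = P -> P *m P = P -> adj Q = Q -> Q *m Q = Q ->
  \tr P = \tr Q -> exists V : 'M[C]_n, [/\ adj V *m V = 1%:M, V *m adj V = 1%:M & V *m P *m adj V = Q].
Proof.
move=> sP PP sQ QQ tPQ.
have diag (X : 'M[C]_n) : adj X = X -> X *m X = X -> exists (V : 'M[C]_n) (a : 'I_n -> bool),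
  [/\ adj V *m V = 1%:M, V *m adj V = 1%:M, V *m X *m adj V = diag_mx (\row_i (a i)%:R)
    & \tr X = (\sum_i a i)%N%:R].
  move=> sX XX; have [|V [D [V1 V2 XE]]] := @spectral_unitary n X; first by rewrite sX.
  have VX : V *m X *m adj V = diag_mx D by rewrite XE !mulmxA V2 mul1mx -mulmxA V2 mulmx1.
  have DD : diag_mx D *m diag_mx D = diag_mx D.
    rewrite -VX -{3}XX !mulmxA; congr (_ *m _).
    by rewrite -[V *m X *m adj V *m V]mulmxA V1 mulmx1.
  have D01 i : D 0 i = (D 0 i == 1)%:R.
    have /matrixP/(_ i i) := DD; rewrite mulmx_diag !mxE eqxx !mulr1n.
    move=> /eqP; rewrite -subr_eq0 -{3}[D 0 i]mulr1 -mulrBr mulf_eq0 subr_eq0.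
    by case: (D 0 i =P 1) => [->|_]//=; rewrite orbF => /eqP.
  exists V, (fun i => D 0 i == 1); split=> //.
    by rewrite VX; congr diag_mx; apply/rowP => i; rewrite !mxE.
  rewrite XE -mulmxA mxtrace_mulC -mulmxA V2 mulmx1 mxtrace_diag natr_sum.
  exact: eq_bigr.
have [V [a [V1 V2 VP tP]]] := diag _ sP PP; have [W [b [W1 W2 WQ tQ]]] := diag _ sQ QQ.
have /perm_of_count[s hs] : (\sum_i a i = \sum_i b i)%N.
  by apply/eqP; rewrite -(eqr_nat C) -tP -tQ tPQ.
pose S : 'M[C]_n := perm_mx s.
have aS : adj S = perm_mx s^-1%g by rewrite /adj tr_perm_mx map_perm_mx.
have S1 : adj S *m S = 1%:M by rewrite aS -perm_mxM mulVg perm_mx1.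
have S2 : S *m adj S = 1%:M by rewrite aS -perm_mxM mulgV perm_mx1.
exists (adj W *m (S *m V)); split.
- by rewrite !adjM adjK -!mulmxA (mulmxA W) W2 mul1mx (mulmxA (adj S)) S1 mul1mx V1.
- by rewrite !adjM adjK -!mulmxA (mulmxA V) V2 mul1mx (mulmxA S) S2 mul1mx W1.
have -> : adj W *m (S *m V) *m P *m adj (adj W *m (S *m V)) = adj W *m (S *m (V *m P *m adj V) *m adj S) *m W.
  by rewrite !adjM adjK !mulmxA.
have -> : S *m (V *m P *m adj V) *m adj S = W *m Q *m adj W.
  rewrite VP WQ aS -row_permE -col_permE; apply/matrixP => i j; rewrite !mxE hs.
  by rewrite (inj_eq perm_inj).
by rewrite !mulmxA W1 mul1mx -mulmxA W1 mulmx1.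
Qed.
End LinearAlgebra.

(** * Paths on the unit circle *)

Section Arc.
Variable R : realType.
Local Notation C := R[i].
Implicit Types (l : C) (s t : R).

(* The arc of the unit circle from [1] to [l] through the half plane of [l]. *)
Definition arcx l t : R := 1 - clamp t * (1 - complex.Re l).
Definition arcy l t : R := Num.sqrt (1 - arcx l t ^+ 2).
Definition arc l t : C := Complex (arcx l t) (if 0 <= complex.Im l then arcy l t else - arcy l t).
Lemma arcx_bd l t : cabs l = 1 -> -1 <= arcx l t <= 1.
Proof.
move=> l1; have := ler_Re l; rewrite l1 ler_norml => /andP[h1 h2].
have := clamp_ge0 t; have := clamp_le1 t; rewrite /arcx => *; apply/andP; split; nra.
Qed.
Lemma arcx_sq l t : cabs l = 1 -> 0 <= 1 - arcx l t ^+ 2.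
Proof. by move=> /(arcx_bd t)/andP[h1 h2]; nra. Qed.
Lemma cabs_arc l t : cabs l = 1 -> cabs (arc l t) = 1.
Proof.
move=> l1; rewrite /cabs /csq /rd /=.
have -> : (if 0 <= complex.Im l then arcy l t else - arcy l t) * (if 0 <= complex.Im l then arcy l t else - arcy l t)
  = arcy l t ^+ 2 by case: ifP => _; rewrite ?mulrNN.
by rewrite sqr_sqrtr ?arcx_sq// -expr2 addrC subrK sqrtr1.
Qed.
Lemma arc0 l : arc l 0 = 1.
Proof.
have e : arcx l 0 = 1 by rewrite /arcx clamp0 mul0r subr0.
by apply/eqP; rewrite eq_complex /= /arcy e expr1n subrr sqrtr0 oppr0 if_same !eqxx.
Qed.
Lemma arc1 l : cabs l = 1 -> arc l 1 = l.
Proof.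
move=> l1; have e : arcx l 1 = complex.Re l by rewrite /arcx clamp1 mul1r subKr.
have sq : 1 - complex.Re l ^+ 2 = complex.Im l ^+ 2.
  have : csq l = 1 by rewrite -[csq l]sqr_sqrtr ?csq_ge0// -/(cabs l) l1 expr1n.
  by rewrite /csq /rd => <-; ring.
apply/eqP; rewrite eq_complex /= /arcy e eqxx sq sqrtr_sqr /=.
by case: (leP 0 (complex.Im l)) => h; rewrite ?(ger0_norm h)// (ltr0_norm h) opprK.
Qed.
Lemma sqrt_dist (a b : R) : 0 <= a -> 0 <= b -> `|Num.sqrt a - Num.sqrt b| <= Num.sqrt `|a - b|.
Proof.
have L (x y : R) : 0 <= x -> x <= y -> `|Num.sqrt x - Num.sqrt y| <= Num.sqrt `|x - y|.
  move=> x0 xy; have y0 := le_trans x0 xy; rewrite distrC [`|x - y|]distrC.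
  have s := ler_wsqrtr xy; rewrite !ger0_norm ?subr_ge0//.
  rewrite -ler_sqr ?nnegrE ?sqrtr_ge0 ?subr_ge0// sqr_sqrtr ?subr_ge0//.
  have := sqr_sqrtr x0; have := sqr_sqrtr y0; have := sqrtr_ge0 x; have := sqrtr_ge0 y.
  by move: s; move: (Num.sqrt x) (Num.sqrt y) => p q; nra.
move=> a0 b0; case: (leP a b) => [|/ltW] ab; first exact: L.
by rewrite distrC [`|a - b|]distrC; exact: L.
Qed.
(** The modulus must not depend on the end point [l], because [unitary_path] moves all eigenvalues
    together. The square in it reflects that the ordinate, a square root, is only Hoelder continuous
    of exponent 1/2. *)
Lemma arc_ucont (e : R) : 0 < e -> exists2 r, 0 < r & forall l, cabs l = 1 ->
  forall s t, `|s - t| <= r -> cabs (arc l s - arc l t) <= e.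
Proof.
move=> e0; exists (Num.min (e / 4) ((e / 4) ^+ 2)); first by rewrite lt_min exprn_gt0 ?divr_gt0.
move=> l l1 s t; rewrite le_min => /andP[h1 h2].
have dx : `|arcx l s - arcx l t| <= 2 * `|s - t|.
  have -> : arcx l s - arcx l t = (clamp t - clamp s) * (1 - complex.Re l) by rewrite /arcx; ring.
  rewrite normrM mulrC; apply: ler_pM => //.
    have := ler_Re l; rewrite l1 ler_norml => /andP[? ?]; rewrite ger0_norm; lra.
  by rewrite distrC; exact: clamp_lip.
have dy : `|arcy l s - arcy l t| <= e / 2.
  apply: le_trans (sqrt_dist (arcx_sq s l1) (arcx_sq t l1)) _.
  have e2 : 0 <= e / 2 by rewrite divr_ge0// ltW.
  rewrite -[leRHS](ger0_norm e2) -[leRHS]sqrtr_sqr; apply: ler_wsqrtr.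
  have -> : 1 - arcx l s ^+ 2 - (1 - arcx l t ^+ 2) = (arcx l t - arcx l s) * (arcx l t + arcx l s) by ring.
  rewrite normrM distrC; apply: le_trans (_ : 2 * `|s - t| * 2 <= _); last first.
    have -> : (e / 2) ^+ 2 = 4 * (e / 4) ^+ 2 by field. lra.
  apply: ler_pM => //; have /andP[? ?] := arcx_bd s l1; have /andP[? ?] := arcx_bd t l1.
  by rewrite ler_norml; apply/andP; split; lra.
apply: le_trans (ler_cabs _) _; rewrite [leRHS](splitr e); apply: lerD.
  by rewrite /arc /=; apply: le_trans dx _; lra.
rewrite /arc; case: ifP => _ //=.
by rewrite -opprD normrN.
Qed.
End Arc.

(** * Finite windows and paths of unitaries inside them *)

Section Window.
Variable R : realType.
Local Notation C := R[i].
Local Notation H := (hilb R).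
Local Notation A := (fam R).
Implicit Types (a b x y : A) (t s : R) (k : idx).

Lemma cdot_be k (w : H) : cdot (be R k) w = w k.
Proof.
rewrite /cdot hdotC hdot_be hdotC hdotZr hdot_be hvZE.
by case: (w k) => p q; apply/eqP; rewrite eq_complex /=; apply/andP; split; apply/eqP; ring.
Qed.
Lemma rk_be_star k k' : star (rk (be R k) k') = rk (be R k') k.
Proof. by apply: fam_eq => t v; rewrite op_star ad_rk op_rk cdot_be. Qed.
Lemma op_sum (I : finType) (F : I -> A) t v : op (\sum_i F i) t v = \sum_i op (F i) t v.
Proof.
apply: (big_morph (fun x => op x t v)) => [x y|]; [exact: op_add|exact: op_zero].
Qed.
Lemma hv_sum (I : finType) (F : I -> H) k : (\sum_i F i) k = \sum_i F i k.
Proof. by apply: (big_morph (fun x : H => x k)) => [x y|]; [exact: hvDE|exact: hv0E]. Qed.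
Lemma opV_sum a t (I : finType) (F : I -> H) : op a t (\sum_i F i) = \sum_i op a t (F i).
Proof.
apply: (big_morph (fun v => op a t v)) => [x y|]; [exact: opD|exact: op0].
Qed.
Lemma star_sum (I : finType) (F : I -> A) : star (\sum_i F i) = \sum_i star (F i).
Proof. by apply: (big_morph star) => [x y|]; [exact: starD|exact: star0A]. Qed.

Section Matrices.
Variables (m : nat) (w : 'I_m -> idx).
Hypothesis wi : injective w.
Definition opm (M : 'M[C]_m) : A := \sum_i \sum_j M i j *: rk (be R (w i)) (w j).
Definition mat t a : 'M[C]_m := \matrix_(i, j) op a t (be R (w j)) (w i).
Lemma op_opm M t (v : H) : op (opm M) t v = \sum_i (\sum_j M i j * v (w j)) *: be R (w i).
Proof.
rewrite /opm op_sum; apply: eq_bigr => i _; rewrite op_sum scaler_suml.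
by apply: eq_bigr => j _; rewrite op_scale op_rk scalerA.
Qed.
Lemma op_opm_w M t (v : H) i : op (opm M) t v (w i) = \sum_j M i j * v (w j).
Proof.
rewrite op_opm; have E (c : 'I_m -> C) : (\sum_i c i *: be R (w i)) (w i) = c i.
  rewrite hv_sum; under eq_bigr do rewrite hvZE beE (inj_eq wi).
  rewrite (bigD1 i)//= big1 ?addr0; first by rewrite eqxx mulr1.
  by move=> j ji; rewrite eq_sym (negbTE ji) mulr0.
exact: E.
Qed.
Lemma op_opm_out M t (v : H) k : (forall i, k <> w i) -> op (opm M) t v k = 0.
Proof.
move=> hk; rewrite op_opm hv_sum big1 // => i _; rewrite hvZE beE.
by case: eqP => [/hk|]//; rewrite mulr0.
Qed.
Lemma inw k : (exists i, k = w i) \/ (forall i, k <> w i).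
Proof.
case: (pselect (exists i, k = w i)); first by left.
by move=> h; right => i ki; apply: h; exists i.
Qed.
Lemma opmM M N : opm M * opm N = opm (M *m N).
Proof.
apply: fam_eq => t v; apply: hvP2 => k; rewrite op_mul.
have [[i ->]|hk] := inw k; last by rewrite !op_opm_out.
rewrite !op_opm_w; under eq_bigr do rewrite op_opm_w mulr_sumr.
rewrite exchange_big /=; apply: eq_bigr => j _; rewrite !mxE mulr_suml.
by apply: eq_bigr => l _; rewrite mulrA.
Qed.
Lemma opmS M : star (opm M) = opm (adj M).
Proof.
rewrite /opm star_sum; under eq_bigr do rewrite star_sum.
rewrite exchange_big /=; apply: eq_bigr => i _; apply: eq_bigr => j _.
by rewrite star_scale rk_be_star adjE.
Qed.
Lemma ev_opm s M : ev s (opm M) = opm M.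
Proof. by apply: fam_eq => t v; rewrite op_ev !op_opm. Qed.
Lemma mat_opm t M : mat t (opm M) = M.
Proof.
apply/matrixP => i j; rewrite mxE op_opm_w (bigD1 j)//= big1 ?addr0.
  by rewrite beE eqxx mulr1.
by move=> l lj; rewrite beE (inj_eq wi) (negbTE lj) mulr0.
Qed.
Lemma opm_inj M N : opm M = opm N -> M = N.
Proof. by move=> h; rewrite -(mat_opm 0 M) h mat_opm. Qed.
Lemma op_opm1 t (v : H) k : op (opm 1%:M) t v k = (k \in codom w)%:R * v k.
Proof.
have [[i ->]|hk] := inw k.
  rewrite codom_f mul1r op_opm_w (bigD1 i)//= big1 ?addr0; first by rewrite mxE eqxx mul1r.
  by move=> j ji; rewrite mxE eq_sym (negbTE ji) mul0r.
rewrite op_opm_out//; case: codomP => [[i /hk]|]//; by rewrite mul0r.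
Qed.
Lemma opm_mat a : (forall s, ev s a = a) -> opm (mat 0 a) = opm 1%:M * a * opm 1%:M.
Proof.
move=> ca; apply: fam_eq => t v; apply: hvP2 => k; rewrite !op_mul.
have [[i ->]|hk] := inw k; last by rewrite !op_opm_out.
rewrite op_opm1 codom_f mul1r op_opm_w.
have -> : op (opm 1%:M) t v = \sum_j v (w j) *: be R (w j).
  rewrite op_opm; apply: eq_bigr => j _; congr (_ *: _).
  rewrite (bigD1 j)//= big1 ?addr0; first by rewrite mxE eqxx mul1r.
  by move=> l lj; rewrite mxE eq_sym (negbTE lj) mul0r.
rewrite opV_sum hv_sum; apply: eq_bigr => j _.
by rewrite opZ hvZE mxE mulrC -[a in RHS](ca 0) op_ev.
Qed.
End Matrices.

Section Diagonal.
Variable f : R -> idx -> C.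
Definition dgm t n (b b' : bool) : C := if b == b' then f t (n, b) else 0.
Lemma bdm_dgm : (exists M, 0 <= M /\ forall t k, cabs (f t k) <= M) -> bdm dgm.
Proof.
move=> [M [M0 hM]]; exists M; split=> // t n b b'; rewrite /dgm; case: eqP => // _.
by rewrite cabs0.
Qed.
Hypothesis hf : bdm dgm.
Lemma op_dg t (v : H) k : op (gop hf) t v k = f t k * v k.
Proof.
by rewrite op_gop /dgm; case: k => n [] /=; rewrite mul0r ?addr0 ?add0r.
Qed.
Lemma dg_be t k : op (gop hf) t (be R k) = f t k *: be R k.
Proof.
by apply: hvP2 => j; rewrite op_dg hvZE beE; case: eqP => [->|]//; rewrite !mulr0.
Qed.
End Diagonal.

Definition iw N (i : 'I_(N + N)) : idx :=
  match fintype.split i with inl n => (n : nat, false) | inr n => (n : nat, true) end.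
Lemma iw_inj N : injective (@iw N).
Proof.
move=> i j; rewrite /iw => h; apply: (can_inj (@splitK N N)).
by case: (fintype.split i) (fintype.split j) h => [n|n] [n'|n'] // [/val_inj ->].
Qed.
Lemma iwl N (n : 'I_N) : iw (lshift N n) = (n : nat, false).
Proof. by rewrite /iw -[lshift N n]/(unsplit (inl n)) unsplitK. Qed.
Lemma iwr N (n : 'I_N) : iw (rshift N n) = (n : nat, true).
Proof. by rewrite /iw -[rshift N n]/(unsplit (inr n)) unsplitK. Qed.
Lemma codom_iw N k : (k \in codom (@iw N)) = (k.1 < N)%N.
Proof.
apply/codomP/idP => [[i ->]|]; first by rewrite /iw; case: (fintype.split i) => n /=.
case: k => n b /= nN; case: b.
  by exists (rshift N (Ordinal nN)); rewrite iwr.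
by exists (lshift N (Ordinal nN)); rewrite iwl.
Qed.
Lemma opm_iw1 N : opm (@iw N) 1%:M = eN R N.
Proof.
apply: fam_eq => t v; apply: hvP2 => k.
by rewrite (op_opm1 (@iw_inj N)) eN_E codom_iw.
Qed.

Definition wop N (M : 'M[C]_(N + N)) : A := opm (@iw N) M + (1 - eN R N).
Notation wmat N := (mat (@iw N)).
Lemma opm_eNl N (M : 'M[C]_(N + N)) : eN R N * opm (@iw N) M = opm (@iw N) M.
Proof. by rewrite -opm_iw1 opmM ?mul1mx//; exact: iw_inj. Qed.
Lemma opm_eNr N (M : 'M[C]_(N + N)) : opm (@iw N) M * eN R N = opm (@iw N) M.
Proof. by rewrite -opm_iw1 opmM ?mulmx1//; exact: iw_inj. Qed.
Lemma wopM N (M M' : 'M[C]_(N + N)) : wop M * wop M' = wop (M *m M').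
Proof.
rewrite /wop -opmM; last exact: iw_inj.
have -> : (opm (@iw N) M + (1 - eN R N)) * (opm (@iw N) M' + (1 - eN R N)) =
   opm (@iw N) M * opm (@iw N) M' + (1 - eN R N - eN R N + eN R N * eN R N) +
   (opm (@iw N) M - opm (@iw N) M * eN R N) + (opm (@iw N) M' - eN R N * opm (@iw N) M') by nring.
by rewrite opm_eNl opm_eNr !subrr !addr0 eN_id -addrA addNr addr0.
Qed.
Lemma wopS N (M : 'M[C]_(N + N)) : star (wop M) = wop (adj M).
Proof. by rewrite /wop starD star_sub star_one eN_sa opmS//; exact: iw_inj. Qed.
Lemma wop1 N : wop (1%:M : 'M[C]_(N + N)) = 1.
Proof. by rewrite /wop opm_iw1 addrC subrK. Qed.
Lemma ev_wop s N (M : 'M[C]_(N + N)) : ev s (wop M) = wop M.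
Proof. by rewrite /wop evD evB ev1 ev_eN ev_opm//; exact: iw_inj. Qed.
Lemma wop_unitary N (M : 'M[C]_(N + N)) : adj M *m M = 1%:M -> M *m adj M = 1%:M -> unitary (wop M).
Proof. by move=> h1 h2; split; rewrite wopS wopM ?h1 ?h2 wop1. Qed.
Lemma wop_wmat N a : (forall s, ev s a = a) -> supp N (a - 1) -> a = wop (wmat N 0 a).
Proof.
move=> ca sa; rewrite /wop opm_mat// ?opm_iw1; last exact: iw_inj.
rewrite -{1}[a](subrK 1) -sa mulrBr mulrBl mulr1 eN_id; nring.
Qed.
Lemma wop_inj N (M M' : 'M[C]_(N + N)) : wop M = wop M' -> M = M'.
Proof. by move=> /addIr /(opm_inj (@iw_inj N)). Qed.

Lemma arc_1 t : arc (1 : C) t = 1.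
Proof.
have e : arcx (1 : C) t = 1 by rewrite /arcx /= subrr mulr0 subr0.
by apply/eqP; rewrite eq_complex /= /arcy e expr1n subrr sqrtr0 oppr0 if_same !eqxx.
Qed.
Lemma arc_clamp (l : C) t : arc l (clamp t) = arc l t.
Proof. by rewrite /arc /arcy /arcx clampK. Qed.

Lemma ucont_dg (f : R -> idx -> C) (hf : bdm (dgm f)) :
  (forall e, 0 < e -> exists2 r, 0 < r & forall s t, `|s - t| <= r -> forall k, cabs (f s k - f t k) <= e) ->
  ucont (gop hf).
Proof.
move=> h e e0; have [r r0 hr] := h _ (divr_gt0 e0 (ltr0Sn _ 1)); exists r => // s t /hr st.
apply: nrm_le (ltW e0) _ => q v; rewrite op_add op_opp !op_ev.
have [M [M0 hM]] := hf.
have hd : bdm (dgm (fun=> (fun k => f s k - f t k))).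
  by apply: bdm_dgm; exists (e / 2); split=> //; rewrite divr_ge0// ltW.
have -> : op (gop hf) s v - op (gop hf) t v = op (gop hd) 0 v.
  by apply: hvP2 => k; rewrite hvDE hvNE !op_dg mulrBl.
apply: le_trans (op_nrm _ _ _) _; rewrite ler_wpM2r ?hn_ge0//.
apply: le_trans (nrm_gop hd (M := e / 2) _ _) _; first by rewrite divr_ge0// ltW.
  move=> q' n b b'; rewrite /dgm; case: eqP => _; first exact: st.
  by rewrite cabs0 divr_ge0// ltW.
by rewrite mulrC divfK.
Qed.

(** The eigenvalues of [c] move along arcs starting at 1. The commutation clause lets such a path be
    inserted without disturbing a projection that commutes with [c]. *)
Lemma unitary_path N c : (forall s, ev s c = c) -> unitary c -> supp N (c - 1) -> exists G,
  [/\ ucont G, clamped G, unitary G, supp N (G - 1) &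
   [/\ ev 0 G = 1, ev 1 G = c & forall d, (forall s, ev s d = d) -> c * d = d * c -> G * d = d * G]].
Proof.
move=> cc [c1 c2] sc; have cE := wop_wmat cc sc; set M := wmat N 0 c in cE.
have M1 : adj M *m M = 1%:M by apply: wop_inj; rewrite -wopM -wopS -cE c1 wop1.
have M2 : M *m adj M = 1%:M by apply: wop_inj; rewrite -wopM -wopS -cE c2 wop1.
have [|P [D [P1 P2 ME]]] := @spectral_unitary _ _ M; first by rewrite M1 M2.
pose V := wop P; have [V1 V2] : unitary V := wop_unitary P1 P2.
(* Outside the window the eigenvalue is 1, whose arc is constant. *)
pose lam k : C := if [pick i | iw i == k] is Some i then D 0 i else 1.
have lamw i : lam (iw i) = D 0 i.
  rewrite /lam; case: pickP => [j /eqP/iw_inj -> //|/(_ i)]; by rewrite eqxx.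
have D1 i : cabs (D 0 i) = 1.
  have : diag_mx D *m diag_mx (map_mx Num.conj D) = 1%:M.
    have DE : diag_mx D = P *m M *m adj P by rewrite ME !mulmxA P2 mul1mx -mulmxA P2 mulmx1.
    have -> : diag_mx (map_mx Num.conj D) = adj (diag_mx D).
      by apply/matrixP => p q; rewrite adjE !mxE eq_sym; case: eqP => [->|]; rewrite ?mulr1n// mulr0n rmorph0.
    rewrite DE !adjM adjK -!mulmxA (mulmxA (adj P) P) P1 mul1mx (mulmxA M) M2 mul1mx.
    exact: P2.
  move=> /matrixP/(_ i i); rewrite mulmx_diag !mxE eqxx !mulr1n => h.
  have : cabs (D 0 i) * cabs (D 0 i) = 1 by rewrite -{2}cabsJ -cabsM h cabs1.
  by move=> k; have := cabs_ge0 (D 0 i); nra.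
have lam1 k : cabs (lam k) = 1 by rewrite /lam; case: pickP => *; rewrite ?D1 ?cabs1.
have hG : bdm (dgm (fun t k => arc (lam k) t)).
  by apply: bdm_dgm; exists 1; split=> // t k; rewrite cabs_arc.
pose G0 := gop hG.
have dgE t v k : op G0 t v k = arc (lam k) t * v k by exact: op_dg.
have G0S t v k : op (star G0) t v k = (arc (lam k) t)^* * v k.
  rewrite (star_gop _ (bdm_adj hG)) op_gop /madj /dgm.
  by case: k => n [] /=; rewrite conjC0 mul0r ?addr0 ?add0r.
have uG : unitary G0.
  have aa l t : cabs l = 1 -> (arc l t)^* * arc l t = 1.
    move=> l1; have := cabs_arc t l1; rewrite mulrC -(normCK (arc l t)) normcE => ->.
    by rewrite expr1n.
  by split; apply: fam_eq => t v; apply: hvP2 => k; rewrite op_mul op_one ?G0S dgE ?G0S mulrA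
    1?[_ * _^*]mulrC aa// mul1r.
have ucG0 : ucont G0.
  apply: ucont_dg => e /arc_ucont[r r0 hr]; exists r => // s t st k; exact: hr.
have clG0 : clamped G0.
  by move=> t; apply: fam_eq => s v; apply: hvP2 => k; rewrite !op_ev !dgE arc_clamp.
have G00 : ev 0 G0 = 1.
  by apply: fam_eq => t v; apply: hvP2 => k; rewrite op_ev op_one dgE arc0 mul1r.
have G01 : ev 1 G0 = wop (diag_mx D).
  apply: fam_eq => t v; apply: hvP2 => k; rewrite op_ev dgE arc1// /wop !(op_add, op_opp, op_one).
  rewrite !(hvDE, hvNE) eN_E -codom_iw; have [[i ->]|hk] := @inw _ (@iw N) k.
    rewrite codom_f mul1r subrr addr0 (op_opm_w (@iw_inj N)) (bigD1 i)//= big1 ?addr0.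
      by rewrite !mxE eqxx mulr1n lamw.
    by move=> j ji; rewrite !mxE eq_sym (negbTE ji) mulr0n mul0r.
  have -> : lam k = 1 by rewrite /lam; case: pickP => // i /eqP/esym/hk.
  rewrite op_opm_out// add0r; case: codomP => [[i /hk]|]//; by rewrite mul1r mul0r subr0.
have sG0 : supp N (G0 - 1).
  apply: fam_eq => t v; apply: hvP2 => k.
  rewrite !op_mul eN_E !(op_add, op_opp, op_one) !(hvDE, hvNE) !dgE eN_E -codom_iw.
  have [[i ->]|hk] := @inw _ (@iw N) k; first by rewrite codom_f !mul1r.
  have -> : lam k = 1 by rewrite /lam; case: pickP => // i /eqP/esym/hk.
  by rewrite arc_1 !mul1r !subrr mulr0.
have eV : eN R N * V = V * eN R N.
  by rewrite /V /wop mulrDr mulrDl opm_eNl opm_eNr mulrBr mulrBl mulr1 mul1r.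
have eVS : eN R N * star V = star V * eN R N by rewrite -[eN R N]eN_sa -!starM eV.
have cV s : ev s V = V by exact: ev_wop.
have sU := csub_ucont R; have sL := csub_clamped R.
have uV : ucont V by move=> e e0; exists 1 => // s t _; rewrite !cV subrr nrm0 ltW.
have lV : clamped V by move=> t; rewrite !cV.
exists (star V * G0 * V); split.
- exact: (csM sU (csM sU (csS sU uV) ucG0) uV).
- exact: (csM sL (csM sL (csS sL lV) clG0) lV).
- exact: unitaryM (unitaryM (unitary_star (conj V1 V2)) uG) (conj V1 V2).
- have -> : star V * G0 * V - 1 = star V * (G0 - 1) * V.
    by rewrite -{1}V1; nring.
  rewrite /supp.
  have -> : eN R N * (star V * (G0 - 1) * V) * eN R N =
    (eN R N * star V) * (G0 - 1) * (V * eN R N) by nring.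
  rewrite eVS -eV; have -> : star V * eN R N * (G0 - 1) * (eN R N * V) =
    star V * (eN R N * (G0 - 1) * eN R N) * V by nring.
  by rewrite sG0.
- have E1 : ev 1 (star V * G0 * V) = c.
    by rewrite !evM evS cV G01 cE ME /V wopS !wopM.
  split=> //; first by rewrite !evM evS cV G00 mulr1 V1.
  move=> d cd cdc; pose d' := V * d * star V.
  have cL : ev 1 G0 = V * c * star V.
    rewrite -E1 !evM evS cV.
    have -> : V * (star V * ev 1 G0 * V) * star V = (V * star V) * ev 1 G0 * (V * star V) by nring.
    by rewrite V2 mulr1 mul1r.
  have Ld : ev 1 G0 * d' = d' * ev 1 G0.
    rewrite cL /d'.
    have -> : V * c * star V * (V * d * star V) = V * (c * (star V * V) * d) * star V by nring.
    have -> : V * d * star V * (V * c * star V) = V * (d * (star V * V) * c) * star V by nring.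
    by rewrite V1 !mulr1 cdc.
  (* A nonzero matrix entry of [b] forces the two eigenvalues concerned to coincide, hence also
     their arcs. *)
  have Gd b : ev 1 G0 * b = b * ev 1 G0 -> G0 * b = b * G0.
    move=> Lb.
    apply: op_ext => t k; apply: hvP2 => j; rewrite !op_mul dgE dg_be opZ hvZE.
    have := congr1 (fun x => op x t (be R k) j) Lb; rewrite !op_mul !op_ev dgE dg_be opZ hvZE !arc1//.
    case: (eqVneq (op b t (be R k) j) 0) => [->|n0]; first by rewrite !mulr0.
    by move=> /(mulIf n0) ->.
  have -> : star V * G0 * V * d = star V * (G0 * d') * V.
    rewrite /d'; have -> : star V * (G0 * (V * d * star V)) * V = star V * G0 * V * d * (star V * V) by nring.
    by rewrite V1 mulr1.
  rewrite Gd// /d'; have -> : star V * (V * d * star V * G0) * V = (star V * V) * d * star V * G0 * V by nring.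
  by rewrite V1 mul1r !mulrA.
Qed.
End Window.

(** * Nontrivial projections become equivalent under the endomorphism *)

Section Projections.
Variable R : realType.
Local Notation C := R[i].
Local Notation H := (hilb R).
Local Notation A := (fam R).
Implicit Types (a b p q x y : A) (t s : R) (k : idx).
Notation wmat N := (mat (@iw N)).

Section Half.
Variable N : nat.
Definition hw (c : bool) (n : 'I_N) : idx := (n : nat, c).
Lemma hw_inj c : injective (hw c). Proof. by move=> i j [] /val_inj. Qed.
(** The operator M (x) 1_2 on the window, extended by 0. *)
Definition hop (M : 'M[C]_N) : A := opm (hw false) M + opm (hw true) M.
Lemma hop_in M t (v : H) (i : 'I_N) c : op (hop M) t v (i : nat, c) = \sum_j M i j * v (j : nat, c).
Proof.
rewrite /hop op_add hvDE; case: c.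
  rewrite op_opm_out ?add0r; last by move=> j [].
  by rewrite -[(_, _)]/(hw true i) (op_opm_w (@hw_inj true)).
rewrite [X in _ + X]op_opm_out ?addr0; last by move=> j [].
by rewrite -[(_, _)]/(hw false i) (op_opm_w (@hw_inj false)).
Qed.
Lemma hop_out M t (v : H) k : ~~ (k.1 < N)%N -> op (hop M) t v k = 0.
Proof.
move=> kN; rewrite /hop op_add hvDE !op_opm_out ?addr0// => i ki;
  by move: kN; rewrite ki /= ltn_ord.
Qed.
Lemma hop_ext x (M : 'M[C]_N) : (forall t (v : H) (i : 'I_N) c, op x t v (i : nat, c) = \sum_j M i j * v (j : nat, c)) ->
  (forall t (v : H) k, ~~ (k.1 < N)%N -> op x t v k = 0) -> x = hop M.
Proof.
move=> h1 h2; apply: fam_eq => t v; apply: hvP2 => -[n c].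
have [nN|nN] := boolP (n < N)%N; last by rewrite h2// hop_out.
by rewrite -[n]/(nat_of_ord (Ordinal nN)) h1 hop_in.
Qed.
Lemma hopM M M' : hop M * hop M' = hop (M *m M').
Proof.
apply: hop_ext => [t v i c|t v k kN]; rewrite op_mul; last by rewrite hop_out.
rewrite hop_in; under eq_bigr do rewrite hop_in mulr_sumr.
rewrite exchange_big /=; apply: eq_bigr => j _; rewrite mxE mulr_suml.
by apply: eq_bigr => l _; rewrite mulrA.
Qed.
Lemma hopS M : star (hop M) = hop (adj M).
Proof. by rewrite /hop starD !opmS//; exact: hw_inj. Qed.
Lemma hop1 : hop 1%:M = eN R N.
Proof.
apply/esym/hop_ext => [t v i c|t v k kN]; rewrite eN_E; last by rewrite (negbTE kN) mul0r.
rewrite ltn_ord mul1r (bigD1 i)//= big1 ?addr0; first by rewrite mxE eqxx mul1r.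
by move=> j ji; rewrite mxE eq_sym (negbTE ji) mul0r.
Qed.
Lemma ev_hop s M : ev s (hop M) = hop M.
Proof. by rewrite /hop evD !ev_opm//; exact: hw_inj. Qed.
Lemma dbl_hop M : dbl (hop M).
Proof.
split=> /=; apply: fam_eq => t v; apply: hvP2 => -[n c]; rewrite !op_mul ?Xop_E ?Zop_E /swap /=.
  have [nN|nN] := boolP (n < N)%N; last by rewrite !hop_out.
  rewrite -[n]/(nat_of_ord (Ordinal nN)) !hop_in; apply: eq_bigr => j _.
  by rewrite Xop_E.
have [nN|nN] := boolP (n < N)%N; last by rewrite !hop_out ?mulr0.
rewrite -[n]/(nat_of_ord (Ordinal nN)) !hop_in mulr_sumr; apply: eq_bigr => j _.
by rewrite Zop_E /= mulrCA.
Qed.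
Lemma mat_hop M : mat (hw false) 0 (hop M) = M.
Proof.
apply/matrixP => i j; rewrite mxE hop_in (bigD1 j)//= big1 ?addr0.
  by rewrite beE eqxx mulr1.
by move=> l lj; rewrite beE xpair_eqE (inj_eq val_inj) (negbTE lj) mulr0.
Qed.
Lemma hop_inj M M' : hop M = hop M' -> M = M'.
Proof. by move=> h; rewrite -(mat_hop M) h mat_hop. Qed.
(** Commuting with [Zop] kills the entries between different booleans; commuting with [Xop]
    identifies the two remaining blocks. *)
Lemma dbl_supp a : (forall s, ev s a = a) -> dbl a -> supp N a -> a = hop (mat (hw false) 0 a).
Proof.
move=> ca [hX hZ] sa; apply: op_ext => t k; apply: hvP2 => j.
have in0 (k' : idx) : ~~ (k'.1 < N)%N -> op a t (be R k') = 0.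
  by move=> kN; rewrite -(suppr sa) op_mul eN_be (negbTE kN) scale0r op0.
have [kN|kN] := boolP (k.1 < N)%N; last first.
  rewrite in0// hv0E; have [jN|jN] := boolP (j.1 < N)%N; last by rewrite hop_out.
  case: j jN => n c jN; rewrite -[n]/(nat_of_ord (Ordinal jN)) hop_in big1// => l _.
  rewrite beE; case: eqP => [E|]; last by rewrite mulr0.
  by move: kN; rewrite -E /= ltn_ord.
have [jN|jN] := boolP (j.1 < N)%N; last first.
  by rewrite hop_out// -(suppl sa) op_mul eN_E (negbTE jN) mul0r.
case: j jN => n c jN; case: k kN => n' c' kN.
rewrite -[n]/(nat_of_ord (Ordinal jN)) hop_in (bigD1 (Ordinal kN))//= big1 ?addr0; last first.
  move=> l /eqP ln; rewrite beE xpair_eqE; case: eqP => [E|]; last by rewrite mulr0.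
  by case: ln; apply: val_inj.
rewrite beE xpair_eqE eqxx mxE /=.
have ct : op a 0 = op a t.
  by apply/funext => v; rewrite -[in LHS](ca t) op_ev.
rewrite ct /hw /=.
have Z := congr1 (fun x => op x t (be R (n', c')) (n, c)) hZ.
have X := congr1 (fun x => op x t (be R (n', false)) (n, true)) hX.
move: Z X; rewrite !op_mul !Xop_E !Zop_E Zop_be opZ hvZE Sop_be /swap /=.
clear jN kN; case: c; case: c' => /=; rewrite ?mulr1 ?mulr0 ?mul1r ?mulN1r //.
- by move=> /eqP; rewrite -subr_eq0 opprK -mulr2n mulrn_eq0 /= => /eqP.
- by move=> /esym/eqP; rewrite -subr_eq0 opprK -mulr2n mulrn_eq0 /= => /eqP.
Qed.
Lemma tr_hop M : \tr (wmat N 0 (hop M)) = \tr M + \tr M.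
Proof.
rewrite {1}/mxtrace big_split_ord /=; congr (_ + _); apply: eq_bigr => i _; rewrite mxE ?iwl ?iwr hop_in.
  rewrite (bigD1 i)//= big1 ?addr0; first by rewrite beE eqxx mulr1.
  by move=> l li; rewrite beE xpair_eqE (inj_eq val_inj) (negbTE li) mulr0.
rewrite (bigD1 i)//= big1 ?addr0; first by rewrite beE eqxx mulr1.
by move=> l li; rewrite beE xpair_eqE (inj_eq val_inj) (negbTE li) mulr0.
Qed.
End Half.

Lemma supp_wmat N a : (forall s, ev s a = a) -> supp N a -> a = opm (@iw N) (wmat N 0 a).
Proof. by move=> ca sa; rewrite opm_mat ?opm_iw1//; exact: iw_inj. Qed.

(** Conjugation by [u] makes the traces of p and d in the window agree. Both are twice the traces of
    the halves, so the halves have equal trace and [projection_equiv] conjugates them; doubling that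
    unitary gives [Q]. *)
Lemma doubled_unitary N p d u :
  (forall s, ev s p = p) -> (forall s, ev s d = d) -> (forall s, ev s u = u) ->
  dbl p -> dbl d -> projection p -> projection d -> unitary u ->
  eN R N * d = d * eN R N -> supp N (p - d) -> supp N (u - 1) -> u * d = p * u ->
  exists Q, [/\ forall s, ev s Q = Q, dbl Q, unitary Q, supp N (Q - 1) & Q * d = p * Q].
Proof.
move=> cp cd cu dp dd [sp pp] [sd dd2] [u1 u2] ed spd su ud; set e := eN R N in ed *.
have ee : e * e = e := eN_id R N; have se : star e = e := eN_sa R N.
have comm1 x : supp N x -> e * x = x * e by move=> h; rewrite (suppl h) (suppr h).
have ep : e * p = p * e.
  by rewrite -[p](subrK d) mulrDr mulrDl ed (comm1 _ spd).
have eu : e * u = u * e.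
  by rewrite -[u](subrK 1) mulrDr mulrDl mulr1 mul1r (comm1 _ su).
have sE x : e * x = x * e -> supp N (x * e).
  move=> h; rewrite /supp -/e; have -> : e * (x * e) * e = e * x * (e * e) by nring.
  by rewrite ee h -mulrA ee.
have cE x : (forall s, ev s x = x) -> forall s, ev s (x * e) = x * e.
  by move=> h s; rewrite evM h ev_eN.
have mE x : (forall s, ev s x = x) -> e * x = x * e -> opm (@iw N) (wmat N 0 (x * e)) = x * e.
  by move=> cx hx; rewrite -supp_wmat//; [exact: cE|exact: sE].
have de x : dbl x -> dbl (x * e).
  move=> dx; rewrite /e -hop1; exact: (csM (csub_dbl R) dx (dbl_hop _)).
have hE x : (forall s, ev s x = x) -> dbl x -> e * x = x * e ->
    hop (mat (@hw N false) 0 (x * e)) = x * e.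
  by move=> cx dx hx; rewrite -dbl_supp//; [exact: cE|exact: de|exact: sE].
have tr : \tr (wmat N 0 (p * e)) = \tr (wmat N 0 (d * e)).
  have iw1 := @iw_inj N.
  have M1 : wmat N 0 (u * e) *m adj (wmat N 0 (u * e)) = 1%:M.
    apply: (opm_inj iw1); rewrite -opmM// -opmS// mE// opm_iw1 starM se.
    have -> : u * e * (e * star u) = u * (e * e) * star u by nring.
    by rewrite ee -eu -mulrA u2 mulr1.
  have M1' := mulmx1C M1.
  have M2 : wmat N 0 (u * e) *m wmat N 0 (d * e) = wmat N 0 (p * e) *m wmat N 0 (u * e).
    apply: (opm_inj iw1); rewrite -!opmM// !mE//.
    have -> : u * e * (d * e) = u * (e * d) * e by nring.
    have -> : p * e * (u * e) = p * (e * u) * e by nring.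
    by rewrite ed eu !mulrA ud.
  rewrite -[wmat N 0 (p * e)]mulmx1 -M1 mulmxA -M2 -mulmxA mxtrace_mulC -mulmxA M1' mulmx1.
  by [].
set Mp := mat (@hw N false) 0 (p * e); set Md := mat (@hw N false) 0 (d * e).
have hp : hop Mp = p * e by exact: hE.
have hd : hop Md = d * e by exact: hE.
have trM : \tr Mp = \tr Md.
  move: tr; rewrite -hp -hd !tr_hop -!mulr2n => /eqP; rewrite eqr_pMn2r// => /eqP.
  by [].
have idem x (M : 'M[C]_N) : hop M = x * e -> star x = x -> x * x = x -> e * x = x * e -> adj M = M /\ M *m M = M.
  move=> hM sx xx ex; split; apply: hop_inj.
    by rewrite -hopS hM starM se sx ex.
  rewrite -hopM hM; have -> : x * e * (x * e) = x * (e * x) * e by nring.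
  by rewrite ex mulrA xx -mulrA ee.
have [ap ip] := idem p Mp hp sp pp ep; have [ad' id'] := idem d Md hd sd dd2 (ed).
have [V [V1 V2 VM]] := projection_equiv ad' id' ap ip (esym trM).
have VM' : V *m Md = Mp *m V by rewrite -VM -[RHS]mulmxA V1 mulmx1.
have eV (M : 'M[C]_N) : e * hop M = hop M by rewrite /e -hop1 hopM mul1mx.
have Ve (M : 'M[C]_N) : hop M * e = hop M by rewrite /e -hop1 hopM mulmx1.
exists (hop V + (1 - e)); split.
- by move=> s; rewrite evD evB ev1 ev_eN ev_hop.
- have sB := csub_dbl R; apply: (csD sB (dbl_hop _)).
  by rewrite /e -hop1; exact: (csB sB (cs1 sB) (dbl_hop _)).
- have k (X Y : 'M[C]_N) : (hop X + (1 - e)) * (hop Y + (1 - e)) = hop (X *m Y) + (1 - e).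
    have -> : (hop X + (1 - e)) * (hop Y + (1 - e)) = hop X * hop Y + (hop X - hop X * e)
      + (hop Y - e * hop Y) + (1 - e - e + e * e) by nring.
    by rewrite Ve eV ee !subrr !addr0 hopM subrK.
  by split; rewrite starD star_sub star_one se hopS k ?V1 ?V2 hop1 addrC subrK.
- have -> : hop V + (1 - e) - 1 = hop V - e by nring.
  by rewrite /supp -/e mulrBr mulrBl eV Ve !ee.
- have spd' : d - d * e = p - p * e.
    have := suppr spd; rewrite -/e mulrBl => h.
    have -> : p - p * e = d - d * e + ((p - d) - (p * e - d * e)) by nring.
    by rewrite h subrr addr0.
  have -> : (hop V + (1 - e)) * d = hop V * d + (d - e * d) by nring.
  have -> : p * (hop V + (1 - e)) = p * hop V + (p - p * e) by nring.
  rewrite ed spd' -{1}(Ve V) -{2}(eV V).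
  have -> : hop V * e * d = hop V * (e * d) by nring.
  have -> : p * (e * hop V) = (p * e) * hop V by nring.
  by rewrite ed -hd -hp !hopM VM'.
Qed.

Lemma ev_ext x y : (forall t, ev t x = ev t y) -> x = y.
Proof. by move=> h; apply: fam_eq => t v; rewrite -(op_ev t x t) h op_ev. Qed.

Section Reparam.
Variable f : R -> R.
Definition rpm_def a : A.
apply: (@Fam _ (fun t => op a (f t)) (fun t => ad a (f t))) => [t x y|t c x|t x y|].
- exact: opD.
- exact: opZ.
- exact: op_ad.
- by have [M [M0 hM]] := op_bd a; exists M.
Defined.
Definition rpm := locked_with lock_key rpm_def.
Lemma ev_rpm s a : ev s (rpm a) = ev (f s) a.
Proof. by apply: fam_eq => t v; rewrite !op_ev /rpm locked_withE. Qed.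
Lemma projection_rpm p : projection p -> projection (rpm p).
Proof.
move=> [sp pp]; split; apply: ev_ext => t; first by rewrite evS !ev_rpm -evS sp.
by rewrite evM !ev_rpm -evM pp.
Qed.
End Reparam.

(** The path is stopped at the times k r, where r is chosen so that successive stopped paths differ
    by at most 1/2; the unitaries of [near_projections] are multiplied up. The last clause later
    confines [U] to the window in which p moves. *)
Lemma path_lifting p : ucont p -> clamped p -> projection p -> exists U,
  [/\ ucont U, clamped U, unitary U, U * ev 0 p = p * U & ev 0 U = 1 /\
    forall v, (forall s, op p s v = op p 0 v) -> forall t, op U t v = v].
Proof.
move=> up cp prp; have [r r0 hr] := up _ (divr_gt0 ltr01 (ltr0Sn R 1)).
pose f (k : nat) t := Num.min (k%:R * r) (clamp t).
have fbd (k : nat) t s : `|f k t - f k s| <= `|t - s|.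
  apply: le_trans (clamp_lip t s); rewrite /f !minEle.
  by case: (leP (k%:R * r) (clamp t)) => h1; case: (leP (k%:R * r) (clamp s)) => h2;
    rewrite ?subrr ?normr0// ler_norml; case: (ler0P (clamp t - clamp s)) => h3; apply/andP; split; lra.
have uk (k : nat) : ucont (rpm (f k) p).
  by move=> e /up[q q0 hq]; exists q => // s t st; rewrite !ev_rpm hq// (le_trans (fbd _ _ _)).
have ck (k : nat) : clamped (rpm (f k) p) by move=> t; rewrite !ev_rpm /f clampK.
suff ind (k : nat) : exists U,
  [/\ ucont U, clamped U, unitary U, U * ev 0 p = rpm (f k) p * U & ev 0 U = 1 /\
    forall v, (forall s, op p s v = op p 0 v) -> forall t, op U t v = v].
  pose k := Num.bound (r^-1).
  have kr : 1 <= k%:R * r.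
    rewrite -ler_pdivrMr// mul1r ltW// /k; apply: archi_boundP.
    by rewrite invr_ge0 ltW.
  have [U [h1 h2 h3 h4 [h5 h6]]] := ind k; exists U; split=> //.
  rewrite h4; congr (_ * _); apply: ev_ext => t; rewrite ev_rpm [RHS]cp.
  by congr (ev _ p); rewrite /f; apply/min_idPr; apply: le_trans (clamp_le1 _) kr.
elim: k => [|k [U [h1 h2 h3 h4 [h5 h6]]]].
  exists 1; split.
  - exact: cs1 (csub_ucont R).
  - exact: cs1 (csub_clamped R).
  - by split; rewrite star_one mulr1.
  - rewrite mul1r mulr1; apply: ev_ext => t; rewrite ev_ev ev_rpm /f mul0r.
    by rewrite (min_idPl (clamp_ge0 t)).
  - by split=> [|v _ t]; rewrite ?ev1 ?op_one.
have [|u [uu ukk uB uf]] := near_projections (projection_rpm (f k) prp) (projection_rpm (f k.+1) prp).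
  apply: nrm_evP => [|t]; first by rewrite invr_ge0.
  rewrite evB !ev_rpm -[2^-1]mul1r; apply: hr.
  have kk : k.+1%:R * r = k%:R * r + r by rewrite -addn1 natrD mulrDl mul1r.
  rewrite /f kk !minEle.
  by case: (leP (k%:R * r) (clamp t)) => ha; case: (leP (k%:R * r + r) (clamp t)) => hb;
    rewrite ler_norml; apply/andP; split; lra.
exists (u * U); split.
- exact: (csM (csub_ucont R) (uB _ (csub_ucont R) (uk k) (uk k.+1)) h1).
- exact: (csM (csub_clamped R) (uB _ (csub_clamped R) (ck k) (ck k.+1)) h2).
- exact: unitaryM.
- by rewrite -mulrA h4 mulrA ukk mulrA.
have opr (q : nat) t v : op (rpm (f q) p) t v = op p (f q t) v by rewrite -(op_ev t _ t) ev_rpm op_ev.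
split.
  rewrite evM h5 mulr1; apply: fam_eq => t v; rewrite op_ev op_one; apply: uf.
  have f0 (q : nat) : f q 0 = 0 by rewrite /f clamp0; apply/min_idPr; rewrite mulr_ge0// ltW.
  by rewrite !opr !f0.
by move=> v hv t; rewrite op_mul h6// uf// !opr !hv.
Qed.

Definition half (c : bool) (i : idx) : idx := (c + i.1.*2, i.2)%N.
Lemma half_inj c : injective (half c).
Proof. by move=> [n b] [n' b'] [/addnI/double_inj -> ->]. Qed.
Definition hs c : A := Sop R (@half_inj c).
(** The reference projection onto the even indices: constant, doubled, and of infinite rank and
    corank. *)
Definition dd : A := locked_with lock_key (hs false * star (hs false)).
Lemma ddE : dd = hs false * star (hs false). Proof. by rewrite /dd locked_withE. Qed.
Lemma hs_iso c : star (hs c) * hs c = 1. Proof. exact: Sop_star_mul. Qed.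
Lemma odd_half c i : odd (half c i).1 = c.
Proof. by rewrite /half oddD odd_double addbF oddb. Qed.
Lemma half_odd i : half (odd i.1) (i.1./2, i.2) = i.
Proof. by case: i => n b; rewrite /half odd_double_half. Qed.
Lemma hs_orth : star (hs false) * hs true = 0.
Proof.
by apply: Sop_orth => i j /(congr1 (fun k => odd k.1)); rewrite !odd_half.
Qed.
Lemma hs_be c i t : op (hs c * star (hs c)) t (be R i) = (odd i.1 == c)%:R *: be R i.
Proof.
rewrite op_mul; case: (eqVneq (odd i.1) c) => [<-|nc].
  have := starS_be (@half_inj (odd i.1)) t (i.1./2, i.2); rewrite half_odd => ->.
  by rewrite Sop_be half_odd scale1r.
rewrite starS_be0 ?op0 ?scale0r// => j /(congr1 (fun k => odd k.1)).
by rewrite odd_half => e; rewrite e eqxx in nc.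
Qed.
Lemma hs_sum : dd + hs true * star (hs true) = 1.
Proof.
apply: op_ext => t i; rewrite op_add op_one ddE !hs_be; case: (odd i.1) => /=.
  by rewrite scale0r scale1r add0r.
by rewrite scale0r scale1r addr0.
Qed.
Lemma ev_hs c s : ev s (hs c) = hs c. Proof. exact: ev_Sop. Qed.
Lemma dbl_hs c : dbl (hs c).
Proof. exact: (@dbl_Sop _ (fun n => c + n.*2)%N). Qed.
Lemma ev_dd s : ev s dd = dd. Proof. by rewrite ddE evM evS ev_hs. Qed.
Lemma dbl_dd : dbl dd.
Proof. have sB := csub_dbl R; rewrite ddE; exact: (csM sB (dbl_hs _) (csS sB (dbl_hs _))). Qed.
Lemma projection_dd : projection dd.
Proof.
split; first by rewrite ddE starM starK.
have -> : dd * dd = hs false * (star (hs false) * hs false) * star (hs false) by rewrite ddE; nring.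
by rewrite hs_iso mulr1 -ddE.
Qed.
Lemma eN_dd N : eN R N * dd = dd * eN R N.
Proof.
apply: op_ext => t i; rewrite [LHS]op_mul [RHS]op_mul eN_be ddE hs_be !opZ hs_be eN_be.
by rewrite !scalerA mulrC.
Qed.

Lemma dd_eigen t i : op dd t (be R i) = 0 \/ op dd t (be R i) = be R i.
Proof. by rewrite ddE hs_be; case: eqP => _; rewrite ?scale0r ?scale1r; [right|left]. Qed.

Lemma nrm_projection p : projection p -> p <> 0 -> nrm p = 1.
Proof.
move=> [sp pp] p0; have := nrm_cstar p; rewrite sp pp => h.
have n0 : nrm p != 0 by apply/eqP => /nrm0_eq0.
by apply: (mulIf n0); rewrite mul1r -expr2.
Qed.

Lemma star_window N a b : star a = a -> star b = b ->
  star (a + eN R N * (b - a) * eN R N) = a + eN R N * (b - a) * eN R N.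
Proof. by move=> ha hb; rewrite starD !starM star_sub eN_sa ha hb mulrA. Qed.
Lemma ev_window s N a b :
  ev s (a + eN R N * (b - a) * eN R N) = ev s a + eN R N * (ev s b - ev s a) * eN R N.
Proof. by rewrite evD !evM evB ev_eN. Qed.

(** A nonzero projection has norm 1 > 1/2, so [isometry_corner] compresses [theta p] to 1. At t = 0
    this gives a doubled isometry with range below that of theta(p)(0), and [absorbing_projection]
    enlarges its range to the whole. *)
Lemma absorbed p : MM p -> projection p -> p <> 0 -> exists W,
  [/\ star W * W = 1, W * star W = ev 0 (theta p), forall s, ev s W = W & dbl W].
Proof.
move=> hp prp p0; have [sp pp] := prp; have [[up cp] _] := hp.
have [||Y [hY YY _]] := @isometry_corner _ p (2^-1) up cp; first by rewrite invr_gt0.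
  by rewrite nrm_projection// invf_lt1 ?ltr1n.
rewrite sp pp in YY; set P := ev 0 (theta p).
have thp : projection (theta p) by split; rewrite -?theta_star ?sp// -thetaM pp.
have PP : projection P by split; rewrite -?evS -?evM ?thp.1 ?thp.2.
pose S := P * ev 0 Y; have dbl0 x : MM x -> dbl (ev 0 x) by case=> _ [[]].
have dP : dbl P := dbl0 _ (MM_theta hp).
have dS : dbl S := csM (csub_dbl R) dP (dbl0 _ hY).
have SS : star S * S = 1.
  have -> : star S * S = star (ev 0 Y) * (star P * P) * ev 0 Y by rewrite /S starM; nring.
  by rewrite PP.1 PP.2 -evS -!evM YY ev1.
have PS : P * S = S by rewrite /S mulrA PP.2.
have [W [W1 W2 W3 W4]] := absorbing_projection PP SS PS (fun s => ev_ev s 0 _) (fun s => ltac:(by rewrite /S evM !ev_ev)).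
exists W; split=> //.
have dSs : dbl (star S) := csS (csub_dbl R) dS.
case: dP => ? ?; case: dS => ? ?; case: dSs => ? ?.
by split=> /=; apply: W4.
Qed.

Lemma theta_projection p : MM p -> projection p -> p <> 0 -> p <> 1 -> ueq (@MM R) (theta p) dd.
Proof.
move=> hp prp p0 p1; have sM := csub_MM R; have [sp pp] := prp.
have hq : MM (1 - p) := csB sM (cs1 sM) hp.
have prq := projectionB prp.
have [W [W1 W2 W3 W4]] := absorbed hp prp p0.
have [|W' [W'1 W'2 W'3 W'4]] := absorbed hq prq.
  by move/eqP; rewrite subr_eq0 => /eqP/esym.
rewrite thetaB theta1 evB ev1 in W'2.
set P := ev 0 (theta p) in W2 W'2.
have PP : P * P = P by rewrite /P -evM -thetaM pp.
have WW' : star W * W' = 0.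
  have -> : star W * W' = (star W * W) * star W * (W' * (star W' * W')) by rewrite W1 W'1 mul1r mulr1.
  have -> : star W * W * star W * (W' * (star W' * W')) = star W * (W * star W) * (W' * star W') * W' by nring.
  rewrite W2 W'2; have -> : star W * P * (1 - P) * W' = star W * (P - P * P) * W' by nring.
  by rewrite PP subrr mulr0 mul0r.
have W'W : star W' * W = 0 by rewrite -[W]starK -starM WW' star0A.
(* Glueing the isometries onto the ranges of P and 1 - P along the even and odd halves gives a
   constant doubled unitary that carries [dd] to P. *)
pose w := W * star (hs false) + W' * star (hs true).
have sw : star w = hs false * star W + hs true * star W' by rewrite /w starD !starM !starK.
have ho : star (hs true) * hs false = 0 by rewrite -[hs false]starK -starM hs_orth star0A.
have w1 : star w * w = 1.
  have -> : star w * w = hs false * (star W * W) * star (hs false) + hs true * (star W' * W') * star (hs true)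
    + hs false * (star W * W') * star (hs true) + hs true * (star W' * W) * star (hs false).
    by rewrite sw /w; nring.
  by rewrite W1 W'1 WW' W'W !mulr0 !mul0r !addr0 !mulr1 -ddE hs_sum.
have w2 : w * star w = 1.
  have -> : w * star w = W * (star (hs false) * hs false) * star W + W' * (star (hs true) * hs true) * star W'
    + W * (star (hs false) * hs true) * star W' + W' * (star (hs true) * hs false) * star W.
    by rewrite sw /w; nring.
  by rewrite !hs_iso hs_orth ho !mulr0 !mul0r !addr0 !mulr1 W2 W'2 addrC subrK.
have cw s : ev s w = w by rewrite /w evD !evM !evS !ev_hs W3 W'3.
have sD := csub_dbl R.
have dw : dbl w.
  exact: (csD sD (csM sD W4 (csS sD (dbl_hs _))) (csM sD W'4 (csS sD (dbl_hs _)))).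
have hw : MM w := MM_const cw dw.
have hth := MM_theta hp.
pose q := star w * theta p * w.
have hqM : MM q := csM sM (csM sM (csS sM hw) hth) hw.
have prth : projection (theta p) by split; rewrite -?theta_star ?sp// -thetaM pp.
have prq' : projection q.
  split; first by rewrite /q !starM starK prth.1 mulrA.
  have -> : q * q = star w * theta p * (w * star w) * theta p * w by rewrite /q; nring.
  by rewrite w2 mulr1 -[_ * theta p * theta p]mulrA prth.2.
have q0 : ev 0 q = dd.
  have -> : ev 0 q = star w * P * w by rewrite /q !evM evS !cw.
  rewrite -W2; have -> : star w * (W * star W) * w = (star w * W) * (star W * w) by nring.
  have -> : star W * w = star (hs false).
    have -> : star W * w = star W * W * star (hs false) + star W * W' * star (hs true) by rewrite /w; nring.
    by rewrite W1 WW' mul1r mul0r addr0.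
  have -> : star w * W = hs false.
    have -> : star w * W = hs false * (star W * W) + hs true * (star W' * W) by rewrite sw; nring.
    by rewrite W1 W'W mulr1 mulr0 addr0.
  by rewrite ddE.
apply: (@ueq_trans _ _ _ q) => //.
  by exists (star w); rewrite starK; split=> //; [exact: (csS sM hw)|exact: (unitary_star (conj w1 w2))].
have [[uq cq] [[kq _] _]] := hqM; rewrite /kpath /= q0 in kq.
(* With 1/200 the self-adjoint x below satisfies |x^2 - x| <= 1/50 < 1/8, and the projection near it
   is within 8/50 of x, hence within 1/2 of q. *)
have [N hN] := kq _ (divr_gt0 ltr01 (ltr0Sn R 199)).
pose x := dd + eN R N * (q - dd) * eN R N.
have sx : star x = x.
  exact: (star_window N projection_dd.1 prq'.1).
have nx : nrm (q - x) <= 1 / 200.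
  by have -> : q - x = q - dd - eN R N * (q - dd) * eN R N by rewrite /x; nring.
have q1 : nrm q <= 1.
  have := nrm_cstar q; rewrite prq'.1 prq'.2 => h; have := nrm_ge0 q; nra.
have nxx : nrm (x * x - x) <= 1 / 50.
  have -> : x * x - x = (x - q) * (x - q) + q * (x - q) + (x - q) * q - (x - q) + (q * q - q) by nring.
  rewrite prq'.2 subrr addr0; have h1 := nrmM (x - q) (x - q); have h2 := nrmM q (x - q).
  have h3 := nrmM (x - q) q; apply: le_trans (nrmB _ _) _.
  have h4 := nrmD ((x - q) * (x - q) + q * (x - q)) ((x - q) * q).
  have h5 := nrmD ((x - q) * (x - q)) (q * (x - q)).
  rewrite nrmBC in nx; have := nrm_ge0 (x - q); have := nrm_ge0 q.
  move: h1 h2 h3 h4 h5 q1 nx; clear; gen_norms; nra.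
have [|p2 [pr2 np2 B2 e2]] := near_projection sx; first by apply: le_trans nxx _; lra.
have Mdd : MM dd := MM_const ev_dd dbl_dd.
have ex0 : ev 0 x = dd by rewrite /x ev_window q0 ev_dd subrr mulr0 mul0r addr0.
have ux : ucont x.
  have sU := csub_ucont R; have ue : ucont (eN R N).
    by move=> e e0; exists 1 => // s t _; rewrite !ev_eN subrr nrm0 ltW.
  have [[ud _] _] := Mdd.
  exact: (csD sU ud (csM sU (csM sU ue (csB sU uq ud)) ue)).
have dblx s : dbl (ev s q) -> dbl (ev s x).
  move=> dq; rewrite /x ev_window ev_dd.
  have de : dbl (eN R N) by rewrite -hop1; exact: dbl_hop.
  exact: (csD sD dbl_dd (csM sD (csM sD de (csB sD dq dbl_dd)) de)).
have cx : clamped x.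
  by move=> t; rewrite /x !ev_window !ev_dd cq.
(* Outside the window and at t = 0, x acts on basis vectors as [dd] does, with eigenvalue 0 or 1;
   [near_projection] preserves such eigenvectors. So p2 differs from [dd] only in the window and
   starts at [dd]. *)
have fix0 t i : (N <= i.1)%N \/ t = 0 -> op p2 t (be R i) = op dd 0 (be R i).
  move=> h; have E : op x t (be R i) = op dd 0 (be R i).
    case: h => [Ni|->]; last by rewrite -(op_ev 0 x 0) ex0.
    rewrite /x op_add !op_mul eN_be ltnNge Ni scale0r !op0 addr0.
    by rewrite -[in LHS](ev_dd 0) op_ev.
  have [h0 h1] := e2 t (be R i); case: (dd_eigen 0 i) => d0.
    by rewrite d0 h0// E d0.
  by rewrite d0 h1// E d0.
have ep0 : ev 0 p2 = dd.
  by apply: op_ext => t i; rewrite op_ev fix0; [rewrite -[in RHS](ev_dd 0) op_ev|right].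
have out x' : (forall t i, (N <= i.1)%N -> op x' t (be R i) = 0) -> x' * eN R N = x'.
  move=> h; apply: op_ext => t i; rewrite op_mul eN_be; case: (ltnP i.1 N) => iN.
    by rewrite scale1r.
  by rewrite scale0r op0 h.
have spd : supp N (p2 - dd).
  have h : (p2 - dd) * eN R N = p2 - dd.
    apply: out => t i iN; rewrite op_add op_opp fix0; last by left.
    by rewrite -[X in _ - op X _ _](ev_dd 0) op_ev subrr.
  have sy : star (p2 - dd) = p2 - dd by rewrite star_sub pr2.1 projection_dd.1.
  rewrite /supp.
  have -> : eN R N * (p2 - dd) * eN R N = eN R N * ((p2 - dd) * eN R N) by nring.
  rewrite h; have := congr1 star h; rewrite starM eN_sa sy.
  exact.
(* [U] carries [dd] to p2, but its end point need not be doubled. A doubled Q does the same at t =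
   1, and [U] is corrected by a path G from 1 to U(1)^-1 Q. That unitary commutes with [dd], so G
   can be chosen to commute with it throughout. *)
have [U [uU cU prU Ud [U0 Uv]]] := path_lifting (B2 _ (csub_ucont R) ux) (B2 _ (csub_clamped R) cx) pr2.
rewrite ep0 in Ud.
have sU : supp N (U - 1).
  have h : (U - 1) * eN R N = U - 1.
    apply: out => t i iN; rewrite op_add op_opp op_one Uv ?subrr// => s.
    by rewrite !fix0//; left.
  have h' : (star U - 1) * eN R N = star U - 1.
    apply: out => t i iN; rewrite op_add op_opp op_one.
    have Ui : op U t (be R i) = be R i by apply: Uv => s; rewrite !fix0//; left.
    by rewrite -{1}Ui -op_mul prU.1 op_one subrr.
  rewrite /supp -mulrA h -[LHS]starK starM eN_sa star_sub star_one h' star_sub starK star_one.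
  by [].
have cst s x' : ev s (ev 1 x') = ev 1 x' by rewrite ev_ev.
have dp1 : dbl (ev 1 p2).
  have := B2 _ (csub_ev 1 sD) _; apply; apply: dblx; by case: hqM => _ [].
have suppE x' : supp N x' -> supp N (ev 1 x') by rewrite /supp => h; rewrite -{2}h !evM ev_eN.
have [|||||Q [cQ dQ uQ sQ Qd]] := @doubled_unitary N (ev 1 p2) dd (ev 1 U) (cst^~ p2) ev_dd (cst^~ U) dp1 dbl_dd _ projection_dd _ (eN_dd N).
- by case: pr2 => h1 h2; split; rewrite -?evS -?evM ?h1 ?h2.
- by case: prU => h1 h2; split; rewrite -evS -evM ?h1 ?h2 ev1.
- by rewrite -(ev_dd 1) -evB; exact: suppE.
- by rewrite -(ev1 (1 : R)) -evB; exact: suppE.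
- by rewrite -{1}(ev_dd 1) -!evM Ud.
pose U1 := ev 1 U; have [U11 U12] : unitary U1.
  by case: prU => h1 h2; split; rewrite -evS -evM ?h1 ?h2 ev1.
have sU1 : supp N (U1 - 1) by rewrite -(ev1 (1 : R)) -evB; exact: suppE.
have sN1 a b : supp N (a - 1) -> supp N (b - 1) -> supp N (a * b - 1).
  move=> ha hb; have -> : a * b - 1 = (a - 1) * (b - 1) + (a - 1) + (b - 1) by nring.
  exact: suppD (suppD (suppM ha hb) ha) hb.
have [|||G [uG cG prG sG [G0 G1 Gd]]] := @unitary_path R N (star U1 * Q).
- by move=> s; rewrite evM evS cst cQ.
- exact: unitaryM (unitary_star (conj U11 U12)) uQ.
- by apply: sN1 => //; rewrite -star_one -star_sub; exact: suppS.
have GD : G * dd = dd * G.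
  apply: Gd ev_dd _.
  rewrite -mulrA Qd !mulrA; congr (_ * _).
  have h : U1 * dd = ev 1 p2 * U1 by rewrite /U1 -{1}(ev_dd 1) -!evM Ud.
  have -> : star U1 * ev 1 p2 = star U1 * ev 1 p2 * (U1 * star U1) by rewrite U12 mulr1.
  have -> : star U1 * ev 1 p2 * (U1 * star U1) = star U1 * (ev 1 p2 * U1) * star U1 by nring.
  rewrite -h; have -> : star U1 * (U1 * dd) * star U1 = (star U1 * U1) * dd * star U1 by nring.
  by rewrite U11 mul1r.
have hUG : MM (U * G).
  split; split.
  - exact: (csM (csub_ucont R) uU uG).
  - exact: (csM (csub_clamped R) cU cG).
  - split; rewrite /kpath /= evM U0 G0 mulr1; last by exact: cs1 sD.
    exact: KK_supp (sN1 _ _ sU sG).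
  - rewrite /= evM G1 mulrA -/U1 U12 mul1r.
    by [].
have Mp2 : MM p2.
  split; split.
  - exact: B2 (csub_ucont R) ux.
  - exact: B2 (csub_clamped R) cx.
  - split; rewrite /kpath /= ep0; last exact: dbl_dd.
    exact: KK_supp spd.
  - exact: dp1.
apply: (@ueq_trans _ _ _ p2) => //.
  apply: near_ueq => //; have -> : q - p2 = (q - x) - (p2 - x) by nring.
  apply: le_trans (nrmB _ _) _; move: nx np2 nxx; clear; gen_norms; lra.
apply: ueq_sym => //; exists (U * G); split=> //; first exact: unitaryM.
have -> : U * G * dd * star (U * G) = U * (G * dd) * star G * star U by rewrite starM; nring.
rewrite GD; have -> : U * (dd * G) * star G * star U = (U * dd) * (G * star G) * star U by nring.
by rewrite prG.2 mulr1 Ud -mulrA prU.2 mulr1.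
Qed.
End Projections.

(** * The determinant obstruction *)

Section Determinants.
Variable C : numClosedFieldType.
(** Sylvester's identity: multiplying the block matrix Z by a unipotent one on either side makes it
    triangular with one of the two determinants. *)
Lemma det_swap m (X Y : 'M[C]_m) : \det (1%:M + X *m Y) = \det (1%:M + Y *m X).
Proof.
pose Z := block_mx 1%:M (- X) Y 1%:M; pose U := block_mx 1%:M X 0 (1%:M : 'M[C]_m).
have U1 : \det U = 1 by rewrite det_ublock !det1 mulr1.
have <- : \det (U *m Z) = \det (1%:M + X *m Y).
  rewrite mulmx_block !mul1mx !mulmx1 !mul0mx add0r add0r addNr.
  by rewrite det_lblock det1 mulr1.
have <- : \det (Z *m U) = \det (1%:M + Y *m X).
  rewrite mulmx_block !mul1mx !mulmx1 !mulmx0 addr0 addr0 subrr.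
  by rewrite det_lblock det1 mul1r addrC.
by rewrite !det_mulmx mulrC.
Qed.
(** [B] is isometric only where Y lives. It will be the restriction to a window of a unitary that
    does not preserve the window, so that multiplicativity of det alone does not apply. *)
Lemma det_conj m (B Y : 'M[C]_m) : Y *m (adj B *m B) = Y ->
  \det (1%:M + B *m Y *m adj B) = \det (1%:M + Y).
Proof. by move=> h; rewrite -mulmxA det_swap -mulmxA h. Qed.
Lemma det_adj m (M : 'M[C]_m) : \det (adj M) = (\det M)^*.
Proof. by rewrite /adj det_map_mx det_tr. Qed.
End Determinants.

(** * Uniformly continuous complex functions and signs *)

Section UniformContinuity.
Variable R : realType.
Local Notation C := R[i].
Lemma mul_conj (z : C) : z * z^* = rc (csq z).
Proof.
case: z => x y; apply/eqP; rewrite eq_complex /csq /rd /=; apply/andP; split; apply/eqP; ring.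
Qed.
(** Boundedness is included so that products, and hence determinants, stay in the class. *)
Definition ucC (F : R -> C) := (exists M, 0 <= M /\ forall t, cabs (F t) <= M) /\
  forall e, 0 < e -> exists2 r, 0 < r & forall s t, `|s - t| <= r -> cabs (F s - F t) <= e.
Lemma ucC_cst c : ucC (fun=> c).
Proof.
split; first by exists (cabs c); split; rewrite ?cabs_ge0.
by move=> e e0; exists 1 => // s t _; rewrite subrr cabs0 ltW.
Qed.
Lemma ucC_add F G : ucC F -> ucC G -> ucC (fun t => F t + G t).
Proof.
move=> [[M [M0 hM]] hF] [[N [N0 hN]] hG]; split.
  exists (M + N); split=> [|t]; first exact: addr_ge0.
  by apply: le_trans (cabsD _ _) _; rewrite lerD.
move=> e e0; have e2 : 0 < e / 2 by rewrite divr_gt0.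
have [r r0 hr] := hF _ e2; have [q q0 hq] := hG _ e2.
exists (Num.min r q) => [|s t]; first by rewrite lt_min r0.
rewrite le_min => /andP[/hr h1 /hq h2]; rewrite opprD addrACA.
by apply: le_trans (cabsD _ _) _; rewrite (splitr e) lerD.
Qed.
Lemma ucC_mul F G : ucC F -> ucC G -> ucC (fun t => F t * G t).
Proof.
move=> [[M [M0 hM]] hF] [[N [N0 hN]] hG]; split.
  exists (M * N); split=> [|t]; first exact: mulr_ge0.
  by rewrite cabsM ler_pM ?cabs_ge0.
move=> e e0; have p : 0 < M + N + 1 by rewrite ltr_wpDl ?addr_ge0.
have [r r0 hr] := hF _ (divr_gt0 e0 p); have [q q0 hq] := hG _ (divr_gt0 e0 p).
exists (Num.min r q) => [|s t]; first by rewrite lt_min r0.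
rewrite le_min => /andP[/hr h1 /hq h2].
have -> : F s * G s - F t * G t = F s * (G s - G t) + (F s - F t) * G t by ring.
apply: le_trans (cabsD _ _) _; rewrite !cabsM.
have E : e = e / (M + N + 1) * (M + N + 1) by rewrite divfK// lt0r_neq0.
rewrite [leRHS]E; have := hM s; have := hN t; have := cabs_ge0 (F s); have := cabs_ge0 (G t).
have := cabs_ge0 (F s - F t); have := cabs_ge0 (G s - G t); move: h1 h2.
move: (e / _) (cabs (F s)) (cabs (G t)) (cabs (F s - F t)) (cabs (G s - G t)) => d a b x y.
by clear -M0 N0; nra.
Qed.
Lemma ucC_sum I (r : seq I) (F : I -> R -> C) : (forall i, ucC (F i)) -> ucC (fun t => \sum_(i <- r) F i t).
Proof.
move=> h; elim: r => [|i r IH].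
  by under eq_fun do rewrite big_nil; exact: ucC_cst.
by under eq_fun do rewrite big_cons; apply: ucC_add.
Qed.
Lemma ucC_prod I (r : seq I) (F : I -> R -> C) : (forall i, ucC (F i)) -> ucC (fun t => \prod_(i <- r) F i t).
Proof.
move=> h; elim: r => [|i r IH].
  by under eq_fun do rewrite big_nil; exact: ucC_cst.
by under eq_fun do rewrite big_cons; apply: ucC_mul.
Qed.
Lemma ucC_det m (M : R -> 'M[C]_m) : (forall i j, ucC (fun t => M t i j)) -> ucC (fun t => \det (M t)).
Proof.
move=> h; rewrite /determinant; apply: ucC_sum => s; apply: ucC_mul; first exact: ucC_cst.
by apply: ucC_prod.
Qed.
Lemma uc_sign (F : R -> R) :
  (forall e, 0 < e -> exists2 r, 0 < r & forall s t, `|s - t| <= r -> `|F s - F t| <= e) ->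
  0 < F 0 -> (forall t, 0 <= t <= 1 -> F t != 0) -> 0 < F 1.
Proof.
move=> uF F0 nF; rewrite ltNge; apply/negP => F1.
have cF : continuous F.
  move=> x; apply/cvgrPdist_le => e /uF[r r0 hr].
  apply/nbhs_ballP; exists r => //= y xy; apply: hr; exact: ltW.
have [|c cI Fc] := @IVT R F 0 1 0 ler01 (continuous_subspaceT cF).
  by rewrite ge_min F1 orbT le_max (ltW F0).
by move: cI; rewrite in_itv /= => /nF; rewrite Fc eqxx.
Qed.
End UniformContinuity.

(** * The twisted shift and its inequivalence to the untwisted one *)

Section Obstruction.
Variable R : realType.
Local Notation C := R[i].
Local Notation H := (hilb R).
Local Notation A := (fam R).
Implicit Types (a b p q x y : A) (t s : R) (k : idx).
Notation wmat N := (mat (@iw N)).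

(* The permutation with the single orbit [.. -> 5 -> 3 -> 1 -> 0 -> 2 -> 4 -> ..] *)
Definition sig (n : nat) : nat := if odd n then (if n == 1%N then 0%N else n.-2) else n.+2.
Definition sigi (n : nat) : nat := if odd n then n.+2 else (if n == 0%N then 1%N else n.-2).
Lemma sigK : cancel sig sigi.
Proof.
move=> [|[|[|n]]] //; rewrite /sig /sigi /= !negbK.
by case E: (odd n) => /=; rewrite ?E ?negbK ?E.
Qed.
Lemma sigiK : cancel sigi sig.
Proof.
move=> [|[|[|n]]] //; rewrite /sig /sigi /= !negbK.
by case E: (odd n) => /=; rewrite ?E ?negbK ?E.
Qed.
Lemma sigp_inj : injective (fun i : idx => (sig i.1, i.2)).
Proof. by move=> [n b] [n' b'] [/(can_inj sigK) -> ->]. Qed.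
Definition v0 : A := Sop R sigp_inj.
Lemma v0_be t i : op v0 t (be R i) = be R (sig i.1, i.2). Proof. exact: Sop_be. Qed.
Lemma v0_unitary : unitary v0.
Proof.
split; first exact: Sop_star_mul.
apply: op_ext => t [n b]; rewrite op_mul op_one.
have -> : (n, b) = (fun i : idx => (sig i.1, i.2)) (sigi n, b) by rewrite /= sigiK.
by rewrite (starS_be sigp_inj) v0_be.
Qed.
Lemma ev_v0 s : ev s v0 = v0. Proof. exact: ev_Sop. Qed.
Lemma MM_v0 : MM v0.
Proof. by apply: MM_const => [s|]; [exact: ev_v0|exact: dbl_Sop]. Qed.

Definition hh t : C := arc (-1) t.
Lemma cN1 : cabs (-1 : C) = 1. Proof. by rewrite cabsN cabs1. Qed.
Lemma cabs_hh t : cabs (hh t) = 1. Proof. exact: cabs_arc cN1. Qed.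
Lemma hh0 : hh 0 = 1. Proof. exact: arc0. Qed.
Lemma hh1 : hh 1 = -1. Proof. exact: arc1 cN1. Qed.
Lemma hhJ t : (hh t)^* * hh t = 1.
Proof.
by have := cabs_hh t; rewrite mulrC -(normCK (hh t)) normcE => ->; rewrite expr1n.
Qed.
Lemma ucC_hh : ucC hh.
Proof.
split; first by exists 1; split=> // t; rewrite cabs_hh.
by move=> e /arc_ucont[r r0 hr]; exists r => // s t; apply: hr; exact: cN1.
Qed.
Definition gg t : C := hh t * hh t.
Lemma ucC_gg : ucC gg. Proof. exact: ucC_mul ucC_hh ucC_hh. Qed.
Lemma cabs_gg t : cabs (gg t) = 1. Proof. by rewrite cabsM cabs_hh mulr1. Qed.
Lemma gg0 : gg 0 = 1. Proof. by rewrite /gg hh0 mulr1. Qed.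
Lemma gg1 : gg 1 = 1. Proof. by rewrite /gg hh1 mulrNN mulr1. Qed.
Lemma gg_clamp t : gg (clamp t) = gg t. Proof. by rewrite /gg /hh arc_clamp. Qed.
Lemma ggJ t : (gg t)^* * gg t = 1.
Proof. by rewrite /gg rmorphM mulrACA hhJ mulr1. Qed.

Definition wt t k : C := if k == (0%N, false) then gg t else 1.
Lemma bdm_wt : bdm (dgm wt).
Proof.
apply: bdm_dgm; exists 1; split=> // t k; rewrite /wt; case: eqP => _.
  by rewrite cabs_gg.
by rewrite cabs1.
Qed.
Definition K0 : A := locked_with lock_key (gop bdm_wt).
Lemma K0E t (v : H) k : op K0 t v k = wt t k * v k.
Proof. by rewrite /K0 locked_withE; exact: op_dg. Qed.
Lemma K0_be t k : op K0 t (be R k) = wt t k *: be R k.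
Proof. by rewrite /K0 locked_withE; exact: dg_be. Qed.
Lemma K0SE t (v : H) k : op (star K0) t v k = (wt t k)^* * v k.
Proof.
rewrite /K0 locked_withE (star_gop _ (bdm_adj bdm_wt)) op_gop /madj /dgm.
by case: k => n [] /=; rewrite conjC0 mul0r ?addr0 ?add0r.
Qed.
Lemma wtJ t k : (wt t k)^* * wt t k = 1.
Proof. by rewrite /wt; case: eqP => _; rewrite ?ggJ// conjC1 mulr1. Qed.
Lemma K0_unitary : unitary K0.
Proof.
by split; apply: fam_eq => t v; apply: hvP2 => k;
  rewrite op_mul op_one ?K0SE K0E ?K0SE mulrA ?[wt _ _ * _]mulrC wtJ mul1r.
Qed.
Lemma ev_K0 s : gg s = 1 -> ev s K0 = 1.
Proof.
move=> h; apply: fam_eq => t v; apply: hvP2 => k; rewrite op_ev op_one K0E /wt h if_same.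
by rewrite mul1r.
Qed.
Lemma MM_K0 : MM K0.
Proof.
split; split.
- rewrite /K0 locked_withE; apply: ucont_dg => e /(ucC_gg.2)[r r0 hr]; exists r => // s t /hr st k.
  by rewrite /wt; case: eqP => // _; rewrite subrr cabs0 (le_trans (cabs_ge0 _) st).
- by move=> t; apply: fam_eq => s v; apply: hvP2 => k; rewrite !op_ev !K0E /wt gg_clamp.
- split; rewrite /kpath /= ev_K0 ?gg0//; last exact: cs1 (csub_dbl R).
  apply: (@KK_supp _ 1%N); apply: fam_eq => t v; apply: hvP2 => k.
  rewrite !op_mul eN_E !(op_add, op_opp, op_one) !(hvDE, hvNE) !K0E eN_E.
  case: k => -[|n] b /=; first by rewrite !mul1r.
  by rewrite /wt /= !mul1r !subrr mulr0.
- rewrite /= ev_K0 ?gg1//; exact: cs1 (csub_dbl R).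
Qed.
Definition u0 : A := locked_with lock_key (K0 * v0).
Lemma u0E : u0 = K0 * v0. Proof. by rewrite /u0 locked_withE. Qed.
Lemma u0_unitary : unitary u0. Proof. rewrite u0E; exact: unitaryM K0_unitary v0_unitary. Qed.
Lemma MM_u0 : MM u0. Proof. rewrite u0E; exact: csM (csub_MM R) _ _ MM_K0 MM_v0. Qed.

Lemma theta_unitary x : unitary x -> unitary (theta x).
Proof. by move=> [h1 h2]; split; rewrite -theta_star -thetaM ?h1 ?h2 theta1. Qed.
Lemma ev_unitary s x : unitary x -> unitary (ev s x).
Proof. by move=> [h1 h2]; split; rewrite -evS -evM ?h1 ?h2 ev1. Qed.

Definition base : A := locked_with lock_key (ev 0 (theta u0)).
Lemma baseE : base = ev 0 (theta u0). Proof. by rewrite /base locked_withE. Qed.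
(** Dividing by the value at 0 leaves a diagonal operator: the blocks at rational points are
    constant and cancel, and the block [None] leaves the phase [gg t] at the single basis vector
    [k0]. *)
Definition twist : A := locked_with lock_key (theta u0 * star base).
Lemma twist_base : twist = theta u0 * star base. Proof. by rewrite /twist locked_withE. Qed.
Definition k0 : idx := lmap None (0%N, false).

Lemma spread_scalar o t i : exists c, op (spread K0 o) t (be R i) = c *: be R i.
Proof.
case: o => [[[a r] c]|] /=; last by exists (wt t i); rewrite K0_be.
by exists (wt (qpt R a) i); rewrite op_ev K0_be.
Qed.
Lemma base_monomial t k : exists k' c, op base t (be R k) = c *: be R k'.
Proof.
have [l [i <-]] := lmap_surj k; have [c hc] := spread_scalar l 0 (sig i.1, i.2).
exists (lmap l (sig i.1, i.2)), c; rewrite baseE op_ev u0E thetaM op_mul.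
have -> : op (theta v0) 0 (be R (lmap l i)) = be R (lmap l (sig i.1, i.2)).
  rewrite -(leg_be l 0) -op_mul thetaE op_mul.
  have -> : spread v0 l = v0 by case: l {hc} => [[[a r] b]|] //=; rewrite ev_v0.
  by rewrite v0_be leg_be.
by rewrite -(leg_be l 0) -op_mul thetaE op_mul hc opZ leg_be.
Qed.
Lemma twistE : twist = blk (fun o => if o is None then K0 else 1).
Proof.
have [_ vv] := theta_unitary v0_unitary.
have -> : twist = theta K0 * star (ev 0 (theta K0)).
  rewrite twist_base baseE u0E thetaM evM starM.
  have -> : ev 0 (theta v0) = theta v0.
    apply: leg_ext => o; rewrite ev_thetaE thetaE.
    by case: o => [[[a r] b]|] //=; rewrite ?ev_ev ev_v0.
  have -> : theta K0 * theta v0 * (star (theta v0) * star (ev 0 (theta K0))) =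
    theta K0 * (theta v0 * star (theta v0)) * star (ev 0 (theta K0)) by nring.
  by rewrite vv mulr1.
apply: blk_uniq => [|o].
  exists (1 + nrm K0); split; first by rewrite addr_ge0 ?nrm_ge0.
  by case=> [_|]; rewrite ?nrm1 ?lerDl ?lerDr ?nrm_ge0.
have hb : bounded_lbl (fun o => ev 0 (spread K0 o)).
  exists (nrm K0); split; [exact: nrm_ge0|move=> l].
  exact: le_trans (nrm_ev _ _) (nrm_spread _ _).
rewrite -mulrA (ev_blk 0 (bspread K0)) (blk_star hb) blkE; last first.
  by have [M [M0 hM]] := hb; exists M; split=> // l; rewrite nrm_star.
rewrite mulrA thetaE -mulrA; congr (_ * _).
case: o => [[[a r] c]|] /=; last by rewrite ev_K0 ?gg0// star_one mulr1.
by rewrite ev_ev; case: (ev_unitary (qpt R a) K0_unitary).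
Qed.
Lemma twist_be t k : op twist t (be R k) = (if k == k0 then gg t else 1) *: be R k.
Proof.
have hb : bounded_lbl (fun o => if o is None then K0 else 1).
  exists (1 + nrm K0); split; first by rewrite addr_ge0 ?nrm_ge0.
  by case=> [_|]; rewrite ?nrm1 ?lerDl ?lerDr ?nrm_ge0.
rewrite twistE; have [l [i <-]] := lmap_surj k.
rewrite -{1}(leg_be l t) -op_mul blkE// op_mul /k0.
case: l => [l|].
  rewrite op_one leg_be; case: eqP => [/lmap_inj2[]//|_]; by rewrite scale1r.
rewrite K0_be opZ leg_be (inj_eq (@lmap_inj None)) /wt.
by [].
Qed.
(** The image of a window lies in a larger window exactly, not merely up to a small error, so that
    determinants can be computed in the larger one. *)
Lemma monomial_window (P : A) N : (forall s, ev s P = P) ->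
  (forall t k, exists k' c, op P t (be R k) = c *: be R k') ->
  exists M0, forall M, (M0 <= M)%N -> eN R M * P * eN R N = P * eN R N.
Proof.
move=> cP hP; have /choice[f hf] : forall k, exists k', exists c, op P 0 (be R k) = c *: be R k'.
  by move=> k; have [k' [c h]] := hP 0 k; exists k', c.
exists (\max_(i < N) maxn (f (i : nat, false)).1 (f (i : nat, true)).1).+1 => M hM.
apply: op_ext => t [n b]; rewrite !op_mul eN_be /=; case: (ltnP n N) => nN; last by rewrite scale0r !op0.
rewrite scale1r -(cP 0) !op_ev; have [c ->] := hf (n, b); rewrite opZ eN_be.
have -> : ((f (n, b)).1 < M)%N.
  apply: leq_trans hM; rewrite ltnS.
  apply: leq_trans (leq_bigmax (Ordinal nN)) => /=.
  by case: b; [exact: leq_maxr|exact: leq_maxl].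
by rewrite scale1r.
Qed.

Lemma clsub_supp M : clsub (supp M : set A).
Proof.
split.
- by rewrite /supp mulr0 mul0r.
- by move=> a b; exact: suppD.
- by move=> a; exact: suppZ.
- by move=> a b; exact: suppM.
- move=> x h; apply/eqP; rewrite -subr_eq0; apply/eqP; apply: (@nrm_small0 _ 2) => e e0.
  have [y hy xy] := h e e0.
  have -> : eN R M * x * eN R M - x = eN R M * (x - y) * eN R M - (x - y).
    by rewrite mulrBr mulrBl hy; nring.
  apply: le_trans (nrmB _ _) _; rewrite mulr_natl mulr2n; apply: lerD => //.
  exact: le_trans (nrm_cut _ _) xy.
Qed.

Lemma clsub_ev0 : clsub [set x : A | ev 0 x = 0].
Proof.
have e0 : ev 0 (0 : A) = 0 by apply: fam_eq => t v; rewrite op_ev !op_zero.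
split=> /=.
- exact: e0.
- by move=> a b ha hb; rewrite evD ha hb addr0.
- by move=> a ha; rewrite evZ ha scaler0.
- by move=> a b ha hb; rewrite evM ha hb mulr0.
- move=> x h; apply: (@nrm_small0 _ 1) => e /h[y hy xy]; rewrite mul1r.
  by apply: le_trans xy; rewrite -[ev 0 x]subr0 -hy -evB; exact: nrm_ev.
Qed.

Lemma opm_wop M (Q : 'M[C]_(M + M)) : wop Q - 1 = opm (@iw M) (Q - 1%:M).
Proof.
have -> : wop Q - 1 = opm (@iw M) Q - eN R M by rewrite /wop; nring.
rewrite -opm_iw1 /opm -sumrB; apply: eq_bigr => i _; rewrite -sumrB; apply: eq_bigr => j _.
by rewrite !mxE scalerBl.
Qed.

(* The determinant [f] of the square root of [star c * twist * base * c * star base]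
   satisfies [f^2 = |det c|^2 * gg], so that [f * (hh)^*] is real and does not change its sign,
   whereas [f 1 > 0] since [c] and [base] are doubled at [t = 1]. *)
Lemma twist_obstruction c : ucont c -> dbl (ev 1 c) -> ev 0 c = 1 -> (exists N, supp N (c - 1)) ->
  nrm (1 - star c * twist * base * c * star base) <= 2^-1 -> False.
Proof.
move=> uc dc c0 [N sc] nZ; set Z := star c * twist * base * c * star base in nZ.
have cb s : ev s base = base by rewrite baseE ev_ev.
have [b1 b2] : unitary base by rewrite baseE; exact: ev_unitary (theta_unitary u0_unitary).
have [M0 hM0] := monomial_window N cb base_monomial.
(* This window contains that of c, its image under [base], and the vector [k0] on which the twist
   acts. *)
pose M := maxn M0 (maxn N k0.1.+1).
have NM : (N <= M)%N by rewrite /M !leq_max leqnn orbT.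
have bM : eN R M * base * eN R N = base * eN R N by apply: hM0; rewrite leq_maxl.
have kM : (k0.1 < M)%N by rewrite /M !leq_max leqnn !orbT.
have dbase : dbl base by rewrite baseE; case: (MM_theta MM_u0) => _ [[]].
have utw : ucont twist.
  have [[h _] _] := MM_theta MM_u0; rewrite twist_base; apply: (csM (csub_ucont R) h); apply: csS (csub_ucont R) _ _.
  by move=> e e0; exists 1 => // s t _; rewrite !cb subrr nrm0 ltW.
have ubase : ucont base by move=> e e0; exists 1 => // s t _; rewrite !cb subrr nrm0 ltW.
have tw1 : ev 1 twist = 1.
  apply: op_ext => t k; rewrite op_ev twist_be gg1 if_same scale1r op_one.
  by [].
have tw0 : ev 0 twist = 1.
  by apply: op_ext => t k; rewrite op_ev twist_be gg0 if_same scale1r op_one.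
pose X := base * eN R N.
have XX : star X * X = eN R N.
  rewrite /X starM eN_sa; have -> : eN R N * star base * (base * eN R N) =
    eN R N * (star base * base) * eN R N by nring.
  by rewrite b1 mulr1 eN_id.
have sX : supp M X.
  have e1 : X * eN R M = X.
    by rewrite /X -mulrA eN_mul (minn_idPl NM).
  by rewrite /supp -mulrA e1 /X mulrA.
have cX s : ev s X = X by rewrite /X evM cb ev_eN.
have conjX x : supp N (x - 1) -> base * x * star base = 1 + X * (x - 1) * star X.
  move=> h; have -> : X * (x - 1) * star X = base * (eN R N * (x - 1) * eN R N) * star base.
    by rewrite /X starM eN_sa; nring.
  have -> : eN R N * (x - 1) * eN R N = x - 1 by exact: h.
  have -> : base * (x - 1) * star base = base * x * star base - base * star base by nring.
  by rewrite b2 addrC subrK.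
have sconj x : supp N (x - 1) -> supp M (base * x * star base - 1).
  move=> h; rewrite conjX// addrAC subrr add0r.
  by apply: suppM; [apply: suppM sX _; exact: supp_mono h|exact: suppS].
have dX : dbl X by have sD := csub_dbl R; rewrite /X -(hop1 R N); exact: (csM sD dbase (dbl_hop _)).
clearbody X.
have sN1 a b : supp M (a - 1) -> supp M (b - 1) -> supp M (a * b - 1).
  move=> ha hb; have -> : a * b - 1 = (a - 1) * (b - 1) + (a - 1) + (b - 1) by nring.
  exact: suppD (suppD (suppM ha hb) ha) hb.
have sM : supp M (c - 1) := supp_mono NM sc.
have sscM : supp M (star c - 1) by rewrite -star_one -star_sub; exact: suppS.
have stw : supp M (twist - 1).
  apply: op_ext => t k; rewrite !op_mul eN_be opZ !(op_add, op_opp, op_one) twist_be.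
  have [->|kk] := eqVneq k k0.
    by rewrite kM scale1r -[X in _ - X]scale1r -scalerBl opZ eN_be kM scale1r.
  by rewrite scale1r subrr scaler0 op0.
have ZE : Z = star c * twist * (base * c * star base) by rewrite /Z; nring.
have sZ : supp M (Z - 1) by rewrite ZE; exact: sN1 (sN1 _ _ sscM stw) (sconj _ sc).
have Z0 : ev 0 Z = 1 by rewrite ZE !evM !evS c0 tw0 !cb star_one !mulr1 mul1r b2.
(* From Z the square root inherits the window, continuity, the value 1 at t = 0 and doubling at t =
   1, each through the clause [sub] for a different closed set. *)
have [r [s [rr [rs sr] _ _ sub]]] := inv_sqrt nZ; pose zeta := 1 - r.
have sr' : supp M (zeta - 1).
  have : supp M r.
    apply: (sub _ (clsub_supp M) _).1; rewrite -[1 - Z]opprB -scaleN1r; exact: suppZ.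
  have -> : zeta - 1 = (-1) *: r by rewrite /zeta scaleN1r; nring.
  by move=> h; exact: suppZ.
have ss' : supp M (1 + s - 1).
  rewrite addrAC subrr add0r; apply: (sub _ (clsub_supp M) _).2.
  rewrite -[1 - Z]opprB -scaleN1r; exact: suppZ.
have ucZ : ucont Z.
  have sU := csub_ucont R; have ucS := csS sU uc; have ubS := csS sU ubase.
  exact: (csM sU (csM sU (csM sU (csM sU ucS utw) ubase) uc) ubS).
have uz : ucont zeta.
  have sU := csub_ucont R; apply: (csB sU (cs1 sU)).
  by apply: (sub _ (csub_clsub sU) _).1; exact: (csB sU (cs1 sU) ucZ).
have z0 : ev 0 zeta = 1.
  have : ev 0 r = 0 by apply: (sub _ clsub_ev0 _).1; rewrite /= evB ev1 Z0 subrr.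
  by move=> h; rewrite /zeta evB ev1 h subr0.
have dz1 : dbl (ev 1 zeta).
  have sU := csub_ev 1 (csub_dbl R).
  have D1 : dbl (ev 1 Z).
    have sD := csub_dbl R; rewrite ZE !evM tw1 mulr1 !evS !cb.
    exact: (csM sD (csS sD dc) (csM sD (csM sD dbase dc) (csS sD dbase))).
  have hB : [set a | dbl (ev 1 a)] (1 - Z) := csB sU (cs1 sU) D1.
  exact: (csB sU (cs1 sU) (sub _ (csub_clsub sU) hB).1).
have zz : zeta * zeta = Z by rewrite /zeta rr.
pose W t x := wmat M 0 (ev t x).
have cev t (x : A) s' : ev s' (ev t x) = ev t x by rewrite ev_ev.
have suppE t x : supp M x -> supp M (ev t x) by rewrite /supp => h; rewrite -{2}h !evM ev_eN.
have suppE1 t x : supp M (x - 1) -> supp M (ev t x - 1).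
  by move=> h; rewrite -(ev1 t) -evB; exact: suppE.
have WE t x : supp M (x - 1) -> ev t x = wop (W t x).
  by move=> h; exact: (wop_wmat (cev t x) (suppE1 t x h)).
have WM t x y : supp M (x - 1) -> supp M (y - 1) -> W t (x * y) = W t x *m W t y.
  by move=> hx hy; apply: wop_inj; rewrite -wopM -!WE ?evM//; exact: sN1.
have WS t x : supp M (x - 1) -> supp M (star x - 1) -> W t (star x) = adj (W t x).
  by move=> hx hy; apply: wop_inj; rewrite -wopS -!WE ?evS.
have W1 t : W t 1 = 1%:M.
  by apply: wop_inj; rewrite wop1 -WE ?ev1// subrr /supp mulr0 mul0r.
pose B := wmat M 0 X; have XB : X = opm (@iw M) B by exact: supp_wmat.
(* Within the window, conjugation by [base] is conjugation by the partial isometry B, whose initial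
   space is the window of c; this is the case covered by [det_conj]. *)
have detC t : \det (W t (base * c * star base)) = \det (W t c).
  have h1 := WE t _ sM; set Q := W t c in h1 *.
  have iwi := @iw_inj M.
  have -> : W t (base * c * star base) = 1%:M + B *m (Q - 1%:M) *m adj B.
    apply: wop_inj; rewrite -WE; last exact: sconj.
    apply: (@addIr _ (-1)); rewrite opm_wop addrAC subrr add0r -!opmM// -opmS// -XB -opm_wop -h1.
    by rewrite conjX// !(evD, evN, evM, evS, ev1) !cX addrAC subrr add0r.
  rewrite det_conj; first by rewrite addrC subrK.
  apply: (opm_inj iwi); rewrite -!opmM// -opmS// -XB XX -opm_wop -h1 -(ev1 t) -evB.
  by have := suppr sc => h2; rewrite -{2}h2 evM ev_eN.
have detT t : \det (W t twist) = gg t.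
  have -> : W t twist = diag_mx (\row_i (if iw i == k0 then gg t else 1)).
    apply/matrixP => i j; rewrite !mxE op_ev twist_be hvZE beE (inj_eq (@iw_inj M)).
    by case: (eqVneq i j) => [->|]; rewrite ?mulr1// mulr0 mulr0n.
  have /codomP[i0 hi0] : k0 \in codom (@iw M) by rewrite codom_iw.
  rewrite det_diag (bigD1 i0)//= big1 ?mulr1; first by rewrite mxE hi0 eqxx.
  by move=> i ii; rewrite mxE hi0 (inj_eq (@iw_inj M)) (negbTE ii).
pose f t := \det (W t zeta); pose d t := \det (W t c).
have ff t : f t * f t = (d t)^* * gg t * d t.
  rewrite /f /d -det_mulmx -WM// zz ZE (WM _ _ _ (sN1 _ _ sscM stw) (sconj _ sc)) WM//.
  by rewrite !det_mulmx detC WS// det_adj detT.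
have fn0 t : f t != 0.
  have h : \det (W t zeta) * \det (W t (1 + s)) = 1.
    by rewrite -det_mulmx -WM// /zeta rs W1 det1.
  apply/eqP => f0; move: h; rewrite -/(f t) f0 mul0r => /eqP.
  by rewrite eq_sym oner_eq0.
have ucf : ucC f.
  apply: ucC_det => i j; split.
    exists (nrm zeta); split=> [|t]; first exact: nrm_ge0.
    rewrite mxE op_ev; apply: le_trans (cabs_le_hn _ _) _.
    by apply: le_trans (op_nrm _ _ _) _; rewrite hn_be mulr1.
  move=> e /uz[q q0 hq]; exists q => // s' t /hq st; rewrite !mxE !op_ev.
  have -> : op zeta s' (be R (iw j)) (iw i) - op zeta t (be R (iw j)) (iw i) =
     op (ev s' zeta - ev t zeta) 0 (be R (iw j)) (iw i).
    by rewrite op_add op_opp hvDE hvNE !op_ev.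
  apply: le_trans (cabs_le_hn _ _) _; apply: le_trans (op_nrm _ _ _) _.
  by rewrite hn_be mulr1.
have uch : ucC (fun t => (hh t)^*).
  have [[m [m0 hm]] hc] := ucC_hh; split; first by exists m; split=> // t; rewrite cabsJ.
  by move=> e /hc[q q0 hq]; exists q => // s' t /hq; rewrite -rmorphB cabsJ.
have ucF := ucC_mul ucf uch.
have Fsq t : (f t * (hh t)^*) * (f t * (hh t)^*) = rc (csq (d t)).
  rewrite mulrACA ff; have -> : (d t)^* * gg t * d t * ((hh t)^* * (hh t)^*) =
     (d t * (d t)^*) * (((hh t)^* * hh t) * ((hh t)^* * hh t)) by rewrite /gg; ring.
  by rewrite hhJ !mulr1 mul_conj.
have d0 t : 0 < csq (d t).
  have h : f t * (hh t)^* != 0.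
    apply: mulf_neq0; first exact: fn0.
    by apply/eqP => h; move: (hhJ t); rewrite h mul0r => /eqP; rewrite eq_sym oner_eq0.
  rewrite lt_neqAle csq_ge0 andbT; apply/eqP => h'.
  by move: (mulf_neq0 h h); rewrite Fsq -h' => /eqP; apply; apply/eqP; rewrite eq_complex /= eqxx.
have realF t : complex.Im (f t * (hh t)^*) = 0 /\ complex.Re (f t * (hh t)^*) != 0.
  have := Fsq t; have := d0 t; case: (f t * (hh t)^*) => x y; rewrite /rc /= => dp.
  move=> /eqP; rewrite eq_complex /= => /andP[/eqP h1 /eqP h2].
  have xy : x * y = 0 by lra.
  have x0 : x != 0 by apply/eqP => x0; move: h1; rewrite x0 mul0r; nra.
  by move/eqP: xy; rewrite mulf_eq0 (negbTE x0) /= => /eqP ->.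
have pos : 0 < complex.Re (f 1 * (hh 1)^*).
  apply: (@uc_sign R (fun t => complex.Re (f t * (hh t)^*))).
  - move=> e /(ucF.2)[q q0 hq]; exists q => // s' t /hq; apply: le_trans.
    apply: le_trans (ler_Re _).
    by case: (f s' * _) => a b; case: (f t * _) => a' b'.
  - have -> : f 0 = 1.
      rewrite /f; have -> : W 0 zeta = 1%:M; last by rewrite det1.
      by apply: wop_inj; rewrite -WE// z0 wop1.
    by rewrite hh0 conjC1 mulr1 /= ltr01.
  - by move=> t _; case: (realF t).
have sdz : supp M (ev 1 zeta - 1) := suppE1 1 _ sr'.
have sD := csub_dbl R; have dB1 a : dbl a -> dbl (a - 1) by move=> h; exact: (csB sD h (cs1 sD)).
have hbE a : (forall s', ev s' a = a) -> dbl a -> supp M (a - 1) -> exists Q : 'M[C]_M, a - 1 = hop Q.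
  move=> ca da sa; exists (mat (@hw M false) 0 (a - 1)); apply: dbl_supp => //; last exact: dB1.
  by move=> s'; rewrite evB ca ev1.
have [Qz Qz1] := hbE _ (cev 1 zeta) dz1 sdz.
have [Qc Qc1] := hbE _ (cev 1 c) dc (suppE1 1 _ sM).
have [QX QX1] : exists Q : 'M[C]_M, X = hop Q.
  by exists (mat (@hw M false) 0 X); exact: dbl_supp.
have addm (Y Y' : 'M[C]_M) : hop (Y + Y') = hop Y + hop Y'.
  apply/esym/hop_ext => [t v i b|t v k kn]; rewrite op_add hvDE; last by rewrite !hop_out// addr0.
  by rewrite !hop_in -big_split; apply: eq_bigr => j _; rewrite mxE mulrDl.
(* At t = 1 the twist is 1 and all factors are doubled, so the relation between the square root and
   Z descends to matrices of half the size; its determinant is |det (1 + Qc)|^2. *)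
have hz2 : (1%:M + Qz) *m (1%:M + Qz) = adj (1%:M + Qc) *m (1%:M + QX *m Qc *m adj QX).
  have k (Y Y' Y'' : 'M[C]_M) : (1 + hop Y) * (1 + hop Y') = 1 + hop Y'' ->
      (1%:M + Y) *m (1%:M + Y') = 1%:M + Y''.
    move=> h; rewrite mulmxDl !mulmxDr !mul1mx mulmx1; rewrite -!addrA; congr (_ + _).
    apply: hop_inj; rewrite !addm -hopM; apply: (addrI 1); rewrite -h; nring.
  have sq : hop (adj Qc) = star (ev 1 c) - 1 by rewrite -hopS -Qc1 star_sub star_one.
  have E1 : 1 + hop Qz = ev 1 zeta by rewrite -Qz1 addrC subrK.
  have E2 : 1 + hop (adj Qc) = star (ev 1 c) by rewrite sq addrC subrK.
  have E3 : 1 + hop (QX *m Qc *m adj QX) = ev 1 (base * c * star base).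
    by rewrite -!hopM -hopS -QX1 -Qc1 conjX// !(evD, evN, evM, evS, ev1) !cX.
  have dZ : dbl (ev 1 Z) by rewrite -zz evM; exact: (csM sD dz1 dz1).
  have [QZ QZ1] := hbE _ (cev 1 Z) dZ (suppE1 1 _ sZ).
  have E4 : 1 + hop QZ = ev 1 Z by rewrite -QZ1 addrC subrK.
  rewrite (k _ _ QZ); last by rewrite E1 E4 -zz evM.
  have -> : adj (1%:M + Qc) = 1%:M + adj Qc by rewrite /adj linearD /= map_mxD trmx1 map_mx1.
  rewrite (k _ _ QZ)//; rewrite E2 E3 E4 ZE [RHS]evM [ev 1 (star c * twist)]evM tw1 mulr1 evS.
  by [].
have f1 : f 1 = \det (1%:M + Qz) * \det (1%:M + Qz).
  rewrite /f; have -> : W 1 zeta = block_mx (1%:M + Qz) 0 0 (1%:M + Qz); last by rewrite det_ublock.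
  have entry (i j : 'I_M) (b b' : bool) : op (ev 1 zeta) 0 (be R (nat_of_ord j, b')) (nat_of_ord i : nat, b) =
      (if b == b' then (1%:M + Qz) i j else 0).
    have -> : ev 1 zeta = 1 + hop Qz by rewrite -Qz1 addrC subrK.
    rewrite op_add op_one hvDE beE hop_in xpair_eqE (inj_eq val_inj) !mxE.
    case: (eqVneq b b') => [->|bb]; last first.
      rewrite andbF big1 ?addr0// => l _.
      by rewrite beE xpair_eqE (negbTE bb) andbF mulr0.
    rewrite andbT (bigD1 j)//= big1 ?addr0; first by rewrite beE eqxx mulr1.
    by move=> l lj; rewrite beE xpair_eqE (inj_eq val_inj) (negbTE lj) mulr0.
  rewrite -[W 1 zeta]submxK; congr block_mx; apply/matrixP => i j;
    by rewrite !mxE ?iwl ?iwr entry ?mxE.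
have : f 1 = rc (csq (\det (1%:M + Qc))).
  rewrite f1 -det_mulmx hz2 det_mulmx det_adj det_conj; first by rewrite mulrC mul_conj.
  apply: hop_inj; rewrite -!hopM -hopS -QX1 XX -Qc1.
  have h2 := suppr sc; rewrite -(ev1 1) -evB -{2}h2 evM ev_eN.
  by [].
move=> h; move: pos; rewrite h hh1 rmorphN1 mulrN1 /= ltNge oppr_le0 csq_ge0.
by [].
Qed.

(** As [theta v0] is constant, comparing with the value at 0 gives theta(u0) close to c base c^-1
    for c = w w(0)^-1, with error 1/10 + 1/10. Cutting c to a window costs at most 1/10 + 11/100
    more, and the total 41/100 stays below the 1/2 of [twist_obstruction]. *)
Lemma theta_u0_v0_inequivalent w : MM w -> unitary w ->
  nrm (star w * theta u0 * w - theta v0) <= 10^-1 -> False.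
Proof.
move=> hw [w1 w2] h; have sM := csub_MM R; pose w0 := ev 0 w.
have [w01 w02] : unitary w0 := ev_unitary 0 (conj w1 w2).
pose u := theta u0; pose c := w * star w0.
have n1 x : unitary x -> nrm x = 1.
  by move=> [x1 _]; have := nrm_cstar x; rewrite x1 nrm1; have := nrm_ge0 x => *; nra.
have uu : unitary u := theta_unitary u0_unitary.
have [bb1 bb2] : unitary base by rewrite baseE; exact: ev_unitary uu.
have uc : unitary c := unitaryM (conj w1 w2) (unitary_star (conj w01 w02)).
have evv : ev 0 (theta v0) = theta v0.
  apply: leg_ext => o; rewrite ev_thetaE thetaE.
  by case: o => [[[a r] b]|] //=; rewrite ?ev_ev ev_v0.
have h1 : nrm (u - w * theta v0 * star w) <= 10^-1.
  have -> : u - w * theta v0 * star w = star (star w) * (star w * u * w - theta v0) * star w.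
    have -> : u = (w * star w) * u * (w * star w) by rewrite w2 mul1r mulr1.
    by rewrite starK w2 mul1r mulr1; rewrite -{1}[u]mul1r -{1}w2 -[_ * u]mulr1 -{1}w2; nring.
  by rewrite nrm_unitary_conj//; exact: unitary_star.
have h0 : nrm (base - w0 * theta v0 * star w0) <= 10^-1.
  by rewrite baseE -evv /w0 -evS -!evM -evB; exact: le_trans (nrm_ev _ _) h1.
have h2 : nrm (u - c * base * star c) <= 2 / 10.
  have -> : u - c * base * star c = (u - w * theta v0 * star w) -
      star (star c) * (base - w0 * theta v0 * star w0) * star c.
    have -> : star (star c) * (base - w0 * theta v0 * star w0) * star c =
      c * base * star c - w * (star w0 * w0) * theta v0 * (star w0 * w0) * star w.
      by rewrite /c starK starM starK; nring.
    by rewrite w01 !mulr1; nring.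
  apply: le_trans (nrmB _ _) _; rewrite nrm_unitary_conj; last exact: unitary_star.
  by move: h1 h0; clear; gen_norms; lra.
have dw0 : dbl w0 by case: hw => _ [[]].
have cw0 s : ev s w0 = w0 by rewrite /w0 ev_ev.
have hc : MM c := csM sM hw (csS sM (MM_const cw0 dw0)).
have c0 : ev 0 c = 1 by rewrite /c evM evS cw0.
have [[ucc _] [[kc _] dc]] := hc; rewrite /kpath /= c0 in kc.
have [N hN] := kc _ (divr_gt0 ltr01 (ltr0Sn R 9)).
pose c' := 1 + eN R N * (c - 1) * eN R N.
have cc' : nrm (c - c') <= 1 / 10.
  by have -> : c - c' = c - 1 - eN R N * (c - 1) * eN R N by rewrite /c'; nring.
have uc' : ucont c'.
  have sU := csub_ucont R; have ue : ucont (eN R N).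
    by move=> e e0; exists 1 => // s t _; rewrite !ev_eN subrr nrm0 ltW.
  exact: (csD sU (cs1 sU) (csM sU (csM sU ue (csB sU ucc (cs1 sU))) ue)).
apply: (@twist_obstruction c') => //.
- rewrite /c' ev_window ev1; have sD := csub_dbl R.
  have de : dbl (eN R N) by rewrite -hop1; exact: dbl_hop.
  exact: (csD sD (cs1 sD) (csM sD (csM sD de (csB sD dc (cs1 sD))) de)).
- by rewrite /c' ev_window ev1 c0 subrr mulr0 mul0r addr0.
- exists N; have -> : c' - 1 = eN R N * (c - 1) * eN R N by rewrite /c'; nring.
  exact: supp_cut.
have uE : twist * base = u.
  by rewrite twist_base -mulrA bb1 mulr1.
have -> : 1 - star c' * twist * base * c' * star base =
    (1 - star c * u * c * star base) + star (c - c') * u * c * star base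
    + star c' * u * (c - c') * star base.
  rewrite star_sub -uE; nring.
have e1 : 1 - star c * u * c * star base = star c * (c * base * star c - u) * c * star base.
  have -> : star c * (c * base * star c - u) * c * star base =
    (star c * c) * base * (star c * c) * star base - star c * u * c * star base by nring.
  by rewrite uc.1 mul1r mulr1 bb2.
rewrite e1; have nc := n1 _ uc; have nu := n1 _ uu.
have nb : nrm (star base) = 1 by rewrite nrm_star; exact: n1 (conj bb1 bb2).
have nc' : nrm c' <= 11 / 10.
  rewrite -[c'](subKr c); apply: le_trans (nrmB _ _) _; rewrite nc; lra.
have m4 (a b d : A) : nrm (a * b * d * star base) <= nrm a * nrm b * nrm d.
  apply: le_trans (nrmM _ _) _; rewrite nb mulr1; apply: le_trans (nrmM _ _) _.
  by rewrite ler_wpM2r ?nrm_ge0// nrmM.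
apply: le_trans (nrmD _ _) _; apply: le_trans (lerD (nrmD _ _) (lexx _)) _.
apply: le_trans (lerD (lerD (m4 _ _ _) (m4 _ _ _)) (m4 _ _ _)) _.
rewrite !nrm_star nc nu nrmBC.
by move: h2 cc' nc' (nrm_ge0 c') (nrm_ge0 (c - c')); clear; gen_norms; nra.
Qed.
End Obstruction.

(** * Equivalence in matrices of size two *)

Section GaugePath.
Variable R : realType.
Local Notation C := R[i].
Local Notation H := (hilb R).
Local Notation A := (fam R).
Implicit Types (t s : R) (b c : bool).

(* The 4x4 unitary [1 + (g - 1) Pi], where [Pi] is the projection onto the span of
   [(false, false)] and [x (false, true) + y (true, false)]; the first component of an
   index is the doubling, the second one is the index of the 2x2 matrices over [A]. *)
Definition gv (x y : R) b c : C := if b then (if c then 0 else rc y) else (if c then rc x else 0).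
Definition gp (x y : R) b c b' c' : C :=
  (~~ b && ~~ c)%:R * (~~ b' && ~~ c')%:R + gv x y b c * gv x y b' c'.
Definition gm (g : C) (x y : R) b c b' c' : C :=
  ((b == b') && (c == c'))%:R + (g - 1) * gp x y b c b' c'.
Lemma gvJ x y b c : (gv x y b c)^* = gv x y b c.
Proof. by case: b; case: c; rewrite /gv ?rcJ ?conjC0. Qed.
Lemma gpJ x y b c b' c' : (gp x y b c b' c')^* = gp x y b c b' c'.
Proof. by rewrite /gp rmorphD /= !rmorphM /= !gvJ !conjC_nat. Qed.
Lemma gp_sym x y b c b' c' : gp x y b c b' c' = gp x y b' c' b c.
Proof. by rewrite /gp [X in X + _]mulrC [X in _ + X]mulrC. Qed.
Lemma gp_idem x y b c b' c' : x ^+ 2 + y ^+ 2 = 1 ->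
  gp x y b c false false * gp x y false false b' c' + gp x y b c true false * gp x y true false b' c'
  + (gp x y b c false true * gp x y false true b' c' + gp x y b c true true * gp x y true true b' c')
  = gp x y b c b' c'.
Proof.
move=> xy; have h : rc x * rc x = 1 - rc y * rc y :> C.
  rewrite -!rcM -[1]/(rc 1) -rcN -rcD; congr rc; rewrite -xy; ring.
by case: b; case: c; case: b'; case: c'; rewrite /gp /gv /=; ring: h.
Qed.
Lemma gmJ g x y b c b' c' : (gm g x y b c b' c')^* = gm g^* x y b' c' b c.
Proof.
rewrite /gm rmorphD /= rmorphM /= rmorphB /= conjC1 gpJ gp_sym conjC_nat.
by rewrite [b == _]eq_sym [c == _]eq_sym.
Qed.
(** As Pi is idempotent, (1 + (g - 1) Pi)(1 + (g' - 1) Pi) = 1 + (g g' - 1) Pi. The sum runs over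
    the four intermediate index pairs. *)
Lemma gm_mul g g' x y b c b' c' : x ^+ 2 + y ^+ 2 = 1 -> g * g' = 1 ->
  gm g x y b c false false * gm g' x y false false b' c' + gm g x y b c true false * gm g' x y true false b' c'
  + (gm g x y b c false true * gm g' x y false true b' c' + gm g x y b c true true * gm g' x y true true b' c')
  = ((b == b') && (c == c'))%:R.
Proof.
move=> xy gg'; have idem := gp_idem b c b' c' xy.
have E : (g - 1) * (g' - 1) = - (g - 1) - (g' - 1) by rewrite mulrBl !mulrBr gg'; ring.
rewrite /gm; set S := (X in X = _).
have -> : S = ((b == b') && (c == c'))%:R + (g - 1) * gp x y b c b' c' + (g' - 1) * gp x y b c b' c'
   + (g - 1) * (g' - 1) * gp x y b c b' c'; last by rewrite E; ring.
rewrite -{3}idem /S; clear.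
by case: b; case: c; case: b'; case: c'; rewrite /=; ring.
Qed.
Lemma cabs_gv x y b c : `|x| <= 1 -> `|y| <= 1 -> cabs (gv x y b c) <= 1.
Proof. by move=> hx hy; case: b; case: c; rewrite /gv ?cabs0 ?ler01// cabs_rc. Qed.
Lemma cabs_gp x y b c b' c' : `|x| <= 1 -> `|y| <= 1 -> cabs (gp x y b c b' c') <= 2.
Proof.
move=> hx hy; apply: le_trans (cabsD _ _) _.
have -> : (2 : R) = 1 + 1 by [].
apply: lerD; rewrite cabsM; last by rewrite mulr_ile1 ?cabs_ge0 ?cabs_gv.
by case: (_ && _); case: (_ && _); rewrite ?cabs0 ?cabs1 ?mulr0 ?mulr1 ?ler01.
Qed.
Lemma gm_dist g g' x x' y y' b c b' c' : cabs g' = 1 ->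
  `|x| <= 1 -> `|y| <= 1 -> `|x'| <= 1 -> `|y'| <= 1 ->
  cabs (gm g x y b c b' c' - gm g' x' y' b c b' c') <= 2 * cabs (g - g') + 4 * (`|x - x'| + `|y - y'|).
Proof.
move=> g1 hx hy hx' hy'.
have -> : gm g x y b c b' c' - gm g' x' y' b c b' c' =
  (g - g') * gp x y b c b' c' + (g' - 1) * (gp x y b c b' c' - gp x' y' b c b' c') by rewrite /gm; ring.
have dv d e : cabs (gv x y d e - gv x' y' d e) <= `|x - x'| + `|y - y'|.
  case: d; case: e; rewrite /gv ?subrr ?cabs0 ?addr_ge0//.
    by rewrite -rcN -rcD cabs_rc lerDr.
  by rewrite -rcN -rcD cabs_rc lerDl.
have dp : cabs (gp x y b c b' c' - gp x' y' b c b' c') <= 2 * (`|x - x'| + `|y - y'|).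
  have -> : gp x y b c b' c' - gp x' y' b c b' c' =
    gv x y b c * (gv x y b' c' - gv x' y' b' c') + (gv x y b c - gv x' y' b c) * gv x' y' b' c'.
    by rewrite /gp; ring.
  apply: le_trans (cabsD _ _) _; rewrite !cabsM mulr_natl mulr2n; apply: lerD.
    by rewrite -[leRHS]mul1r ler_pM ?cabs_ge0 ?cabs_gv.
  by rewrite -[leRHS]mulr1 ler_pM ?cabs_ge0 ?cabs_gv.
have n2 : cabs (g' - 1) <= 2 by apply: le_trans (cabsB _ _) _; rewrite g1 cabs1.
apply: le_trans (cabsD _ _) _; rewrite !cabsM; apply: lerD.
  by rewrite mulrC ler_wpM2r ?cabs_ge0 ?cabs_gp.
have -> : (4 : R) = 2 * 2 by rewrite -natrM.
by rewrite -mulrA ler_pM ?cabs_ge0.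
Qed.

Variable d : R.
Hypothesis d0 : 0 < d.
(* The position along the gauge path runs slowly from [0] to [2] along the even half of the
   orbit of [sig] and rests at [2] on the odd half. On [0, 1] the range of [Pi] is rotated onto
   a doubled one with the phase [gg t]; on [1, 2] that phase is deformed to [1]. *)
Definition gpos (n : nat) : R := if odd n then 2 else n./2%:R * d.
Definition gx n : R := Num.sqrt (1 - clamp (gpos n)).
Definition gy n : R := Num.sqrt (clamp (gpos n)).
Definition gph t n : C := gg (clamp t * clamp (2 - gpos n)).
Lemma gxy n : gx n ^+ 2 + gy n ^+ 2 = 1.
Proof.
rewrite /gx /gy !sqr_sqrtr ?clamp_ge0 ?subr_ge0 ?clamp_le1//.
by rewrite subrK.
Qed.
Lemma gx1 n : `|gx n| <= 1.
Proof.
rewrite ger0_norm ?sqrtr_ge0// -sqrtr1 ler_wsqrtr//.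
by have := clamp_ge0 (gpos n); lra.
Qed.
Lemma gy1 n : `|gy n| <= 1.
Proof. by rewrite ger0_norm ?sqrtr_ge0// -[leRHS]sqrtr1 ler_wsqrtr// clamp_le1. Qed.
Lemma gphJ t n : (gph t n)^* * gph t n = 1. Proof. exact: ggJ. Qed.
Lemma gph_abs t n : cabs (gph t n) = 1. Proof. exact: cabs_gg. Qed.
Definition gent c c' t n b b' : C := gm (gph t n) (gx n) (gy n) b c b' c'.
Lemma gent_bd c c' t n b b' : cabs (gent c c' t n b b') <= 5.
Proof.
rewrite /gent /gm; apply: le_trans (cabsD _ _) _.
have -> : (5 : R) = 1 + 2 * 2 by rewrite -natrM -natr1 addrC.
apply: lerD; first by case: (_ && _); rewrite ?cabs0 ?cabs1 ?ler01.
rewrite cabsM ler_pM ?cabs_ge0 ?cabs_gp ?gx1 ?gy1//.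
by apply: le_trans (cabsB _ _) _; rewrite gph_abs cabs1.
Qed.
Lemma bdm_gent c c' : bdm (gent c c').
Proof. by exists 5; split=> // t n b b'; exact: gent_bd. Qed.
(** One entry of a 2 x 2 matrix over the path algebra, acting in turn by 2 x 2 matrices on the
    fibres. *)
Definition gauge c c' : A := locked_with lock_key (gop (bdm_gent c c')).
Lemma gaugeE c c' t (v : H) n b : op (gauge c c') t v (n, b) =
  gent c c' t n b false * v (n, false) + gent c c' t n b true * v (n, true).
Proof. by rewrite /gauge locked_withE op_gop. Qed.
Lemma gauge_starE c c' t (v : H) n b : op (star (gauge c c')) t v (n, b) =
  (gent c c' t n false b)^* * v (n, false) + (gent c c' t n true b)^* * v (n, true).
Proof.
by rewrite /gauge locked_withE (star_gop _ (bdm_adj (bdm_gent c c'))) op_gop.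
Qed.
Lemma nrm_gauge c c' : nrm (gauge c c') <= 10.
Proof.
rewrite /gauge locked_withE; have -> : (10 : R) = 2 * 5 by rewrite -natrM.
by apply: nrm_gop => // t n b b'; exact: gent_bd.
Qed.
Lemma op_natb (z : bool) t (v : H) k : op (z%:R : A) t v k = z%:R * v k.
Proof. by case: z; rewrite ?op_one ?mul1r// op_zero mul0r. Qed.
Lemma gauge_unitary_l c c' :
  star (gauge false c) * gauge false c' + star (gauge true c) * gauge true c' = (c == c')%:R.
Proof.
apply: fam_eq => t v; apply: hvP2 => -[n b].
rewrite op_natb op_add hvDE !op_mul !gauge_starE !gaugeE !gmJ.
have h b' := gm_mul b c b' c' (gxy n) (gphJ t n).
have -> : (c == c')%:R * v (n, b) = \sum_(b' <- [:: false; true]) ((b == b') && (c == c'))%:R * v (n, b').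
  rewrite !big_cons big_nil addr0; case: b {h}; rewrite /= mul0r ?add0r ?addr0//.
rewrite !big_cons big_nil addr0 -!h /gent; ring.
Qed.
Lemma gauge_unitary_r c c' :
  gauge c false * star (gauge c' false) + gauge c true * star (gauge c' true) = (c == c')%:R.
Proof.
apply: fam_eq => t v; apply: hvP2 => -[n b].
rewrite op_natb op_add hvDE !op_mul !gaugeE !gauge_starE !gmJ.
have gg' : gph t n * (gph t n)^* = 1 by rewrite mulrC gphJ.
have h b' := gm_mul b c b' c' (gxy n) gg'.
have -> : (c == c')%:R * v (n, b) = \sum_(b' <- [:: false; true]) ((b == b') && (c == c'))%:R * v (n, b').
  rewrite !big_cons big_nil addr0; case: b {h}; rewrite /= mul0r ?add0r ?addr0//.
rewrite !big_cons big_nil addr0 -!h /gent; ring.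
Qed.

Lemma gent_rest c c' t n b b' : gph t n = 1 -> gent c c' t n b b' = ((b == b') && (c == c'))%:R.
Proof. by move=> h; rewrite /gent /gm h subrr mul0r addr0. Qed.
Lemma clamp_ge1 (r : R) : 1 <= r -> clamp r = 1.
Proof.
move=> h; rewrite /clamp (max_idPr (le_trans ler01 h)).
exact/min_idPl.
Qed.
Lemma clamp_le0 (r : R) : r <= 0 -> clamp r = 0.
Proof. by move=> h; rewrite /clamp (max_idPl h) (min_idPr ler01). Qed.
Lemma gph_far t n : 2 <= gpos n -> gph t n = 1.
Proof. by move=> h; rewrite /gph (@clamp_le0 (2 - _)) ?subr_le0// mulr0 gg0. Qed.
Lemma gph_0 n : gph 0 n = 1. Proof. by rewrite /gph clamp0 mul0r gg0. Qed.
Lemma gph_1 n : gpos n <= 1 -> gph 1 n = 1.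
Proof. by move=> h; rewrite /gph clamp1 mul1r clamp_ge1 ?gg1//; lra. Qed.
Lemma ev0_gauge c c' : ev 0 (gauge c c') = (c == c')%:R.
Proof.
apply: fam_eq => t v; apply: hvP2 => -[n b]; rewrite op_ev gaugeE !gent_rest ?gph_0// op_natb.
by case: b; rewrite /= mul0r ?add0r ?addr0.
Qed.
Lemma dbl_fibre (a : A) (z : nat -> C) : (forall t v n b, op a t v (n, b) = z n * v (n, b)) -> dbl a.
Proof.
move=> h; split=> /=; apply: fam_eq => t v; apply: hvP2 => -[n b]; rewrite !op_mul ?Xop_E ?Zop_E !h.
  by rewrite Xop_E.
by rewrite Zop_E /= mulrCA.
Qed.
Lemma dbl_natb (z : bool) : dbl (z%:R : A).
Proof. by case: z; [exact: cs1 (csub_dbl R)|exact: cs0 (csub_dbl R)]. Qed.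
(** Up to position 1 the phase is gg(1) = 1 and the gauge is trivial. Beyond it x = 0 and y = 1, so
    Pi selects the first matrix index and acts as 1_2 on the doubling. *)
Lemma dbl_ev1_gauge c c' : dbl (ev 1 (gauge c c')).
Proof.
apply: (@dbl_fibre _ (fun n => (c == c')%:R * (if c then 1 else gph 1 n))) => t v n b.
rewrite op_ev gaugeE; case: (leP (gpos n) 1) => h.
  rewrite !gent_rest ?gph_1// if_same mulr1.
  by case: b; rewrite /= mul0r ?add0r ?addr0.
have hx : gx n = 0 by rewrite /gx clamp_ge1 ?subrr ?sqrtr0// ltW.
have hy : gy n = 1 by rewrite /gy clamp_ge1 ?sqrtr1// ltW.
rewrite /gent hx hy /gm /gp /gv; have -> : rc 0 = 0 :> C by [].
have -> : rc 1 = 1 :> C by [].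
by case: b; case: c; case: c'; rewrite /=; ring.
Qed.
Lemma MM_gauge c c' : MM (gauge c c').
Proof.
split; split.
- move=> e e0; have e4 : 0 < e / 4 by rewrite divr_gt0.
  have [r r0 hr] := (ucC_gg R).2 _ e4; exists r => // s t st.
  have bd : bdm (fun=> (fun n b b' => gent c c' s n b b' - gent c c' t n b b')).
    exists (5 + 5); split=> [|_ n b b']; first by rewrite addr_ge0.
    by apply: le_trans (cabsB _ _) _; rewrite lerD ?gent_bd.
  have -> : ev s (gauge c c') - ev t (gauge c c') = gop bd.
    apply: fam_eq => q v; apply: hvP2 => -[n b].
    by rewrite op_add op_opp hvDE hvNE !op_ev !gaugeE op_gop /=; ring.
  have -> : e = 2 * (e / 2) by rewrite mulrC divfK.
  apply: nrm_gop => [|q n b b']; first by rewrite divr_ge0// ltW.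
  rewrite /gent; apply: le_trans (gm_dist _ b c b' c' (gph_abs t n) (gx1 n) (gy1 n) (gx1 n) (gy1 n)) _.
  rewrite !subrr normr0 addr0 mulr0 addr0; have -> : e / 2 = 2 * (e / 4) by field.
  rewrite ler_wpM2l//; apply: hr.
  rewrite -mulrBl normrM; apply: le_trans st.
  apply: le_trans (clamp_lip s t); rewrite -[leRHS]mulr1 ler_wpM2l//.
  by rewrite ger0_norm ?clamp_ge0// clamp_le1.
- move=> t; apply: fam_eq => s v; apply: hvP2 => -[n b].
  by rewrite !op_ev !gaugeE /gent /gph clampK.
- split; rewrite /kpath /= ev0_gauge; last exact: dbl_natb.
  (* Even indices from 2K on have position at least K d >= 2, and odd ones rest at 2; outside this
     window the gauge is 1. *)
  pose K := Num.bound (2 / d).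
  have hK : 2 <= K%:R * d.
    by rewrite -ler_pdivrMr// ltW// /K archi_boundP// divr_ge0// ltW.
  apply: (@KK_supp _ K.*2); apply: fam_eq => t v; apply: hvP2 => -[n b].
  rewrite !op_mul eN_E !(op_add, op_opp) !(hvDE, hvNE) !gaugeE !op_natb !eN_E /=.
  case: (ltnP n K.*2) => nK; first by rewrite !mul1r.
  have gK : gph t n = 1.
    apply: gph_far; rewrite /gpos; case: (odd n) => //; apply: le_trans hK _.
    by rewrite ler_wpM2r ?(ltW d0)// ler_nat -[K]doubleK half_leq.
  rewrite !mul0r !gent_rest//.
  by case: b; rewrite /= mul0r ?add0r ?addr0 subrr.
- exact: dbl_ev1_gauge.
Qed.

(** Conjugation by the shift compares the gauge at neighbouring points of the orbit. From 1 to 0 it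
    jumps from the identity to phase [gg t] on the fibre vector [false], which the twist in [u0]
    accounts for exactly; elsewhere the position changes by at most d. Entries then change by at
    most 2 (e/4) + 4 (e/16 + e/16) = e, and the fibre size doubles this in norm. *)
Lemma gauge_step e : (forall s t, `|s - t| <= d -> cabs (gg s - gg t) <= e / 4) ->
  Num.sqrt d <= e / 16 -> forall c c', nrm (u0 R * gauge c c' - gauge c c' * v0 R) <= 2 * e.
Proof.
move=> he hd c c'.
have [v1 v2] := v0_unitary R.
have e0 : 0 <= e by have := sqrtr_ge0 d; lra.
have sh t (x : H) n b : op (v0 R) t (op (gauge c c') t (op (star (v0 R)) t x)) (n, b) =
    gent c c' t (sigi n) b false * x (n, false) + gent c c' t (sigi n) b true * x (n, true).
  have E (y : H) (m : nat) (b' : bool) : op (v0 R) t y (m, b') = y (sigi m, b').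
    have -> : op (v0 R) t y (m, b') = op (v0 R) t y (sig (sigi m), b') by rewrite sigiK.
    by rewrite -[LHS](op_starS (@sigp_inj) t (op (v0 R) t y) (sigi m, b')) -op_mul v1 op_one.
  rewrite E gaugeE; have F (b' : bool) : op (star (v0 R)) t x (sigi n, b') = x (n, b').
    by rewrite op_starS /= sigiK.
  by rewrite !F.
pose df t n b b' := wt t (n, b) * gent c c' t (sigi n) b b' - gent c c' t n b b'.
have dfE t n b b' : cabs (df t n b b') <= e.
  rewrite /df; case: n => [|[|n]].
  - rewrite /sigi /= gent_rest; last exact: gph_far.
    have p0 : gpos 0 = 0 by rewrite /gpos /= mul0r.
    have hx : gx 0 = 1 by rewrite /gx p0 clamp0 subr0 sqrtr1.
    have hy : gy 0 = 0 by rewrite /gy p0 clamp0 sqrtr0.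
    have hg : gph t 0 = gg t.
      by rewrite /gph p0 subr0 (@clamp_ge1 2) ?ler1n// mulr1 gg_clamp.
    rewrite /gent hx hy hg /wt /gm /gp /gv; have -> : rc 0 = 0 :> C by [].
    have -> : rc 1 = 1 :> C by [].
    have -> : (if ((0%N, b) : idx) == (0%N, false) then gg t else 1) = (if b then 1 else gg t).
      by case: b.
    set X := (X in cabs X); have -> : X = 0; last by rewrite cabs0.
    rewrite /X {X}; clear; case: b; case: b'; case: c; case: c'; rewrite /=; ring.
  - rewrite /sigi /= !gent_rest; try by apply: gph_far; rewrite /gpos.
    by rewrite /wt /= mul1r subrr cabs0.
  - have wtE : wt t (n.+2, b) = 1 by [].
    rewrite wtE mul1r /sigi /= negbK.
    case on : (odd n).
      rewrite !gent_rest; try by apply: gph_far; rewrite /gpos /= ?negbK on.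
      by rewrite subrr cabs0.
    have pE : gpos n.+2 = gpos n + d.
      by rewrite /gpos /= negbK on -natr1 mulrDl mul1r.
    apply: le_trans (gm_dist _ b c b' c' (gph_abs _ _) (gx1 _) (gy1 _) (gx1 _) (gy1 _)) _.
    have dc : `|clamp (gpos n) - clamp (gpos n.+2)| <= d.
      by apply: le_trans (clamp_lip _ _) _; rewrite pE opprD addNKr normrN ger0_norm// ltW.
    have h1 : cabs (gph t n - gph t n.+2) <= e / 4.
      apply: he; rewrite -mulrBr normrM -[leRHS]mul1r ler_pM//.
        by rewrite ger0_norm ?clamp_ge0// clamp_le1.
      apply: le_trans (clamp_lip _ _) _; rewrite pE.
      have -> : 2 - gpos n - (2 - (gpos n + d)) = d by ring.
      by rewrite ger0_norm// ltW.
    have h2 : `|gx n - gx n.+2| <= e / 16.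
      apply: le_trans (sqrt_dist _ _) _; rewrite ?subr_ge0 ?clamp_le1//.
      apply: le_trans hd; apply: ler_wsqrtr.
      have -> : 1 - clamp (gpos n) - (1 - clamp (gpos n.+2)) = - (clamp (gpos n) - clamp (gpos n.+2)) by ring.
      by rewrite normrN.
    have h3 : `|gy n - gy n.+2| <= e / 16.
      apply: le_trans (sqrt_dist _ _) _; rewrite ?clamp_ge0//.
      by apply: le_trans hd; apply: ler_wsqrtr.
    by move: h1 h2 h3; clear; move: (cabs _) `|_ - _| `|_ - _| => p q r; lra.
have bdf : bdm df by exists e; split.
have -> : u0 R * gauge c c' - gauge c c' * v0 R = gop bdf * v0 R.
  have -> : gop bdf = K0 R * (v0 R * gauge c c' * star (v0 R)) - gauge c c'.
    apply: fam_eq => t x; apply: hvP2 => -[n b].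
    rewrite op_add op_opp hvDE hvNE [op (K0 R * _) _ _]op_mul K0E !op_mul sh gaugeE op_gop /df /=.
    ring.
  have -> : (K0 R * (v0 R * gauge c c' * star (v0 R)) - gauge c c') * v0 R =
    K0 R * v0 R * gauge c c' * (star (v0 R) * v0 R) - gauge c c' * v0 R by nring.
  by rewrite v1 mulr1 u0E.
apply: le_trans (nrmM _ _) _; have : nrm (v0 R) <= 1 by exact: nrm_Sop.
have : nrm (gop bdf) <= 2 * e by apply: nrm_gop.
by move=> p q; rewrite -[leRHS]mulr1 ler_pM ?nrm_ge0.
Qed.
End GaugePath.

Lemma gauge_exists (R : realType) (e : R) : 0 < e -> exists W : bool -> bool -> fam R,
  [/\ forall c c', MM (W c c'), forall c c', nrm (W c c') <= 10,
    forall c c', nrm (u0 R * W c c' - W c c' * v0 R) <= e,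
    forall c c', star (W false c) * W false c' + star (W true c) * W true c' = (c == c')%:R
    & forall c c', W c false * star (W c' false) + W c true * star (W c' true) = (c == c')%:R].
Proof.
move=> e0; have e8 : 0 < e / 2 / 4 by rewrite !divr_gt0.
have [r r0 hr] := (ucC_gg R).2 _ e8.
have q0 : 0 < e / 2 / 16 by rewrite !divr_gt0.
have d0 : 0 < Num.min r ((e / 2 / 16) ^+ 2) by rewrite lt_min r0 exprn_gt0.
exists (gauge (Num.min r ((e / 2 / 16) ^+ 2))); split.
- exact: MM_gauge d0.
- exact: nrm_gauge.
- move=> c c'; have E : e = 2 * (e / 2) by rewrite mulrC divfK.
  rewrite [leRHS]E; apply: (@gauge_step _ _ d0 (e / 2)) => [s t st|].
    by apply: hr; apply: le_trans st _; rewrite ge_min lexx.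
  rewrite -[leRHS](ger0_norm (ltW q0)) -[leRHS]sqrtr_sqr; apply: ler_wsqrtr.
  by rewrite ge_min lexx orbT.
- exact: gauge_unitary_l.
- exact: gauge_unitary_r.
Qed.

(** * The C*-algebra *)

Section LimitProjections.
Variable R : realType.
Local Notation A := (fam R).
Implicit Types (a b p q x y : A).

Lemma ueq_jn n a b : ueq (@MM R) a b -> ueq (@AA R) (jn n a) (jn n b).
Proof.
move=> [u [hu [u1 u2] <-]]; exists (jn n u); split; first exact: AA_jn.
  by split; rewrite -jnS -jnM ?u1 ?u2 jn1.
by rewrite -jnS -!jnM.
Qed.
Lemma MM_dd : MM (dd R). Proof. exact: MM_const (@ev_dd R) (@dbl_dd R). Qed.
Lemma dd_nontrivial : dd R <> 0 /\ dd R <> 1.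
Proof.
split=> h.
  have := congr1 (fun x => op x 0 (be R (0%N, false))) h; rewrite ddE hs_be op_zero /= scale1r.
  by move=> /(congr1 (@hn R)); rewrite hn_be hn0 => /eqP; rewrite oner_eq0.
have := congr1 (fun x => op x 0 (be R (1%N, false))) h; rewrite ddE hs_be op_one /= scale0r.
by move=> /(congr1 (@hn R)); rewrite hn_be hn0 => /eqP; rewrite eq_sym oner_eq0.
Qed.
(** [jn n] of [dd] is [jn n.+1] of [theta dd], and [theta dd] is equivalent to [dd]; all stages
    therefore share one reference projection. *)
Lemma jn_dd n : ueq (@AA R) (jn n (dd R)) (jn 0 (dd R)).
Proof.
elim: n => [|n IH]; first exact: ueq_refl (csub_AA R).
apply: (ueq_trans (csub_AA R)) IH; apply: (ueq_sym (csub_AA R)); rewrite -jn_theta.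
apply: ueq_jn; have [h0 h1] := dd_nontrivial.
exact: theta_projection MM_dd (projection_dd R) h0 h1.
Qed.
Lemma AA_projection p : AA p -> projection p -> p <> 0 -> p <> 1 -> ueq (@AA R) p (jn 0 (dd R)).
Proof.
move=> hp prp p0 p1; have [sp pp] := prp; have sM := csub_MM R; have sA := csub_AA R.
(* The constant 1/100 gives |z^2 - z| <= 1/25, so the projection p' near z has jn(p') within 1/100 +
   8/25 < 1/2 of p. This also excludes p' = 0 and p' = 1. *)
have [n [x [hx px]]] := hp _ (divr_gt0 ltr01 (ltr0Sn R 99)).
pose z : A := (2^-1 : R[i]) *: (x + star x).
have hz : MM z by apply: (csZ sM); exact: (csD sM hx (csS sM hx)).
have two : (2^-1 : R[i]) = rc 2^-1.
  by apply/eqP; rewrite -[2]/(1 + 1 : R[i]) -(rc1 R) -rcD eq_complex /= !expr0n /= !addr0 mul0r oppr0 eqxx andbT; apply/eqP; field.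
have sz : star z = z.
  by rewrite /z two star_scale rcJ starD starK addrC.
pose y := jn n z.
have py : nrm (p - y) <= 1 / 100.
  have -> : p - y = (2^-1 : R[i]) *: ((p - jn n x) + star (p - jn n x)).
    rewrite /y /z jnZ jnD jnS star_sub sp.
    have -> : p - jn n x + (p - star (jn n x)) = (p + p) - (jn n x + star (jn n x)) by nring.
    rewrite scalerBr; congr (_ - _).
    by rewrite -[p in RHS]scale1r -scalerDl scalerA mulVf ?scale1r// pnatr_eq0.
  rewrite nrmZ two cabs_rc ger0_norm ?invr_ge0//.
  have := nrmD (p - jn n x) (star (p - jn n x)); rewrite nrm_star.
  by move: px; gen_norms; lra.
have np : nrm p = 1 by exact: nrm_projection.
have yy : nrm (z * z - z) <= 1 / 25.
  rewrite -(nrm_jn n) jnB jnM -/y.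
  have -> : y * y - y = (p - y) * (p - y) - p * (p - y) - (p - y) * p + (p - y) + (p * p - p) by nring.
  rewrite pp subrr addr0; apply: le_trans (nrmD _ _) _.
  apply: le_trans (lerD (nrmB _ _) (lexx _)) _.
  apply: le_trans (lerD (lerD (nrmB _ _) (lexx _)) (lexx _)) _.
  have h1 := nrmM (p - y) (p - y); have h2 := nrmM p (p - y); have h3 := nrmM (p - y) p.
  by rewrite np in h2 h3; move: h1 h2 h3 py (nrm_ge0 (p - y)); clear; gen_norms; nra.
have [|p' [pr' np' B' _]] := near_projection sz; first by apply: le_trans yy _; lra.
have hp' : MM p' := B' _ sM hz.
have pj : nrm (p - jn n p') <= 2^-1.
  have -> : p - jn n p' = (p - y) - jn n (p' - z) by rewrite /y jnB; nring.
  apply: le_trans (nrmB _ _) _; rewrite nrm_jn; move: py np' yy; clear; gen_norms; lra.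
have prj : projection (jn n p') by case: pr' => h1 h2; split; rewrite -?jnS -?jnM ?h1 ?h2.
apply: (ueq_trans sA (near_ueq sA hp (AA_jn n hp') prp prj pj)).
apply: (ueq_trans sA _ (jn_dd n.+1)).
rewrite -jn_theta; apply: ueq_jn; apply: theta_projection => // h.
  have j0 : jn n (0 : A) = 0 by rewrite -(subrr (1 : A)) jnB !subrr.
  by move: pj; rewrite h j0 subr0 np; lra.
move: pj; rewrite h jn1 nrmBC nrm_projection; first by lra.
  exact: projectionB.
by move=> /eqP; rewrite subr_eq0 => /eqP/esym.
Qed.
Lemma AA_theta x : MM x -> AA (theta x).
Proof.
move=> hx; have -> : theta x = jn 0 x by rewrite /jn expr0 star_one mulr1 mul1r.
exact: AA_jn.
Qed.
End LimitProjections.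

(** * The limit as a C*-algebra *)

Section LimitAlgebra.
Variable R : realType.
Local Notation C := R[i].
Local Notation A := (fam R).

Definition inAA : {pred A} := fun x => `[< AA x >].
Lemma inAA_submod : submod_closed inAA.
Proof.
have sA := csub_AA R; split; first by apply/asboolP; exact: cs0.
move=> c x y /asboolP hx /asboolP hy; apply/asboolP.
exact: (csD sA (csZ sA c hx) hy).
Qed.
HB.instance Definition _ := GRing.isSubmodClosed.Build C A inAA inAA_submod.
Record calg := CAlg { cv : A; cvP : cv \in inAA }.
HB.instance Definition _ := [isSub for cv].
HB.instance Definition _ := [Choice of calg by <:].
HB.instance Definition _ := [SubChoice_isSubLmodule of calg by <:].
Implicit Types x y : calg.
Lemma cvAA x : AA (cv x). Proof. exact/asboolP/cvP. Qed.
Definition mkA (a : A) (ha : AA a) : calg := CAlg (asboolT ha).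
Lemma cvD x y : cv (x + y) = cv x + cv y. Proof. by []. Qed.
Lemma cvZ c x : cv (c *: x) = c *: cv x. Proof. by []. Qed.
Lemma cvB x y : cv (x - y) = cv x - cv y. Proof. by []. Qed.
Lemma cv0 : cv 0 = 0. Proof. by []. Qed.
Lemma cv_inj x y : cv x = cv y -> x = y. Proof. exact: val_inj. Qed.

Lemma rc_le (a b : R) : (rc a <= rc b :> C) = (a <= b).
Proof. by rewrite lecE /= eqxx. Qed.
Definition cnorm x : C := rc (nrm (cv x)).
Lemma cnormD x y : cnorm (x + y) <= cnorm x + cnorm y.
Proof. by rewrite /cnorm -rcD rc_le cvD nrmD. Qed.
Lemma cnormZ (c : C) x : cnorm (c *: x) = `|c| * cnorm x.
Proof. by rewrite /cnorm cvZ nrmZ normcE rcM. Qed.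
Lemma cnorm0_eq0 x : cnorm x = 0 -> x = 0.
Proof.
by move=> /(congr1 (@complex.Re R)) /= /nrm0_eq0 h; apply: cv_inj; rewrite h.
Qed.
HB.instance Definition _ := Lmodule_isNormed.Build C calg cnormD cnormZ cnorm0_eq0.
Lemma cnormE x : `|x| = rc (nrm (cv x)). Proof. by []. Qed.

Lemma pos_rc (e : C) : 0 < e -> e = rc (complex.Re e) /\ 0 < complex.Re e.
Proof.
rewrite ltcE /= => /andP[/eqP h0 h]; split=> //.
by case: e h0 h => a b /= -> _.
Qed.
Lemma ball_cv x y (e : R) : ball x (rc e) y = (nrm (cv x - cv y) < e) :> Prop.
Proof.
rewrite -ball_normE /= cnormE cvB; apply/propext.
by rewrite ltcE /= eqxx.
Qed.
Lemma archi_inv (e : R) : 0 < e -> exists K, forall k, (K <= k)%N -> k.+1%:R^-1 <= e.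
Proof.
move=> e0; exists (Num.bound e^-1) => k hk; rewrite invf_ple ?posrE ?ltr0n//.
apply: le_trans (_ : (Num.bound e^-1)%:R <= _); last by rewrite ler_nat leqW.
by apply: ltW; apply: archi_boundP; rewrite invr_ge0 ltW.
Qed.
(** Centres of balls of radius 1 / (n + 1) belonging to the filter form a Cauchy sequence of
    families; its limit stays in the closed set [AA]. *)
Lemma calg_complete (F : set_system calg) : ProperFilter F -> cauchy F -> cvg F.
Proof.
move=> FF /cauchyP cF.
have /choice[u hu] n : exists x, F (ball x (rc n.+1%:R^-1)).
  by apply: cF; rewrite ltcE /= eqxx invr_gt0 ltr0n.
have cu : ncauchy (fun n => cv (u n)).
  move=> e e0; have [K hK] := archi_inv (divr_gt0 e0 (ltr0Sn R 1)); exists K => k l /hK Kk /hK Kl.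
  have [z []] := filter_ex (filterI (hu k) (hu l)); rewrite !ball_cv => h1 h2.
  have -> : cv (u k) - cv (u l) = (cv (u k) - cv z) - (cv (u l) - cv z) by nring.
  apply: le_trans (nrmB _ _) _; rewrite (splitr e); apply: lerD; apply: le_trans (ltW _) _; eassumption.
have [a ha] := fam_complete cu.
have Aa : AA a.
  apply: (csC (csub_AA R)) => e /ha[K hK]; exists (cv (u K)); first exact: cvAA.
  by rewrite nrmBC; exact: hK.
apply/cvg_ex; exists (mkA Aa); apply/fcvgrPdist_lt => eps /pos_rc[he e0]; rewrite {}he.
move: (complex.Re eps) e0 => e e0 {eps}.
have e3 : 0 < e / 3 by rewrite divr_gt0.
have [K hK] := archi_inv e3; have [L hL] := ha _ e3.
have h1 := hK _ (leq_maxl K L); have h2 := hL _ (leq_maxr K L).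
apply: filterS (hu (maxn K L)) => y; rewrite ball_cv => h3.
rewrite cnormE cvB ltcE /= eqxx /=.
have -> : a - cv y = - (cv (u (maxn K L)) - a) + (cv (u (maxn K L)) - cv y) by nring.
apply: le_lt_trans (nrmD _ _) _; rewrite nrmN.
by move: h1 h2 h3 e0; move: (_^-1) => i; gen_norms; clear; lra.
Qed.
HB.instance Definition _ := Uniform_isComplete.Build calg calg_complete.

Definition cmul x y : calg := mkA (csM (csub_AA R) (cvAA x) (cvAA y)).
Definition cone : calg := mkA (cs1 (csub_AA R)).
Definition cstar x : calg := mkA (csS (csub_AA R) (cvAA x)).
Lemma cmulA : associative cmul. Proof. by move=> x y z; apply: cv_inj; rewrite /= mulrA. Qed.
Lemma cmul1 : left_id cone cmul. Proof. by move=> x; apply: cv_inj; rewrite /= mul1r. Qed.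
Lemma cmulr1 : right_id cone cmul. Proof. by move=> x; apply: cv_inj; rewrite /= mulr1. Qed.
Lemma cmulDl : left_distributive cmul +%R.
Proof. by move=> x y z; apply: cv_inj; rewrite /= mulrDl. Qed.
Lemma cmulDr : right_distributive cmul +%R.
Proof. by move=> x y z; apply: cv_inj; rewrite /= mulrDr. Qed.
Lemma cone_neq0 : cone != 0.
Proof. by apply/eqP => /(congr1 cv) /= /eqP; rewrite oner_eq0. Qed.
Lemma cscaleAl (c : C) x y : c *: cmul x y = cmul (c *: x) y.
Proof. by apply: cv_inj; rewrite /= scalerAl. Qed.
Lemma cscaleAr (c : C) x y : c *: cmul x y = cmul x (c *: y).
Proof. by apply: cv_inj; rewrite /= scalerAr. Qed.
Lemma cstarK : involutive cstar. Proof. by move=> x; apply: cv_inj; rewrite /= starK. Qed.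
Lemma cstarD : {morph cstar : x y / x + y}.
Proof. by move=> x y; apply: cv_inj; rewrite /= starD. Qed.
Lemma cstarM x y : cstar (cmul x y) = cmul (cstar y) (cstar x).
Proof. by apply: cv_inj; rewrite /= starM. Qed.
Lemma cstarZ (c : C) x : cstar (c *: x) = c^* *: cstar x.
Proof. by apply: cv_inj; rewrite /= star_scale. Qed.
Lemma cnormM x y : `|cmul x y| <= `|x| * `|y|.
Proof. by rewrite !cnormE -rcM rc_le nrmM. Qed.
Lemma cnormCstar x : `|cmul (cstar x) x| = `|x| ^+ 2.
Proof. by rewrite !cnormE /= nrm_cstar expr2 rcM -expr2. Qed.
HB.instance Definition _ := isCStarAlgebra.Build R calg cmulA cmul1 cmulr1 cmulDl cmulDr
  cone_neq0 cscaleAl cscaleAr cstarK cstarD cstarM cstarZ cnormM cnormCstar.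
End LimitAlgebra.

Lemma star1 (S : starRingType) : star (1 : S) = 1.
Proof.
have e : star (star (1 : S) * 1) = star 1 * 1 by rewrite starM starK.
by move: e; rewrite mulr1 starK.
Qed.
Lemma unitary1 (S : starRingType) : unitary (1 : S).
Proof. by split; rewrite star1 mulr1. Qed.

(** * Simplicity and pure infiniteness *)

Section LimitCStar.
Variable R : realType.
Local Notation C := R[i].
Local Notation A := (fam R).
Local Notation cA := (calg R : cstarAlgType R).
Local Notation AR := (ring_of cA).
Implicit Types (a b x y : AR).

Lemma cvM x y : cv (x * y) = cv x * cv y. Proof. by []. Qed.
Lemma cv1 : cv (1 : AR) = 1. Proof. by []. Qed.
Lemma cvS x : cv (star x) = star (cv x). Proof. by []. Qed.
Lemma cstar_normE x : cstar_norm x = nrm (cv x). Proof. by []. Qed.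
Lemma cv_neq0 x : x <> 0 -> cv x <> 0.
Proof. by move=> h e; apply: h; apply: cv_inj. Qed.
Lemma cv_projection x : projection x -> projection (cv x).
Proof. by move=> [h1 h2]; split; rewrite -?cvS -?cvM ?h1 ?h2. Qed.
Lemma mk_unitary (a : A) (ha : AA a) : unitary a -> unitary (mkA ha : AR).
Proof. by move=> [h1 h2]; split; apply: cv_inj; rewrite cvM cvS. Qed.
Lemma cv_unitary x : unitary x -> unitary (cv x).
Proof. by move=> [h1 h2]; split; rewrite -cvS -cvM ?h1 ?h2. Qed.
Lemma calg_corner x : x <> 0 -> exists y, star y * (star x * x) * y = 1.
Proof.
move=> x0; have [y hy e] := AA_corner (cvAA x) (cv_neq0 x0).
by exists (mkA hy : AR); apply: cv_inj; exact: e.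
Qed.

Lemma simple_calg : simple_cstar cA.
Proof.
move=> I [_ I0 _ _ Im].
have [[b Ib /calg_corner[y e]]|h] := EM (exists2 b, I b & b <> 0); [right|left].
  have I1 : I 1 by rewrite -e; apply: (Im _ _ (Im _ _ (Im _ _ Ib).1).1).2.
  by apply/seteqP; split=> // x _; rewrite -(mulr1 x); apply: (Im _ _ I1).1.
apply/seteqP; split=> [x Ix|x ->//] /=; by apply: contrapT => x0; apply: h; exists x.
Qed.

(* [c y (c y)^* <= N c^2] for a large scalar [N], as [1 - y y^* / N] has a square root. *)
Lemma corner_dominated x y : star x = x -> exists (k : C) g, k *: (x * x) - x * y * star (x * y) = star g * g.
Proof.
move=> sx; set z := cv y; pose m := nrm (z * star z) + 1.
have m0 : 0 < m by rewrite ltr_wpDl ?nrm_ge0.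
have m1 : (2 * m) != 0 by rewrite mulf_neq0 ?gt_eqF// pnatr_eq0.
pose s := Num.sqrt (2 * m).
have ss : rc s * rc s = rc (2 * m) :> C by rewrite -rcM -expr2 sqr_sqrtr// mulr_ge0 ?ler0n// ltW.
pose d : A := 1 - rc (2 * m)^-1 *: (z * star z).
have sd : star d = d by rewrite /d star_sub star_one star_scale rcJ starM starK.
have nd : nrm (1 - d) <= 2^-1.
  have -> : 1 - d = rc (2 * m)^-1 *: (z * star z) by rewrite /d opprB addrC subrK.
  rewrite nrmZ cabs_rc ger0_norm ?invr_ge0 ?mulr_ge0 ?ler0n ?(ltW m0)//.
  rewrite invfM -mulrA ger_pMr ?invr_gt0// mulrC ler_pdivrMr// mul1r.
  by rewrite lerDl.
have hd : AA d.
  have sA := csub_AA R; apply: (csB sA (cs1 sA)); apply: (csZ sA).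
  exact: (csM sA (cvAA y) (csS sA (cvAA y))).
have [r [sr rr B]] := sqrt_sa sd nd; have hr : AA r := B _ (csub_AA R) hd.
exists (rc (2 * m)), (rc s *: ((mkA hr : AR) * x)).
apply: cv_inj; rewrite cvB cvZ !cvM !cvS cvZ !cvM -/z.
have -> : star (rc s *: (r * cv x)) = rc s *: (cv x * r).
  by rewrite star_scale rcJ starM sr -cvS sx.
rewrite -scalerAl -scalerAr scalerA ss.
have -> : cv x * r * (r * cv x) = cv x * (r * r) * cv x by nring.
rewrite rr /d starM -cvS sx mulrBr mulrBl mulr1 scalerBr; congr (_ - _).
rewrite -scalerAr -scalerAl scalerA -rcM mulfV// rc1 scale1r; nring.
Qed.

Lemma AA_hs c : AA (theta (hs R c)).
Proof. by apply: AA_theta; apply: MM_const => [s|]; [exact: ev_hs|exact: dbl_hs]. Qed.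

Lemma purely_infinite_calg : purely_infinite cA.
Proof.
move=> B [_ B0 _ BZ [BM BS]] her Bn0.
have [[b Bb b0]|h] := EM (exists2 b, B b & b <> 0); last first.
  case: Bn0; apply/seteqP; split=> [x Ix|x ->//] /=; by apply: contrapT => x0; apply: h; exists x.
pose c := star b * b; have Bc : B c by apply: BM => //; exact: BS.
have sc : star c = c by rewrite /c starM starK.
have c0 : c <> 0.
  move=> /(congr1 (fun x : AR => nrm (cv x))) /=; rewrite nrm_cstar nrm0 => /eqP.
  by rewrite sqrf_eq0 => /eqP/nrm0_eq0; exact: cv_neq0.
have [y ey] := calg_corner c0.
(* [w] is an isometry whose range projection is dominated by a multiple of c^2, so heredity puts
   that projection into B. It is equivalent to 1, and the proper isometry s makes it infinite. *)
pose w := c * y; have ww : star w * w = 1 by rewrite /w starM -ey; nring.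
have [k [g hg]] : exists (k : C) g, k *: (c * c) - w * star w = star g * g.
  exact: corner_dominated.
clearbody w; pose s : AR := mkA (AA_hs false).
have s1 : star s * s = 1.
  by apply: cv_inj; rewrite cvM cvS /= -theta_star -thetaM hs_iso theta1.
have s2 : s * star s <> 1.
  move=> /(congr1 (fun x : AR => cv x)) /=; rewrite -theta_star -thetaM => h.
  have [_] := dd_nontrivial R; apply; rewrite ddE.
  apply/eqP; rewrite -subr_eq0; apply/eqP; apply: nrm0_eq0.
  by rewrite -nrm_theta thetaB theta1 h subrr nrm0.
have prp : projection (w * star w).
  split; first by rewrite starM starK.
  have -> : w * star w * (w * star w) = w * (star w * w) * star w by nring.
  by rewrite ww mulr1.
exists (w * star w).
  apply: (her _ (k *: (c * c))); last exact: BZ (BM _ _ Bc Bc).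
    by exists (w * star w); case: prp => -> ->.
  by exists g.
split=> //; exists (w * (s * star s) * star w); split.
- split; last first.
    have -> : w * star w * (w * (s * star s) * star w) = w * (star w * w) * (s * star s) * star w by nring.
    by rewrite ww mulr1.
  split; first by rewrite !starM !starK; nring.
  have -> : w * (s * star s) * star w * (w * (s * star s) * star w)
     = w * s * star s * (star w * w) * s * star s * star w by nring.
  rewrite ww mulr1.
  have -> : w * s * star s * s * star s * star w = w * s * (star s * s) * star s * star w by nring.
  by rewrite s1 mulr1 !mulrA.
- move=> e; apply: s2.
  have : star w * (w * (s * star s) * star w) * w = star w * (w * star w) * w by rewrite e.
  have -> : star w * (w * (s * star s) * star w) * w = (star w * w) * (s * star s) * (star w * w) by nring.
  have -> : star w * (w * star w) * w = (star w * w) * (star w * w) by nring.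
  by rewrite ww !mul1r mulr1.
- exists (w * s * star w); rewrite !starM !starK; split.
    have -> : w * (star s * star w) * (w * s * star w) = w * (star s * (star w * w) * s) * star w by nring.
    by rewrite ww mulr1 s1 mulr1.
  have -> : w * s * star w * (w * (star s * star w)) = w * s * (star w * w) * star s * star w by nring.
  by rewrite ww mulr1 !mulrA.
Qed.
End LimitCStar.

(** * The norm of matrices over the limit *)

Section ModuleNorm.
Variable R : realType.
Local Notation cA := (calg R : cstarAlgType R).
Local Notation AR := (ring_of cA).
Variable n : nat.
Implicit Types (x y : 'cV[AR]_n) (T U : 'M[AR]_n).

Lemma nrm_cv_sum (I : finType) (F : I -> AR) : nrm (cv (\sum_i F i)) <= \sum_i nrm (cv (F i)).
Proof.
elim/big_rec2: _ => [|i s a _ h]; first by rewrite nrm0.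
by rewrite cvD; apply: le_trans (nrmD _ _) _; rewrite lerD2l.
Qed.
Lemma cv_sum (I : finType) (F : I -> AR) : cv (\sum_i F i) = \sum_i cv (F i).
Proof. by elim/big_rec2: _ => // i s a _ h; rewrite cvD h. Qed.
(** The summands are positive, so on each vector a single one is dominated by the sum. *)
Lemma nrm_sum_cstar (I : finType) (F : I -> fam R) j :
  nrm (F j) ^+ 2 <= nrm (\sum_i star (F i) * F i).
Proof.
set S := \sum_i _; rewrite -[leRHS]sqr_sqrtr ?nrm_ge0// ler_sqr ?nnegrE ?sqrtr_ge0 ?nrm_ge0//.
apply: nrm_le => [|t v]; first exact: sqrtr_ge0.
apply: hn_le; first by rewrite mulr_ge0 ?sqrtr_ge0 ?hn_ge0.
rewrite exprMn sqr_sqrtr ?nrm_ge0//.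
apply: le_trans (_ : hdot (op S t v) v <= _).
  rewrite /S op_sum; have -> : hdot (\sum_i op (star (F i) * F i) t v) v
      = \sum_i hdot (op (F i) t v) (op (F i) t v).
    elim/big_rec2: _ => [|i r a _ h]; first by rewrite hdot0l.
    by rewrite hdotDl h op_mul op_star ad_op.
  by rewrite (bigD1 j)//= lerDl sumr_ge0// => i _; exact: hdot_ge0.
apply: le_trans (ler_norm _) _; apply: le_trans (hdot_CS _ _) _.
by rewrite expr2 mulrA ler_wpM2r ?hn_ge0 ?op_nrm.
Qed.
Lemma module_norm_ge x j : nrm (cv (x j 0)) <= module_norm x.
Proof.
rewrite -ler_sqr ?nnegrE ?sqrtr_ge0 ?nrm_ge0// sqr_sqrtr ?nrm_ge0// cstar_normE cv_sum.
exact: (nrm_sum_cstar (fun i => cv (x i 0))).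
Qed.
Lemma module_norm_le x : module_norm x <= \sum_i nrm (cv (x i 0)).
Proof.
have h0 : 0 <= \sum_i nrm (cv (x i 0)) by apply: sumr_ge0 => i _; exact: nrm_ge0.
rewrite -ler_sqr ?nnegrE ?sqrtr_ge0// sqr_sqrtr ?nrm_ge0// cstar_normE.
apply: le_trans (nrm_cv_sum _) _; rewrite expr2 mulr_suml; apply: ler_sum => i _.
rewrite cvM cvS nrm_cstar expr2 ler_wpM2l ?nrm_ge0// (bigD1 i)//= lerDl.
by apply: sumr_ge0 => k _; exact: nrm_ge0.
Qed.
Lemma module_norm_mul T x : module_norm x <= 1 ->
  module_norm (T *m x) <= \sum_i \sum_j nrm (cv (T i j)).
Proof.
move=> hx; apply: le_trans (module_norm_le _) _; apply: ler_sum => i _.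
rewrite mxE; apply: le_trans (nrm_cv_sum _) _; apply: ler_sum => j _.
rewrite cvM; apply: le_trans (nrmM _ _) _; rewrite ler_piMr ?nrm_ge0//.
exact: le_trans (module_norm_ge _ _) hx.
Qed.
Lemma module_norm0 : module_norm (0 : 'cV[AR]_n) = 0.
Proof.
rewrite /module_norm big1 ?cstar_normE ?nrm0 ?sqrtr0// => i _; by rewrite mxE mulr0.
Qed.
Lemma cstar_mxnorm_le T : cstar_mxnorm T <= \sum_i \sum_j nrm (cv (T i j)).
Proof.
apply: ge_sup.
  by exists (module_norm (T *m 0)), 0 => //=; rewrite module_norm0.
by move=> _ [x hx <-]; exact: module_norm_mul.
Qed.
Lemma cstar_mxnorm_ge T x : module_norm x <= 1 -> module_norm (T *m x) <= cstar_mxnorm T.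
Proof.
move=> hx; apply: ub_le_sup; last by exists x.
by exists (\sum_i \sum_j nrm (cv (T i j))) => _ [y hy <-]; exact: module_norm_mul.
Qed.
Lemma cstar_mxnorm_ge0 T : 0 <= cstar_mxnorm T.
Proof. by apply: le_trans (cstar_mxnorm_ge T (x := 0) _); rewrite ?module_norm0// sqrtr_ge0. Qed.

Lemma module_norm_unitary U x : star U * U = 1 -> module_norm (U *m x) = module_norm x.
Proof.
move=> UU; rewrite /module_norm; congr (Num.sqrt (cstar_norm _)).
have E y : \sum_i star (y i 0) * y i 0 = (map_mx star y^T *m y) 0 0.
  by rewrite mxE; apply: eq_bigr => i _; rewrite !mxE.
rewrite !E; have -> : map_mx star (U *m x)^T = map_mx star x^T *m star U.
  apply/matrixP => i j; rewrite !mxE (big_morph star (@starD AR) (star0 _)).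
  by apply: eq_bigr => k _; rewrite !mxE starM.
by rewrite -mulmxA (mulmxA (star U)) [star U *m U]UU mul1mx.
Qed.
(** Tested on the image of a standard basis column under [star U], the conjugated matrix produces a
    vector of norm |r| = 1. *)
Lemma cstar_mxnorm_unitary U (r : AR) : (0 < n)%N -> unitary U -> nrm (cv r) = 1 ->
  1 <= cstar_mxnorm (star U * r%:M * U).
Proof.
move=> n0 [U1 U2] hr; pose k : 'I_n := Ordinal n0; pose x : 'cV[AR]_n := delta_mx k 0.
have V1 : star (star U) * star U = 1 by rewrite starK.
have mx (s : AR) : module_norm (s *: x) = nrm (cv s).
  rewrite /module_norm (bigD1 k)//= big1 => [|i /negbTE ik].
    by rewrite addr0 !mxE !eqxx mulr1 cstar_normE cvM cvS nrm_cstar sqrtr_sqr ger0_norm ?nrm_ge0.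
  by rewrite !mxE ik /= mulr0 mulr0.
have h1 : module_norm (star U *m x) = 1.
  by rewrite module_norm_unitary// -[x]scale1r mx cv1 nrm1.
have E : star U * r%:M * U * star U = star U * r%:M by rewrite -mulrA U2 mulr1.
have {}E : (star U * r%:M * U) *m (star U *m x) = star U *m (r%:M *m x).
  exact: etrans (mulmxA _ _ _) (etrans (congr1 (mulmx^~ x) E) (esym (mulmxA _ _ _))).
rewrite -hr -mx -(module_norm_unitary _ V1) -mul_scalar_mx -E.
by apply: cstar_mxnorm_ge; rewrite h1.
Qed.
End ModuleNorm.

(** * Cancellation for projections and its failure for unitaries *)

Section KP.
Variable R : realType.
Local Notation A := (fam R).
Local Notation cA := (calg R : cstarAlgType R).
Local Notation AR := (ring_of cA).
Implicit Types (a b p q x y : AR).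

Lemma approx_unitary_equiv_of_unitary p q u :
  unitary u -> star u * p * u = q -> approx_unitary_equiv (@cstar_norm R cA) p q.
Proof.
move=> hu <-; exists (fun=> u); split=> //.
by under eq_fun do rewrite subrr cstar_normE nrm0; exact: cvg_cst.
Qed.

Definition trivial_proj p := p = 0 \/ p = 1.
Lemma nrm_trivial_sub p q : projection p -> projection q -> p <> q ->
  trivial_proj p \/ trivial_proj q -> nrm (cv (p - q)) = 1.
Proof.
have key (r s : AR) : projection s -> r <> s -> trivial_proj r -> nrm (cv (r - s)) = 1.
  move=> prs rs [r0|r1]; have prs' := cv_projection prs.
    rewrite cvB r0 cv0 sub0r nrmN; apply: nrm_projection => //.
    by apply: cv_neq0 => s0; apply: rs; rewrite s0.
  rewrite cvB r1 cv1; apply: nrm_projection; first exact: projectionB.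
  rewrite -cv1 -cvB; apply: cv_neq0 => /eqP; rewrite subr_eq0 => /eqP h.
  by apply: rs; rewrite r1.
move=> prp prq pq [hp|hq]; first exact: key.
by rewrite -opprB [cv (- _)]/= nrmN; apply: key => // h; apply: pq.
Qed.
Lemma trivial_conj n p (u : 'M[AR]_n) : trivial_proj p -> unitary u -> star u * p%:M * u = p%:M.
Proof.
move=> [->|->] [u1 u2]; first by rewrite raddf0 mulr0 mul0r.
by rewrite -[1%:M]/(1 : 'M[AR]_n) mulr1.
Qed.

(** Nontrivial projections are unitarily equivalent outright. If one of two distinct projections is
    0 or 1, conjugation fixes its amplification; the difference of the amplifications is then always
    a conjugate of that of p - q, of norm at least 1, and cannot tend to 0. *)
Lemma KP_projections p q : projection p -> projection q -> forall n, (0 < n)%N -> KP n p q.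
Proof.
move=> prp prq n n0 [u [uu hu]].
have [<-|pq] := EM (p = q).
  by apply: (approx_unitary_equiv_of_unitary (unitary1 AR)); rewrite star1 mul1r mulr1.
have [triv|ntriv] := EM (trivial_proj p \/ trivial_proj q).
  exfalso; have hr := nrm_trivial_sub prp prq pq triv.
  have [V hV eV] : exists2 V : nat -> 'M[AR]_n, forall m, unitary (V m) &
      forall m, star (u m) * p%:M * u m - q%:M = star (V m) * (p - q)%:M * V m.
    case: triv => h.
      exists (fun=> 1) => m; first exact: unitary1.
      by rewrite (trivial_conj h (uu m)) star1 mul1r mulr1 raddfB.
    exists u => m; first exact: uu.
    by rewrite -[in LHS](trivial_conj h (uu m)) raddfB mulrBr mulrBl.
  have [m /=] := filter_ex (cvgr0_norm_lt _ hu _ ltr01).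
  rewrite eV ger0_norm ?cstar_mxnorm_ge0// => h.
  by have := cstar_mxnorm_unitary n0 (hV m) hr; rewrite leNgt h.
have [p0 p1] : cv p <> 0 /\ cv p <> 1.
  by split=> h; apply: ntriv; left; [left|right]; apply: cv_inj.
have [q0 q1] : cv q <> 0 /\ cv q <> 1.
  by split=> h; apply: ntriv; right; [left|right]; apply: cv_inj.
have [w [hw uw e]] : ueq (@AA R) (cv p) (cv q).
  apply: (ueq_trans (csub_AA R) (AA_projection (cvAA p) (cv_projection prp) p0 p1)).
  exact: (ueq_sym (csub_AA R) (AA_projection (cvAA q) (cv_projection prq) q0 q1)).
apply: (@approx_unitary_equiv_of_unitary _ _ (star (mkA hw : AR))).
  by have [h1 h2] := mk_unitary hw uw; split; rewrite starK.
by rewrite starK; apply: cv_inj; rewrite -e.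
Qed.

Definition uA : AR := mkA (AA_theta (MM_u0 R)).
Definition vA : AR := mkA (AA_theta (MM_v0 R)).
Lemma unitary_uA : unitary uA.
Proof. by apply: mk_unitary; apply: theta_unitary; exact: u0_unitary. Qed.
Lemma unitary_vA : unitary vA.
Proof. by apply: mk_unitary; apply: theta_unitary; exact: v0_unitary. Qed.

Lemma not_equiv_uA_vA : ~ approx_unitary_equiv (@cstar_norm R cA) uA vA.
Proof.
move=> [u [uu hu]].
have e0 : 0 < 10^-1 :> R by rewrite invr_gt0.
have [m /=] := filter_ex (cvgr0_norm_lt _ hu _ e0).
rewrite cstar_normE ger0_norm ?nrm_ge0// => h.
exact: (theta_u0_v0_inequivalent (AA_MM (cvAA (u m))) (cv_unitary (uu m)) (ltW h)).
Qed.

(** The constant 80 counts four entries, each a sum of two terms of norm at most 10 e, where 10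
    bounds the entries of the gauge. *)
Lemma gauge_matrix (e : R) : 0 < e -> exists2 W : 'M[AR]_2, unitary W &
  cstar_mxnorm (star W * uA%:M * W - vA%:M) <= 80 * e.
Proof.
move=> /gauge_exists [W [hW nW gW w1 w2]].
pose V c c' : AR := mkA (AA_theta (hW c c')).
pose b (i : 'I_2) : bool := (i : nat) != 0%N.
have sum2 (F : bool -> AR) : \sum_(k < 2) F (b k) = F false + F true.
  by rewrite !big_ord_recl big_ord0 addr0.
have bb (i j : 'I_2) : (b i == b j) = (i == j) by case: i j => [[|[|i]]] // hi [[|[|j]]].
have thb (d : bool) : theta (d%:R : A) = cv (d%:R : AR).
  have t0 : theta (0 : A) = 0 by rewrite -(subrr (1 : A)) thetaB !subrr.
  by case: d; [exact: theta1|exact: t0].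
have v1 c c' : star (V false c) * V false c' + star (V true c) * V true c' = (c == c')%:R.
  apply: cv_inj; rewrite cvD !cvM !cvS /= -!theta_star -!thetaM -thetaD w1.
  exact: thb.
have v2 c c' : V c false * star (V c' false) + V c true * star (V c' true) = (c == c')%:R.
  apply: cv_inj; rewrite cvD !cvM !cvS /= -!theta_star -!thetaM -thetaD w2.
  exact: thb.
exists (\matrix_(i, j) V (b i) (b j)).
  split; apply/matrixP => i j; rewrite !mxE -bb.
    by under eq_bigr do rewrite !mxE; rewrite (sum2 (fun k => star (V k (b i)) * V k (b j))) v1.
  by under eq_bigr do rewrite !mxE; rewrite (sum2 (fun k => V (b i) k * star (V (b j) k))) v2.
apply: le_trans (cstar_mxnorm_le _) _.
have E (i j : 'I_2) : nrm (cv ((star (\matrix_(i, j) V (b i) (b j)) * uA%:M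
    * (\matrix_(i, j) V (b i) (b j)) - vA%:M : 'M[AR]_2) i j)) <= 20 * e.
  have -> : (star (\matrix_(i, j) V (b i) (b j)) * uA%:M
    * (\matrix_(i, j) V (b i) (b j)) - vA%:M : 'M[AR]_2) i j =
    star (V false (b i)) * (uA * V false (b j) - V false (b j) * vA) +
    star (V true (b i)) * (uA * V true (b j) - V true (b j) * vA).
    rewrite -mulrA [(uA%:M : 'M[AR]_2) * _]mul_scalar_mx !mxE.
    under eq_bigr do rewrite !mxE; rewrite (sum2 (fun k => star (V k (b i)) * (uA * V k (b j)))).
    have -> : vA *+ (i == j) = (b i == b j)%:R * vA by rewrite bb mulr_natl.
    by rewrite -v1 mulrDl !mulrBr opprD addrACA !mulrA.
  rewrite cvD; apply: le_trans (nrmD _ _) _.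
  have B c : nrm (cv (star (V c (b i)) * (uA * V c (b j) - V c (b j) * vA))) <= 10 * e.
    rewrite cvM cvS; apply: le_trans (nrmM _ _) _; rewrite nrm_star cvB !cvM /=.
    by rewrite -!thetaM -thetaB !nrm_theta; apply: ler_pM; rewrite ?nrm_ge0.
  by have := lerD (B false) (B true); lra.
rewrite !big_ord_recl !big_ord0 !addr0.
by have := lerD (lerD (E ord0 ord0) (E ord0 (lift ord0 ord0)))
  (lerD (E (lift ord0 ord0) ord0) (E (lift ord0 ord0) (lift ord0 ord0))); lra.
Qed.
Lemma amplification_uA_vA : amplification_equiv 2 uA vA.
Proof.
have /choice[W hW] (m : nat) : exists W : 'M[AR]_2, unitary W /\
    cstar_mxnorm (star W * uA%:M * W - vA%:M) <= 80 * m.+1%:R^-1.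
  have e0 : 0 < m.+1%:R^-1 :> R by rewrite invr_gt0 ltr0n.
  by have [W] := gauge_matrix e0; exists W.
exists W; split=> [m|]; first exact: (hW m).1.
apply/cvgr0Pnorm_le => e e0.
have [K hK] := archi_inv (divr_gt0 e0 (ltr0Sn R 79)).
exists K => // m /= /hK h; rewrite ger0_norm ?cstar_mxnorm_ge0//.
by apply: le_trans (hW m).2 _; rewrite mulrC -ler_pdivlMr.
Qed.
End KP.

Theorem proposition5p12 (R : realType) :
  exists A : cstarAlgType R,
    simple_cstar A /\ purely_infinite A /\
    (forall p q : ring_of A, projection p -> projection q ->
      forall n : nat, (0 < n)%N -> KP n p q) /\
    (exists u v : ring_of A, unitary u /\ unitary v /\ KP_fails 2 u v).
Proof.
exists (calg R); split; first exact: simple_calg.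
split; first exact: purely_infinite_calg.
split; first exact: KP_projections.
exists (uA R), (vA R); split; first exact: unitary_uA.
split; first exact: unitary_vA.
split; [exact: amplification_uA_vA|exact: not_equiv_uA_vA].
Qed.
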